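(* Let $(M,L)$ be a $C$-reducible Finsler manifold. The following assertions are equivalent: (a) $(M,L)$ is a Berwald manifold; (b) $(M,L)$ is a Landsberg manifold; (c) $(M,L)$ is a general Landsberg manifold.
   Context: Setting. $M$ is a smooth manifold of finite dimension $n$, $\pi:\mathcal{T}M\to M$ is the bundle of nonzero tangent vectors, $\pi^{-1}(TM)\to\mathcal{T}M$ is the pullback of $TM$ by $\pi$, and $\mathfrak{X}(\pi(M))$ is the module of its smooth sections ($\pi$-vector fields, written $\overline{X}$). Tensor fields on the bundle $\pi^{-1}(TM)$ are called $\pi$-tensor fields. $\overline{\eta}(u)=(u,u)$ is the fundamental $\pi$-vector field. $\rho:T(\mathcal{T}M)\to\pi^{-1}(TM)$ is $\rho=(\pi_{\mathcal{T}M},d\pi)$ and $\gamma:\pi^{-1}(TM)\to V(\mathcal{T}M)$ is the natural isomorphism (vertical lift) onto the vertical bundle. $(M,L)$ is a Finsler manifold ($L$ positively homogeneous of degree $1$, smooth on $\mathcal{T}M$, with positive definite metric $g$ on $\pi^{-1}(TM)$ of components $g_{ij}=\frac12\partial^2L^2/\partial y^i\partial y^j$). Put $\ell(\overline{X})=L^{-1}g(\overline{X},\overline{\eta})$ and $\hbar=g-\ell\otimes\ell$. A linear connection $\nabla$ in $\pi^{-1}(TM)$ is regular if, with $K(X)=\nabla_X\overline{\eta}$ and $H(\mathcal{T}M)=\ker K$, one has $T(\mathcal{T}M)=V(\mathcal{T}M)\oplus H(\mathcal{T}M)$; then $\beta=(\rho|_{H(\mathcal{T}M)})^{-1}$. Its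 torsion is $\mathbf{T}(X,Y)=\nabla_X\rho Y-\nabla_Y\rho X-\rho[X,Y]$; put $Q(\overline{X},\overline{Y})=\mathbf{T}(\beta\overline{X},\beta\overline{Y})$ and $T(\overline{X},\overline{Y})=\mathbf{T}(\gamma\overline{X},\beta\overline{Y})$. Throughout, $\nabla$ is the Cartan connection: the unique regular connection with $\nabla g=0$, $Q=0$ and $g(T(\overline{X},\overline{Y}),\overline{Z})=g(T(\overline{X},\overline{Z}),\overline{Y})$. Write $T(\overline{X},\overline{Y},\overline{Z})=g(T(\overline{X},\overline{Y}),\overline{Z})$ (Cartan tensor, components $\frac12\partial g_{ij}/\partial y^k$) and $C(\overline{X})=\mathrm{Tr}\{\overline{Y}\mapsto T(\overline{X},\overline{Y})\}$. Definitions. $(M,L)$ is: - $C$-reducible if $\dim M\ge3$ and $T(\overline{X},\overline{Y},\overline{Z})=\frac{1}{n+1}\{\hbar(\overline{X},\overline{Y})C(\overline{Z})+\hbar(\overline{Y},\overline{Z})C(\overline{X})+\hbar(\overline{Z},\overline{X})C(\overline{Y})\}$; - Berwald if $\nabla_{\beta\overline{X}}T=0$ for all $\overline{X}$; - Landsberg if $\nabla_{\beta\overline{\eta}}T=0$; - general Landsberg if $\nabla_{\beta\overline{\eta}}C=0$. *)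

(* Defs.v *)
From mathcomp Require Import all_boot all_order all_algebra.
From mathcomp Require Import all_classical all_reals all_analysis.
Set Implicit Arguments.
Unset Strict Implicit.
Unset Printing Implicit Defensive.
Import Order.TTheory GRing.Theory Num.Theory.
Import numFieldNormedType.Exports.
Local Open Scope classical_set_scope.
Local Open Scope ring_scope.

(* [f] is of class C^k near [x]. The model spaces below are finite dimensional,
   where this agrees with the usual notion. *)
Fixpoint Ck_at (R : realType) (V W : normedModType R) (k : nat) (f : V -> W)
    (x : V) : Prop :=
  if k is k'.+1 then
    (\forall y \near x, differentiable f y) /\
    (forall v : V, Ck_at k' (fun y => 'D_v f y) x)
  else \forall y \near x, {for y, continuous f}.

Definition smooth_at (R : realType) (V W : normedModType R) (f : V -> W)
    (x : V) : Prop :=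
  forall k, Ck_at k f x.

(* A family of charts indexed by the points: [coord p] is a chart around [p],
   and [cinv p] is its inverse (both are total, with irrelevant values outside
   of the domain, resp. the image, of the chart). The tangent space at [p] is
   the model space [V]: a tangent vector at [p] is represented by its components
   in the chart attached to [p]. *)
Record charted (R : realType) (P : Type) (V : normedModType R) := Charted {
  coord : P -> P -> V ;
  cinv : P -> V -> P }.

(* The change of components at [q], from the chart of [q] to the chart of [p]. *)
Definition tcoord (R : realType) (P : Type) (V : normedModType R)
    (C : charted P V) (p q : P) : V -> V :=
  'd (coord C p \o cinv C q) (coord C q q).

Definition tangent_map (R : realType) (P Q : Type) (V W : normedModType R)
    (C : charted P V) (D : charted Q W) (f : P -> Q) (p : P) : V -> W :=
  'd (coord D (f p) \o f \o cinv C p) (coord C p p).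

Definition dfun (R : realType) (P : Type) (V : normedModType R)
    (C : charted P V) (f : P -> R) (p : P) (v : V) : R :=
  'd (f \o cinv C p : V -> R) (coord C p p) v.

Definition smooth_fun (R : realType) (P : Type) (V : normedModType R)
    (C : charted P V) (D : set P) (f : P -> R) : Prop :=
  forall p, D p -> smooth_at (f \o cinv C p : V -> R) (coord C p p).

(* [X] gives, at each point, components in the chart of that point; they are
   converted here to the fixed chart of [p], where they can be differentiated.
   Likewise for [sec_in] below. *)
Definition vf_in (R : realType) (P : Type) (V : normedModType R)
    (C : charted P V) (X : P -> V) (p : P) : V -> V :=
  fun z => tcoord C p (cinv C p z) (X (cinv C p z)).

Definition smooth_vf (R : realType) (P : Type) (V : normedModType R)
    (C : charted P V) (D : set P) (X : P -> V) : Prop :=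
  forall p, D p -> smooth_at (vf_in C X p) (coord C p p).

Definition lie_bracket (R : realType) (P : Type) (V : normedModType R)
    (C : charted P V) (X Y : P -> V) : P -> V :=
  fun p => 'd (vf_in C Y p) (coord C p p) (X p)
         - 'd (vf_in C X p) (coord C p p) (Y p).

(* Any smooth structure is given by an atlas of this form: choose, for each
   point, one chart of the structure around it. *)
Record manifold (R : realType) (n : nat) := Manifold {
  pt :> topologicalType ;
  charts : charted pt 'rV[R]_n ;
  dom : pt -> set pt ;
  manifold_hausdorff : hausdorff_space pt ;
  manifold_second_countable : second_countable (T := pt) ;
  dom_center : forall p, dom p p ;
  dom_open : forall p, open (dom p) ;
  image_open : forall p, open (coord charts p @` dom p) ;
  coordK : forall p q, dom p q -> cinv charts p (coord charts p q) = q ;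
  coord_continuous : forall p, {within dom p, continuous (coord charts p)} ;
  cinv_continuous : forall p,
    {within coord charts p @` dom p, continuous (cinv charts p)} ;
  transition_smooth : forall p q r, dom p r -> dom q r ->
    smooth_at (coord charts q \o cinv charts p) (coord charts p r) }.

(* The element [(p, v)] of [TM] is the tangent vector at [p] with components [v]
   in the chart of [p]. *)
Definition TM (R : realType) (n : nat) (M : manifold R n) : Type :=
  (M * 'rV[R]_n)%type.

Definition proj (R : realType) (n : nat) (M : manifold R n) (u : TM M) : M :=
  u.1.

Definition slit (R : realType) (n : nat) (M : manifold R n) : set (TM M) :=
  [set u | u.2 != 0].
Arguments slit {R n} M.

(* The chart attached to [u] is the one induced by the chart of M attached to
   the base point of [u], with coordinates (x^i, y^i). *)
Definition tm_charts (R : realType) (n : nat) (M : manifold R n) :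
    charted (TM M) ('rV[R]_n * 'rV[R]_n)%type :=
  let C := charts M in
  Charted
    (fun u w : TM M =>
      (coord C (proj u) (proj w), tcoord C (proj u) (proj w) w.2))
    (fun u z =>
      let q := cinv C (proj u) z.1 in
      (q, 'd (coord C q \o cinv C (proj u)) (z.1) (z.2)) : TM M).

(* The fibre of the pullback bundle over [u] is the tangent space of M at
   [proj u], so that a pi-vector field is a function [TM M -> 'rV[R]_n]; only
   its values on [slit M] matter. *)
Definition sec_in (R : realType) (n : nat) (M : manifold R n)
    (S : TM M -> 'rV[R]_n) (u : TM M) : 'rV[R]_n * 'rV[R]_n -> 'rV[R]_n :=
  fun z => let w := cinv (tm_charts M) u z in
    tcoord (charts M) (proj u) (proj w) (S w).

Definition smooth_sec (R : realType) (n : nat) (M : manifold R n)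
    (S : TM M -> 'rV[R]_n) : Prop :=
  forall u, slit M u -> smooth_at (sec_in S u) (coord (tm_charts M) u u).

Definition eta (R : realType) (n : nat) (M : manifold R n) : TM M -> 'rV[R]_n :=
  fun u => u.2.

Definition rho (R : realType) (n : nat) (M : manifold R n) (u : TM M) :
    'rV[R]_n * 'rV[R]_n -> 'rV[R]_n :=
  tangent_map (tm_charts M) (charts M) (@proj R n M) u.

(* The vertical lift: the differential at [u] of the inclusion into TM of the
   fibre through [u]. *)
Definition gam (R : realType) (n : nat) (M : manifold R n) (u : TM M) :
    'rV[R]_n -> 'rV[R]_n * 'rV[R]_n :=
  'd (fun v : 'rV[R]_n => coord (tm_charts M) u ((proj u, v) : TM M)) (u.2).

Definition vertical (R : realType) (n : nat) (M : manifold R n) (u : TM M) :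
    set ('rV[R]_n * 'rV[R]_n) :=
  [set z | rho u z = 0].

(* g(X, Y) = 1/2 d^2/ds dt L^2(u + s X + t Y) at s = t = 0. *)
Definition metric (R : realType) (n : nat) (M : manifold R n) (L : TM M -> R)
    (u : TM M) (X Y : 'rV[R]_n) : R :=
  2^-1 * 'D_X (fun v : 'rV[R]_n =>
            'D_Y (fun v' : 'rV[R]_n => L (proj u, v') ^+ 2) v) (u.2).

Record finsler (R : realType) (n : nat) (M : manifold R n) (L : TM M -> R) :
    Prop := Finsler {
  finsler_homogeneous : forall (p : M) (v : 'rV[R]_n) (a : R), 0 < a ->
    L (p, a *: v) = a * L (p, v) ;
  finsler_smooth : smooth_fun (tm_charts M) (slit M) L ;
  finsler_posdef : forall u, slit M u -> forall X : 'rV[R]_n, X != 0 ->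
    0 < metric L u X X }.

Definition ell (R : realType) (n : nat) (M : manifold R n) (L : TM M -> R)
    (u : TM M) (X : 'rV[R]_n) : R :=
  (L u)^-1 * metric L u X (eta u).

Definition angular (R : realType) (n : nat) (M : manifold R n) (L : TM M -> R)
    (u : TM M) (X Y : 'rV[R]_n) : R :=
  metric L u X Y - ell L u X * ell L u Y.

(* [nabla u z S] is the covariant derivative, at [u], of the pi-vector field [S]
   in the direction of the tangent vector [z] of TM at [u]. *)
Definition connection_op (R : realType) (n : nat) (M : manifold R n) : Type :=
  TM M -> 'rV[R]_n * 'rV[R]_n -> (TM M -> 'rV[R]_n) -> 'rV[R]_n.

Record linear_connection (R : realType) (n : nat) (M : manifold R n)
    (nabla : connection_op M) : Prop := LinearConnection {
  nabla_linear : forall u, slit M u -> forall S, smooth_sec S ->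
    forall (a : R) z1 z2,
    nabla u (a *: z1 + z2) S = a *: nabla u z1 S + nabla u z2 S ;
  nabla_add : forall u, slit M u -> forall S1 S2,
    smooth_sec S1 -> smooth_sec S2 -> forall z,
    nabla u z (fun w => S1 w + S2 w) = nabla u z S1 + nabla u z S2 ;
  nabla_leibniz : forall u, slit M u -> forall f S,
    smooth_fun (tm_charts M) (slit M) f -> smooth_sec S -> forall z,
    nabla u z (fun w => f w *: S w) =
      f u *: nabla u z S + dfun (tm_charts M) f u z *: S u ;
  nabla_smooth : forall X S,
    smooth_vf (tm_charts M) (slit M) X -> smooth_sec S ->
    smooth_sec (fun u => nabla u (X u) S) }.

(* The kernel of the map K : z |-> nabla_z eta. *)
Definition horizontal (R : realType) (n : nat) (M : manifold R n)
    (nabla : connection_op M) (u : TM M) : set ('rV[R]_n * 'rV[R]_n) :=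
  [set z | nabla u z (@eta R n M) = 0].

Definition regular (R : realType) (n : nat) (M : manifold R n)
    (nabla : connection_op M) : Prop :=
  forall u, slit M u ->
    (forall z, exists v h,
       [/\ vertical u v, horizontal nabla u h & z = v + h]) /\
    (forall z, vertical u z -> horizontal nabla u z -> z = 0).

(* The inverse of the restriction of [rho u] to the horizontal space, when
   [nabla] is regular. *)
Definition beta (R : realType) (n : nat) (M : manifold R n)
    (nabla : connection_op M) (u : TM M) (X : 'rV[R]_n) :
    'rV[R]_n * 'rV[R]_n :=
  xget 0 [set z | horizontal nabla u z /\ rho u z = X].

Definition torsion (R : realType) (n : nat) (M : manifold R n)
    (nabla : connection_op M) (X Y : TM M -> 'rV[R]_n * 'rV[R]_n) :
    TM M -> 'rV[R]_n :=
  fun u => nabla u (X u) (fun w => rho w (Y w))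
         - nabla u (Y u) (fun w => rho w (X w))
         - rho u (lie_bracket (tm_charts M) X Y u).

Definition torsionQ (R : realType) (n : nat) (M : manifold R n)
    (nabla : connection_op M) (X Y : TM M -> 'rV[R]_n) : TM M -> 'rV[R]_n :=
  torsion nabla (fun w => beta nabla w (X w)) (fun w => beta nabla w (Y w)).

Definition torsionT (R : realType) (n : nat) (M : manifold R n)
    (nabla : connection_op M) (X Y : TM M -> 'rV[R]_n) : TM M -> 'rV[R]_n :=
  torsion nabla (fun w => gam w (X w)) (fun w => beta nabla w (Y w)).

Record cartan_connection (R : realType) (n : nat) (M : manifold R n)
    (L : TM M -> R) (nabla : connection_op M) : Prop := CartanConnection {
  cartan_linear : linear_connection nabla ;
  cartan_regular : regular nabla ;
  cartan_metric : forall u, slit M u -> forall z X Y,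
    smooth_sec X -> smooth_sec Y ->
    dfun (tm_charts M) (fun w => metric L w (X w) (Y w)) u z
    - metric L u (nabla u z X) (Y u) - metric L u (X u) (nabla u z Y) = 0 ;
  cartan_Q : forall X Y, smooth_sec X -> smooth_sec Y ->
    forall u, slit M u -> torsionQ nabla X Y u = 0 ;
  cartan_T : forall X Y Z, smooth_sec X -> smooth_sec Y -> smooth_sec Z ->
    forall u, slit M u ->
    metric L u (torsionT nabla X Y u) (Z u) =
    metric L u (torsionT nabla X Z u) (Y u) }.

Definition extension (R : realType) (n : nat) (M : manifold R n) (u : TM M)
    (v : 'rV[R]_n) : TM M -> 'rV[R]_n :=
  xget (fun=> 0) [set S | smooth_sec S /\ S u = v].

(* [torsionT] is linear over the smooth functions, so that this does not depend
   on the chosen extensions of [X] and [Y] to smooth sections. *)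
Definition tensorT (R : realType) (n : nat) (M : manifold R n)
    (nabla : connection_op M) (u : TM M) (X Y : 'rV[R]_n) : 'rV[R]_n :=
  torsionT nabla (extension u X) (extension u Y) u.

Definition formT (R : realType) (n : nat) (M : manifold R n) (L : TM M -> R)
    (nabla : connection_op M) (u : TM M) (X Y Z : 'rV[R]_n) : R :=
  metric L u (tensorT nabla u X Y) Z.

Definition formC (R : realType) (n : nat) (M : manifold R n)
    (nabla : connection_op M) (u : TM M) (X : 'rV[R]_n) : R :=
  \tr (lin1_mx (tensorT nabla u X)).

Definition covT (R : realType) (n : nat) (M : manifold R n)
    (nabla : connection_op M) (u : TM M) (z : 'rV[R]_n * 'rV[R]_n)
    (X Y : TM M -> 'rV[R]_n) : 'rV[R]_n :=
  nabla u z (fun w => tensorT nabla w (X w) (Y w))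
  - tensorT nabla u (nabla u z X) (Y u)
  - tensorT nabla u (X u) (nabla u z Y).

Definition covC (R : realType) (n : nat) (M : manifold R n)
    (nabla : connection_op M) (u : TM M) (z : 'rV[R]_n * 'rV[R]_n)
    (X : TM M -> 'rV[R]_n) : R :=
  dfun (tm_charts M) (fun w => formC nabla w (X w)) u z
  - formC nabla u (nabla u z X).

Definition C_reducible (R : realType) (n : nat) (M : manifold R n)
    (L : TM M -> R) (nabla : connection_op M) : Prop :=
  (3 <= n)%N /\
  forall u, slit M u -> forall X Y Z : 'rV[R]_n,
    formT L nabla u X Y Z =
    (n.+1%:R)^-1 * (angular L u X Y * formC nabla u Z
                  + angular L u Y Z * formC nabla u X
                  + angular L u Z X * formC nabla u Y).

Definition berwald (R : realType) (n : nat) (M : manifold R n)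
    (nabla : connection_op M) : Prop :=
  forall X, smooth_sec X -> forall u, slit M u ->
    forall Y Z, smooth_sec Y -> smooth_sec Z ->
    covT nabla u (beta nabla u (X u)) Y Z = 0.

Definition landsberg (R : realType) (n : nat) (M : manifold R n)
    (nabla : connection_op M) : Prop :=
  forall u, slit M u -> forall Y Z, smooth_sec Y -> smooth_sec Z ->
    covT nabla u (beta nabla u (eta u)) Y Z = 0.

Definition general_landsberg (R : realType) (n : nat) (M : manifold R n)
    (nabla : connection_op M) : Prop :=
  forall u, slit M u -> forall Y, smooth_sec Y ->
    covC nabla u (beta nabla u (eta u)) Y = 0.

(* Main.v *)
(* Differentiating the C-reducibility identity in a horizontal direction, along
   which g and h are parallel, gives
     nabla T = 1/(n+1) (h (x) nabla C, symmetrized);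
   as h is nonzero transversally to eta, T is parallel in a given horizontal
   direction if and only if C is, hence (b) <-> (c).

   For (b) -> (a), let Gamma be the horizontal connection coefficients. Along a
   fibre, the Landsberg condition gives d_X (Gamma_a y) = Gamma_a X, and the
   horizontal derivative of T becomes g(d_Z Gamma_a X, Y), totally symmetric in
   a, X, Y, Z. Together with the identity above this forces it to be
   mu * (h (x) h, symmetrized) for some scalar mu. Since d_W d_Z Gamma is
   symmetric in W and Z, a further vertical differentiation gives mu * C = 0.
   If mu were nonzero at some point, it would be nonzero nearby, so C would
   vanish nearby, hence nabla C and nabla T too: a contradiction. *)
From HB Require Import structures.
Require Import Defs.
From mathcomp Require Import all_boot all_order all_algebra.
From mathcomp Require Import all_classical all_reals all_analysis.
From mathcomp Require Import ring lra.
Set Implicit Arguments.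
Unset Strict Implicit.
Unset Printing Implicit Defensive.
Import Order.TTheory GRing.Theory Num.Theory.
Import numFieldNormedType.Exports.
Local Open Scope classical_set_scope.
Local Open Scope ring_scope.

(** * Maps of class C^k *)

(** The connection is only an operator on global sections over [TM M], zero vectors included, so
    even its locality has to be proved. Smooth bump functions, extended by zero thanks to the
    Hausdorff property, turn it into coefficients [christoffel] in each chart. The implication from
    Landsberg to Berwald then takes place in a single fibre. At a fixed base point the metric, the
    Cartan tensor, their base derivatives and the horizontal coefficients are functions of [y != 0]
    alone. A horizontal derivative is a given base derivative corrected by a fibre derivative, so
    only fibre calculus remains. The Koszul formula explains the role of the Landsberg condition:
    the spray [Ga y y y] always has fibre derivative [2 Ga y X y], and under that condition a second
    derivative gives [2 Ga y a X], that is, Berwald and Cartan coefficients agree. Their fibre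
    derivative is thus a third derivative of one map, whence its total symmetry. In the last step
    [mu] is a function of [y], whose derivative must be eliminated together with [C]. This takes a
    vector orthogonal to both [y] and a given vector, which exists because the dimension is at least
    3. *)

Section Differentiation.
Context {R : realType}.
Implicit Types U V W : normedModType R.

Lemma diff_eps V W (f : V -> W) (df : {linear V -> W}) x :
  continuous df ->
  (forall e : R, 0 < e -> \forall h \near 0, `|f (h + x) - f x - df h| <= e * `|h|) ->
  differentiable f x /\ 'd f x = df :> (V -> W).
Proof.
move=> dfc H.
have Hx : f \o shift x = cst (f x) + df +o_ 0 id.
  apply/eqaddoP => e e0; near=> h.
  rewrite /= (_ : (_ - _) h = f (h + x) - f x - df h); first by near: h; exact: H.
  by rewrite /= opprD addrA.
have E := diff_unique dfc Hx.
by split=> //; apply/diff_locallyP; split; rewrite E.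
Unshelve. all: by end_near. Qed.

Lemma near_eq_diff V W (f g : V -> W) x :
  (\forall y \near x, f y = g y) -> differentiable f x ->
  differentiable g x /\ 'd g x = 'd f x :> (V -> W).
Proof.
move=> fg df; apply: diff_eps; first exact: diff_continuous.
move=> e e0.
have /diff_locally/eqaddoP/(_ e e0) H := df.
have fg0 : \forall h \near (0 : V), f (h + x) = g (h + x).
  by move: fg; rewrite (near_shift 0); apply: filterS => h /=; rewrite subr0.
rewrite -(nbhs_singleton fg); near=> h.
rewrite -(near fg0 h)//.
have : `|(f \o shift x - (cst (f x) + 'd f x)) h| <= e * `|h| by near: h.
by rewrite /= opprD addrA.
Unshelve. all: by end_near. Qed.

Lemma near_eq_differentiable V W (f g : V -> W) x :
  (\forall y \near x, f y = g y) -> differentiable f x -> differentiable g x.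
Proof. by move=> fg /(near_eq_diff fg)[]. Qed.

Lemma near_eq_diffE V W (f g : V -> W) x :
  (\forall y \near x, f y = g y) -> differentiable f x ->
  'd g x = 'd f x :> (V -> W).
Proof. by move=> fg /(near_eq_diff fg)[]. Qed.

(** An equality near [x] also holds near each point close to [x], so it passes to directional
    derivatives and the induction closes. *)
Lemma Ck_at_near V W k (f g : V -> W) x :
  (\forall y \near x, f y = g y) -> Ck_at k f x -> Ck_at k g x.
Proof.
elim: k f g => [|k IH] f g /near_join fg /=.
  move=> fc; near=> y.
  have E : \forall z \near y, f z = g z by near: y.
  have /= : {for y, continuous f} by near: y.
  rewrite /prop_for /continuous_at -(nbhs_singleton E); apply: cvg_trans.
  exact: near_eq_cvg.
move=> [df Dk]; split.
  near=> y; have E : \forall z \near y, f z = g z by near: y.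
  by apply: near_eq_differentiable E _; near: y.
move=> v; apply: IH (Dk v); near=> y.
by apply: near_eq_derive; near: y.
Unshelve. all: by end_near. Qed.

Lemma Ck_at_S V W k (f : V -> W) x : Ck_at k.+1 f x -> Ck_at k f x.
Proof.
elim: k f => [|k IH] f /=.
  by move=> [df _]; apply: filterS df => y; exact: differentiable_continuous.
by move=> [df H]; split=> // v; apply: IH; exact: H.
Qed.

Lemma Ck_at_le V W k l (f : V -> W) x : (l <= k)%N -> Ck_at k f x -> Ck_at l f x.
Proof.
move=> /subnK <-; elim: (k - l)%N => // m IH; rewrite addSn => /Ck_at_S; exact: IH.
Qed.

Lemma Ck_at_continuous V W k (f : V -> W) x : Ck_at k f x -> {for x, continuous f}.
Proof. by move=> /(Ck_at_le (leq0n k)) /= /nbhs_singleton. Qed.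

Lemma Ck_at_diff V W k (f : V -> W) x :
  Ck_at k.+1 f x -> \forall y \near x, differentiable f y.
Proof. by case. Qed.

Lemma Ck_at_cst V W k (a : W) (x : V) : Ck_at k (cst a) x.
Proof.
elim: k a => [|k IH] a /=; first by near=> y; exact: cst_continuous.
split; first by near=> y; exact: differentiable_cst.
move=> v; apply: Ck_at_near (IH 0); near=> y; by rewrite derive_cst.
Unshelve. all: by end_near. Qed.

Lemma Ck_at_linear V W k (f : {linear V -> W}) (x : V) : continuous f -> Ck_at k f x.
Proof.
move=> fc; case: k => [|k] /=; first by near=> y; exact: fc.
split; first by near=> y; exact: linear_differentiable.
move=> v; apply: Ck_at_near (Ck_at_cst k (f v) x); near=> y.
by rewrite deriveE; [rewrite diff_lin|exact: linear_differentiable].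
Unshelve. all: by end_near. Qed.

Lemma Ck_at_add V W k (f g : V -> W) x :
  Ck_at k f x -> Ck_at k g x -> Ck_at k (fun y => f y + g y) x.
Proof.
elim: k f g => [|k IH] f g /=.
  move=> fc gc; near=> y; apply: continuousD; [by near: y|by near: y].
move=> [df Df] [dg Dg]; split.
  near=> y; apply: differentiableD; [by near: y|by near: y].
move=> v; apply: Ck_at_near (IH _ _ (Df v) (Dg v)); near=> y.
by rewrite -deriveD //; apply: diff_derivable; near: y.
Unshelve. all: by end_near. Qed.

Lemma scale_is_bilinear W :
  bilinear_for (GRing.Scale.Law.clone _ _ *:%R _)
    (GRing.Scale.Law.clone _ _ *:%R _) (@GRing.scale R W : R -> W -> W).
Proof.
split=> [u'|u] a x y /=; first by rewrite scalerDl scalerA.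
by rewrite scalerDr !scalerA mulrC.
Qed.
Lemma is_diff_scale V W (f : V -> R) (g : V -> W) x :
  differentiable f x -> differentiable g x ->
  differentiable (fun y => f y *: g y) x /\
  'd (fun y => f y *: g y) x = (fun v => 'd f x v *: g x + f x *: 'd g x v) :> (V -> W).
Proof.
move=> df dg.
pose F : {bilinear R -> W -> W} := HB.pack (@GRing.scale R W)
  (bilinear_isBilinear.Build R R W W _ _ (@GRing.scale R W) (scale_is_bilinear W)).
have Fc : continuous (fun p => F p.1 p.2) by move=> p; exact: scale_continuous.
have E : (fun y => f y *: g y) = (fun p => F p.1 p.2) \o (fun y => (f y, g y)) by [].
have dp : differentiable (fun y => (f y, g y)) x by exact: differentiable_pair.
have dF : differentiable (fun p => F p.1 p.2) (f x, g x).
  exact: differentiable_bilin.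
split; first by rewrite E; exact: differentiable_comp.
rewrite E diff_comp// diff_bilin//= diff_pair//.
by apply/funext => v /=; rewrite addrC.
Qed.

Lemma differentiable_scale V W (f : V -> R) (g : V -> W) x :
  differentiable f x -> differentiable g x -> differentiable (fun y => f y *: g y) x.
Proof. by move=> df dg; have [] := is_diff_scale df dg. Qed.

Lemma diff_scale V W (f : V -> R) (g : V -> W) x v :
  differentiable f x -> differentiable g x ->
  'd (fun y => f y *: g y) x v = 'd f x v *: g x + f x *: 'd g x v.
Proof. by move=> df dg; have [_ ->] := is_diff_scale df dg. Qed.

Lemma Ck_at_scale V W k (f : V -> R) (g : V -> W) x :
  Ck_at k f x -> Ck_at k g x -> Ck_at k (fun y => f y *: g y) x.
Proof.
elim: k f g => [|k IH] f g /=.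
  move=> fc gc; near=> y.
  by apply: (@cvgZ _ _ _ _ _ f g (f y) (g y)); near: y.
move=> [df Df] [dg Dg].
split; first by near=> y; apply: differentiable_scale; near: y.
move=> v; apply: Ck_at_near (Ck_at_add (IH _ _ (Df v) (Ck_at_S (conj dg Dg)))
  (IH _ _ (Ck_at_S (conj df Df)) (Dg v))).
near=> y; have dfy : differentiable f y by near: y.
have dgy : differentiable g y by near: y.
by rewrite !deriveE ?diff_scale//; exact: differentiable_scale.
Unshelve. all: by end_near. Qed.

Lemma derive_linear_comp U V W (c : {linear V -> W}) (f : U -> V) x v :
  continuous c -> differentiable f x -> 'D_v (c \o f) x = c ('D_v f x).
Proof.
move=> cc df; rewrite !deriveE//; last first.
  by apply: differentiable_comp => //; exact: linear_differentiable.
by rewrite diff_comp//= ?diff_lin//; exact: linear_differentiable.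
Qed.

Lemma Ck_at_linear_comp U V W k (c : {linear V -> W}) (f : U -> V) x :
  continuous c -> Ck_at k f x -> Ck_at k (c \o f) x.
Proof.
move=> cc; elim: k f => [|k IH] f /=.
  by move=> fc; near=> y; apply: continuous_comp; [near: y|exact: cc].
move=> [df Df]; split.
  near=> y; apply: differentiable_comp; [by near: y|exact: linear_differentiable].
move=> v; apply: Ck_at_near (IH _ (Df v)); near=> y.
by rewrite derive_linear_comp//; near: y.
Unshelve. all: by end_near. Qed.

Lemma Ck_at_mul V k (f g : V -> R) x :
  Ck_at k f x -> Ck_at k g x -> Ck_at k (fun y => f y * g y) x.
Proof. exact: Ck_at_scale. Qed.

Lemma Ck_at_opp V W k (f : V -> W) x : Ck_at k f x -> Ck_at k (fun y => - f y) x.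
Proof.
move=> /(Ck_at_scale (@Ck_at_cst V R k (-1) x)); apply: Ck_at_near.
by near=> y; rewrite scaleN1r.
Unshelve. all: by end_near. Qed.

Lemma Ck_at_sum V W k (I : Type) (r : seq I) (P : pred I) (f : I -> V -> W) x :
  (forall i, P i -> Ck_at k (f i) x) -> Ck_at k (fun y => \sum_(i <- r | P i) f i y) x.
Proof.
move=> H; elim: r => [|i r IH].
  rewrite (_ : (fun y => _) = cst 0); first exact: Ck_at_cst.
  by apply/funext => y; rewrite big_nil.
have [Pi|nPi] := boolP (P i).
  rewrite (_ : (fun y => _) = fun y => f i y + \sum_(j <- r | P j) f j y).
    by apply: Ck_at_add => //; exact: H.
  by apply/funext => y; rewrite big_cons Pi.
rewrite (_ : (fun y => _) = fun y => \sum_(j <- r | P j) f j y)//.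
by apply/funext => y; rewrite big_cons (negbTE nPi).
Qed.

Lemma Ck_at_prod V k (I : Type) (r : seq I) (P : pred I) (f : I -> V -> R) x :
  (forall i, P i -> Ck_at k (f i) x) -> Ck_at k (fun y => \prod_(i <- r | P i) f i y) x.
Proof.
move=> H; elim: r => [|i r IH].
  rewrite (_ : (fun y => _) = cst 1); first exact: Ck_at_cst.
  by apply/funext => y; rewrite big_nil.
have [Pi|nPi] := boolP (P i).
  rewrite (_ : (fun y => _) = fun y => f i y * \prod_(j <- r | P j) f j y).
    by apply: Ck_at_mul => //; exact: H.
  by apply/funext => y; rewrite big_cons Pi.
rewrite (_ : (fun y => _) = fun y => \prod_(j <- r | P j) f j y)//.
by apply/funext => y; rewrite big_cons (negbTE nPi).
Qed.

Lemma Ck_at_inv V k (f : V -> R) x : f x != 0 ->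
  Ck_at k f x -> Ck_at k (fun y => (f y)^-1) x.
Proof.
move=> fx0; elim: k => [|k IH] fk; have f0 : \forall y \near x, f y != 0 by
  apply: cvgr_neq0 fx0; exact: Ck_at_continuous fk.
  move: fk => /= fc; near=> y; have fy0 : f y != 0 by near: y.
  by apply: (cvgV fy0); near: y.
have [df Df] := fk; split.
  near=> y; have dfy : differentiable f y by near: y.
  by apply: differentiableV => //; near: y.
have IHk := IH (Ck_at_S fk).
move=> v; apply: Ck_at_near (Ck_at_mul (Ck_at_opp (Ck_at_mul IHk IHk)) (Df v)).
near=> y; have dfy : differentiable f y by near: y.
have fy0 : f y != 0 by near: y.
rewrite [RHS]deriveV//; last exact: diff_derivable.
by rewrite expr2 invfM.
Unshelve. all: by end_near. Qed.

(** [Ck_at] only speaks of derivatives in fixed directions, while the chain rule differentiates the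
    outer map in the moving direction ['D_v f y]. Expanding that direction with continuous
    coordinate forms brings it back to fixed ones. *)
Definition finite_basis V := exists (m : nat) (e : 'I_m -> V) (c : 'I_m -> {linear V -> R}),
  (forall i, continuous (c i)) /\ forall v, v = \sum_i c i v *: e i.

Lemma Ck_at_comp U V W k (f : U -> V) (g : V -> W) x : finite_basis V ->
  Ck_at k f x -> Ck_at k g (f x) -> Ck_at k (g \o f) x.
Proof.
move=> [m [e [c [cc ce]]]]; elim: k g => [|k IH] g.
  move=> fk gk; have fc := Ck_at_continuous fk; move: fk gk => /= fk gk.
  have gk' : \forall y \near x, {for f y, continuous g} by apply: fc gk.
  by near=> y; apply: continuous_comp; near: y.
move=> fk [dg Dg]; have fc := Ck_at_continuous fk; have [df Df] := fk.
have dg' : \forall y \near x, differentiable g (f y) by apply: fc dg.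
split.
  near=> y; have dfy : differentiable f y by near: y.
  by apply: differentiable_comp => //; near: y.
move=> v.
have : Ck_at k (fun y => \sum_i c i ('D_v f y) *: ('D_(e i) g \o f) y) x.
  apply: Ck_at_sum => i _; apply: Ck_at_scale; last first.
    exact: IH (Ck_at_S fk) (Dg (e i)).
  exact: (Ck_at_linear_comp (cc i) (Df v)).
apply: Ck_at_near; near=> y.
have dfy : differentiable f y by near: y.
have dgy : differentiable g (f y) by near: y.
rewrite [RHS]deriveE; last exact: differentiable_comp.
rewrite diff_comp//= -(deriveE v dfy) [X in 'd g _ X]ce linear_sum.
by apply: eq_bigr => i _; rewrite linearZ/=; congr (_ *: _); rewrite -deriveE.
Unshelve. all: by end_near. Qed.

End Differentiation.

(** * Symmetry of second derivatives *)

Section Schwarz.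
Context {R : realType}.
Implicit Types U V W : normedModType R.

Lemma is_derive_line V (f : V -> R) (a u : V) (s : R) :
  differentiable f (a + s *: u) ->
  is_derive s 1 (fun t => f (a + t *: u)) ('D_u f (a + s *: u)).
Proof.
move=> df.
have dl : is_diff s (fun t : R => a + t *: u) (fun t => t *: u).
  apply: is_diff_eq.
  by rewrite add0r.
have dc : differentiable (f \o (fun t : R => a + t *: u)) s.
  by apply: differentiable_comp.
have -> : (fun t => f (a + t *: u)) = f \o (fun t : R => a + t *: u) by [].
apply: DeriveDef; first exact: diff_derivable.
rewrite !deriveE// diff_comp//=.
by rewrite diff_val scale1r.
Qed.

Lemma mvt_line V (f : V -> R) (a u : V) (h : R) : 0 < h ->
  (forall s : R, 0 <= s <= h -> differentiable f (a + s *: u)) ->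
  exists2 s : R, 0 <= s <= h & f (a + h *: u) - f a = h * 'D_u f (a + s *: u).
Proof.
move=> h0 df.
pose g t := f (a + t *: u).
have [||s sI E] := @MVT R g (fun s => 'D_u f (a + s *: u)) 0 h h0.
- move=> x; rewrite in_itv/= => /andP[x0 xh]; apply: is_derive_line.
  by apply: df; rewrite !ltW.
- apply: derivable_within_continuous => x; rewrite in_itv/= => xI.
  by have [] := is_derive_line (df x xI).
exists s; first by move: sI; rewrite in_itv/= => /andP[? ?]; rewrite !ltW.
by move: E; rewrite /g scale0r addr0 subr0 mulrC.
Qed.

(** The mean value theorem is applied twice to the second difference: along [u] to the increment [F]
    in the direction [v], then along [v] to ['D_u f]. *)
Lemma mvt_square V (f : V -> R) (a u v : V) (h : R) : 0 < h ->
  (forall s t : R, 0 <= s <= h -> 0 <= t <= h -> differentiable f (a + s *: u + t *: v)) ->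
  (forall s t : R, 0 <= s <= h -> 0 <= t <= h ->
     differentiable ('D_u f) (a + s *: u + t *: v)) ->
  exists s t : R, [/\ 0 <= s <= h, 0 <= t <= h &
    f (a + h *: u + h *: v) - f (a + h *: u) - (f (a + h *: v) - f a) =
    h * (h * 'D_v ('D_u f) (a + s *: u + t *: v))].
Proof.
move=> h0 df dDf.
have h0h : (0 : R) <= 0 <= h by rewrite lexx ltW.
have hhh : (0 : R) <= h <= h by rewrite lexx ltW.
pose F z := f (z + h *: v) - f z.
have dF s : 0 <= s <= h -> is_diff (a + s *: u) F
    (fun w => 'd f (a + s *: u + h *: v) w - 'd f (a + s *: u) w).
  move=> sI; have d1 := df _ _ sI hhh.
  have := df _ _ sI h0h; rewrite scale0r addr0 => d2.
  have d3 : is_diff (a + s *: u) (fun z => z + h *: v) id.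
    by apply: is_diff_eq; rewrite addr0.
  have d4 : is_diff (a + s *: u + h *: v) f ('d f (a + s *: u + h *: v)).
    exact: differentiableP.
  have d5 : is_diff (a + s *: u) f ('d f (a + s *: u)) by exact: differentiableP.
  have d6 := @is_diff_comp _ _ _ _ _ _ _ _ _ d3 d4.
  have := @is_diffB _ _ _ _ _ _ _ _ d6 d5.
  by apply.
have [s sI E] : exists2 s : R, 0 <= s <= h & F (a + h *: u) - F a = h * 'D_u F (a + s *: u).
  by apply: mvt_line => // s sI; have [] := dF s sI.
have [t tI E2] : exists2 t : R, 0 <= t <= h & 'D_u f (a + s *: u + h *: v) - 'D_u f (a + s *: u)
    = h * 'D_v ('D_u f) (a + s *: u + t *: v).
  exact: (@mvt_line V ('D_u f) _ v h h0 (fun t tI => dDf s t sI tI)).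
exists s, t; split=> //; rewrite -E2; transitivity (F (a + h *: u) - F a) => //.
rewrite E; congr (_ * _); have [dFs dFE] := dF s sI.
have d1 := df _ _ sI hhh.
have := df _ _ sI h0h; rewrite scale0r addr0 => d2.
by rewrite deriveE// dFE -!deriveE.
Qed.

Lemma near_square V (P : set V) (a u v : V) : (\forall z \near a, P z) ->
  exists2 h : R, 0 < h & forall s t : R, 0 <= s <= h -> 0 <= t <= h -> P (a + s *: u + t *: v).
Proof.
move=> /nbhs_ballP[e /= e0 He].
(* With sides at most [e / M / 2] the displacement stays below [e / 2]; the summand 1 keeps [M]
   positive when both vectors vanish. *)
pose M := `|u| + `|v| + 1.
have M0 : 0 < M by rewrite ltr_pwDr// addr_ge0.
exists (e / M / 2); first by rewrite !divr_gt0.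
move=> s t /andP[s0 sh] /andP[t0 th]; apply: He.
rewrite -ball_normE /ball_/= opprD addrA opprD addrA subrr add0r -opprD normrN.
apply: le_lt_trans (ler_normD _ _) _; rewrite !normrZ !ger0_norm//.
have Hu : s * `|u| <= e / M / 2 * `|u| by rewrite ler_wpM2r.
have Hv : t * `|v| <= e / M / 2 * `|v| by rewrite ler_wpM2r.
apply: le_lt_trans (lerD Hu Hv) _; rewrite -mulrDr.
apply: (@le_lt_trans _ _ (e / M / 2 * M)).
  by apply: ler_wpM2l; [rewrite ltW// !divr_gt0|rewrite /M lerDl].
have -> : e / M / 2 * M = e / 2 by field; rewrite gt_eqF.
by rewrite ltr_pdivrMr// ltr_pMr// ltr1n.
Qed.

Lemma dist_half (p q r e : R) : `|p - r| < e / 2 -> `|q - r| < e / 2 -> `|q - p| <= e.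
Proof.
move=> A1 A2; rewrite (splitr e) -(subrKA r); apply: le_trans (ler_normD _ _) _.
by rewrite lerD ?ltW// distrC.
Qed.

(** The second difference over a small parallelogram is symmetric in [u] and [v]. It equals [h * h]
    times either mixed derivative at suitable points of the parallelogram, and continuity of both at
    [x] makes the values there differ by at most any [e > 0]. *)
Lemma schwarz V (f : V -> R) (x u v : V) : Ck_at 2 f x ->
  'D_u ('D_v f) x = 'D_v ('D_u f) x.
Proof.
move=> f2.
have /= [df Df] := f2.
have [dDu /(_ v) cvu] := Df u; have [dDv /(_ u) cuv] := Df v.
have {}cvu := nbhs_singleton cvu; have {}cuv := nbhs_singleton cuv.
apply/eqP; rewrite -subr_eq0 -normr_le0; apply/ler_addgt0Pl => e e0; rewrite addr0.
have e20 : 0 < e / 2 by rewrite divr_gt0.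
move/cvgrPdist_lt : cvu => /(_ _ e20) cvu.
move/cvgrPdist_lt : cuv => /(_ _ e20) cuv.
have [h h0 H] : exists2 h : R, 0 < h & forall s t : R, 0 <= s <= h -> 0 <= t <= h ->
    [/\ differentiable f (x + s *: u + t *: v),
     differentiable ('D_u f) (x + s *: u + t *: v),
     differentiable ('D_v f) (x + s *: u + t *: v),
     `|'D_v ('D_u f) x - 'D_v ('D_u f) (x + s *: u + t *: v)| < e / 2 &
     `|'D_u ('D_v f) x - 'D_u ('D_v f) (x + s *: u + t *: v)| < e / 2].
  apply: (@near_square _ (fun z => [/\ differentiable f z, differentiable ('D_u f) z,
    differentiable ('D_v f) z, `|'D_v ('D_u f) x - 'D_v ('D_u f) z| < e / 2 &
     `|'D_u ('D_v f) x - 'D_u ('D_v f) z| < e / 2])).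
  apply: filterS (filterI df (filterI dDu (filterI dDv (filterI cvu cuv)))) => z.
  by move=> [H1 [H2 [H3 [H4 H5]]]]; exact: (And5 H1 H2 H3 H4 H5).
have [||s [t [sI tI E]]] := @mvt_square _ f x u v h h0.
- by move=> s t sI tI; have [] := H _ _ sI tI.
- by move=> s t sI tI; have [] := H _ _ sI tI.
have [||s' [t' [sI' tI' E']]] := @mvt_square _ f x v u h h0.
- by move=> s' t' sI' tI'; rewrite addrAC; have [] := H _ _ tI' sI'.
- by move=> s' t' sI' tI'; rewrite addrAC; have [] := H _ _ tI' sI'.
have EE : 'D_v ('D_u f) (x + s *: u + t *: v) = 'D_u ('D_v f) (x + t' *: u + s' *: v).
  apply: (mulfI (lt0r_neq0 h0)); apply: (mulfI (lt0r_neq0 h0)).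
  rewrite -E (addrAC x (t' *: u) (s' *: v)) -E' (addrAC x (h *: v) (h *: u)).
  by rewrite !opprB addrACA [RHS]addrACA; congr (_ + _); rewrite addrC.
have [_ _ _ A1 _] := H _ _ sI tI; have [_ _ _ _ A2] := H _ _ tI' sI'.
rewrite EE in A1.
exact: dist_half A1 A2.
Qed.

End Schwarz.

(** * Smooth maps between row spaces and their products *)

Section Smooth.
Context {R : realType}.
Implicit Types U V W : normedModType R.

Fact coordinate_linear m n (i : 'I_m) (j : 'I_n) :
  linear (fun A : 'M[R]_(m, n) => A i j : R).
Proof. by move=> a u v; rewrite !mxE. Qed.
Definition coordinate m n i j : {linear 'M[R]_(m, n) -> R} :=
  HB.pack (fun A : 'M[R]_(m, n) => A i j : R)
    (GRing.isLinear.Build _ _ _ _ _ (coordinate_linear i j)).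

Lemma coordinateE m n i j (A : 'M[R]_(m, n)) : coordinate i j A = A i j.
Proof. by []. Qed.

Lemma coordinate_continuous m n i j : continuous (@coordinate m n i j).
Proof. exact: coord_continuous. Qed.

Fact linfst_linear V W : linear (fst : V * W -> V). Proof. by []. Qed.
Definition linfst V W : {linear (V * W)%type -> V} :=
  HB.pack (fst : V * W -> V) (GRing.isLinear.Build _ _ _ _ _ (@linfst_linear V W)).
Fact linsnd_linear V W : linear (snd : V * W -> W). Proof. by []. Qed.
Definition linsnd V W : {linear (V * W)%type -> W} :=
  HB.pack (snd : V * W -> W) (GRing.isLinear.Build _ _ _ _ _ (@linsnd_linear V W)).

Lemma linfst_continuous V W : continuous (@linfst V W).
Proof. by move=> z; exact: cvg_fst. Qed.
Lemma linsnd_continuous V W : continuous (@linsnd V W).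
Proof. by move=> z; exact: cvg_snd. Qed.

Lemma finite_basis_R : @finite_basis R R.
Proof.
exists 1%N, (fun=> 1), (fun=> idfun); split=> [_ x //|v].
by rewrite big_ord1 /= /GRing.scale /= mulr1.
Qed.

Lemma finite_basis_rV n : finite_basis 'rV[R]_n.
Proof.
exists n, (delta_mx 0), (coordinate 0); split; first exact: coordinate_continuous.
exact: row_sum_delta.
Qed.

Lemma finite_basis_prod V W : finite_basis V -> finite_basis W ->
  finite_basis (V * W)%type.
Proof.
move=> [m [e [c [cc ce]]]] [m' [e' [c' [cc' ce']]]].
exists (m + m')%N.
exists (fun i : 'I_(m + m') => match fintype.split i with inl j => (e j, 0) | inr j => (0, e' j) end).
exists (fun i : 'I_(m + m') => match fintype.split i with inl j => c j \o @linfst V W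
  | inr j => c' j \o @linsnd V W end : {linear _ -> _}).
split.
  move=> i; case: (fintype.split i) => j x /=; apply: continuous_comp.
  - exact: linfst_continuous.
  - exact: cc.
  - exact: linsnd_continuous.
  - exact: cc'.
move=> [v w]; rewrite big_split_ord /=.
under eq_bigr do rewrite (unsplitK (inl _)) /=.
under [X in _ + X]eq_bigr do rewrite (unsplitK (inr _)) /=.
have E1 (u : 'I_m -> V) : \sum_i (u i, 0 : W) = (\sum_i u i, 0).
  elim/big_rec2 : _ => // i y1 _ _ ->.
  by transitivity (u i + y1, (0 : W) + 0) => //; rewrite addr0.
have E2 (u : 'I_m' -> W) : \sum_i (0 : V, u i) = (0, \sum_i u i).
  elim/big_rec2 : _ => // i y1 _ _ ->.
  by transitivity ((0 : V) + 0, u i + y1) => //; rewrite addr0.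
rewrite (eq_bigr (fun i => (c i v *: e i, 0))); last first.
  by move=> i _; transitivity (c i v *: e i, c i v *: (0 : W)) => //; rewrite scaler0.
rewrite [X in _ + X](eq_bigr (fun i => (0, c' i w *: e' i))); last first.
  by move=> i _; transitivity (c' i w *: (0 : V), c' i w *: e' i) => //; rewrite scaler0.
rewrite E1 E2 -ce -ce'; transitivity (v + 0, 0 + w) => //.
by rewrite addr0 add0r.
Qed.

Lemma finite_basis_rVrV n : finite_basis ('rV[R]_n * 'rV[R]_n)%type.
Proof. by apply: finite_basis_prod; exact: finite_basis_rV. Qed.

Lemma Ck_at_pair U V W k (f : U -> V) (g : U -> W) x :
  Ck_at k f x -> Ck_at k g x -> Ck_at k (fun y => (f y, g y)) x.
Proof.
elim: k f g => [|k IH] f g /=.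
  by move=> fc gc; near=> y; apply: (@cvg_pair _ _ _ _ (nbhs (f y)) (nbhs (g y))); near: y.
move=> [df Df] [dg Dg]; split.
  by near=> y; apply: differentiable_pair; near: y.
move=> v; apply: Ck_at_near (IH _ _ (Df v) (Dg v)); near=> y.
have dfy : differentiable f y by near: y.
have dgy : differentiable g y by near: y.
by rewrite !deriveE ?diff_pair//; exact: differentiable_pair.
Unshelve. all: by end_near. Qed.

Lemma Ck_at_mx V k m n (f : V -> 'M[R]_(m, n)) x :
  (forall i j, Ck_at k (fun y => f y i j) x) -> Ck_at k f x.
Proof.
move=> H; have : Ck_at k (fun y => \sum_i \sum_j f y i j *: (delta_mx i j : 'M[R]_(m, n))) x.
  apply: Ck_at_sum => i _; apply: Ck_at_sum => j _.
  by apply: Ck_at_scale => //; exact: Ck_at_cst.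
by apply: Ck_at_near; near=> y; rewrite -matrix_sum_delta.
Unshelve. all: by end_near. Qed.

Lemma Ck_at_rV V k n (f : V -> 'rV[R]_n) x :
  (forall j, Ck_at k (fun y => f y 0 j) x) -> Ck_at k f x.
Proof. by move=> H; apply: Ck_at_mx => i j; rewrite ord1. Qed.

Lemma Ck_at_coord V k m n (f : V -> 'M[R]_(m, n)) x i j :
  Ck_at k f x -> Ck_at k (fun y => f y i j) x.
Proof. exact/(@Ck_at_linear_comp _ _ _ _ _ (coordinate i j))/coordinate_continuous. Qed.

Lemma Ck_at_det V k n (A : V -> 'M[R]_n) x :
  (forall i j, Ck_at k (fun y => A y i j) x) -> Ck_at k (fun y => \det (A y)) x.
Proof.
move=> H; rewrite /determinant; apply: Ck_at_sum => s _.
apply: Ck_at_mul; first exact: Ck_at_cst.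
by apply: Ck_at_prod => i _; exact: H.
Qed.

Lemma Ck_at_mulmx V k m n p (A : V -> 'M[R]_(m, n)) (B : V -> 'M[R]_(n, p)) x :
  Ck_at k A x -> Ck_at k B x -> Ck_at k (fun y => A y *m B y) x.
Proof.
move=> HA HB; apply: Ck_at_mx => i j.
rewrite (_ : (fun y => _) = fun y => \sum_l A y i l * B y l j); last first.
  by apply/funext => y; rewrite mxE.
by apply: Ck_at_sum => l _; apply: Ck_at_mul; exact: Ck_at_coord.
Qed.

(* Cramer's rule: the inverse matrix is a rational function of the entries. *)
Lemma Ck_at_solve V k n (A : V -> 'M[R]_n) (s b : V -> 'rV[R]_n) x :
  A x \in unitmx -> Ck_at k A x -> Ck_at k b x ->
  (\forall y \near x, s y *m A y = b y) -> Ck_at k s x.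
Proof.
move=> Ax HA Hb sA.
have HAij i j : Ck_at k (fun y => A y i j) x by exact: Ck_at_coord.
have dA : Ck_at k (fun y => \det (A y)) x by exact: Ck_at_det.
have d0 : \det (A x) != 0 by move: Ax; rewrite unitmxE unitfE.
have adjA : Ck_at k (fun y => \adj (A y)) x.
  apply: Ck_at_mx => i j.
  rewrite (_ : (fun y => _) = fun y => cofactor (A y) j i); last first.
    by apply/funext => y; rewrite mxE.
  apply: Ck_at_mul; first exact: Ck_at_cst.
  apply: Ck_at_det => i' j'.
  rewrite (_ : (fun y => _) = fun y => A y (lift j i') (lift i j')) //.
  by apply/funext => y; rewrite !mxE.
have /Ck_at_near : Ck_at k (fun y => (\det (A y))^-1 *: (b y *m \adj (A y))) x.
  by apply: Ck_at_scale; [exact: Ck_at_inv|exact: Ck_at_mulmx].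
apply; have dn0 : \forall y \near x, \det (A y) != 0.
  by apply: cvgr_neq0 d0; exact: (Ck_at_continuous dA).
near=> y; have <- : s y *m A y = b y by near: y.
have dy : \det (A y) != 0 by near: y.
by rewrite -mulmxA mul_mx_adj scalar_mxC mul_scalar_mx scalerA mulVf// scale1r.
Unshelve. all: by end_near. Qed.

Lemma smooth_at_D V W (f : V -> W) x v : smooth_at f x -> smooth_at ('D_v f) x.
Proof. by move=> fs k; have [_] := fs k.+1; apply. Qed.

Lemma smooth_at_diff V W (f : V -> W) x : smooth_at f x -> \forall y \near x, differentiable f y.
Proof. by move=> /(_ 1%N)/Ck_at_diff. Qed.

Lemma smooth_at_differentiable V W (f : V -> W) x : smooth_at f x -> differentiable f x.
Proof. by move=> /smooth_at_diff/nbhs_singleton. Qed.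

Lemma smooth_at_near V W (f g : V -> W) x :
  (\forall y \near x, f y = g y) -> smooth_at f x -> smooth_at g x.
Proof. by move=> fg fs k; exact: Ck_at_near fg (fs k). Qed.

Lemma smooth_at_comp U V W (f : U -> V) (g : V -> W) x : finite_basis V ->
  smooth_at f x -> smooth_at g (f x) -> smooth_at (g \o f) x.
Proof. by move=> fb fs gs k; exact: Ck_at_comp. Qed.

Lemma schwarz_rV V n (f : V -> 'rV[R]_n) (x u v : V) : smooth_at f x ->
  'D_u ('D_v f) x = 'D_v ('D_u f) x.
Proof.
move=> fs; apply/rowP => j.
have key w1 w2 : ('D_w1 ('D_w2 f) x) 0 j = 'D_w1 ('D_w2 (fun y => f y 0 j)) x.
  rewrite -[LHS](@coordinateE 1 n 0 j) -derive_linear_comp.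
  - apply: near_eq_derive; near=> y.
    rewrite -[RHS]/('D_w2 (coordinate 0 j \o f) y) derive_linear_comp//.
      exact: coordinate_continuous.
    by near: y; exact: smooth_at_diff.
  - exact: coordinate_continuous.
  - by apply: smooth_at_differentiable; exact: smooth_at_D.
apply: (etrans (key u v)); apply: (etrans _ (esym (key v u))).
apply: (@schwarz R V (fun y => f y 0 j)).
exact: (@Ck_at_coord V 2 1 n f x 0 j (fs 2%N)).
Unshelve. all: by end_near. Qed.

(** Both the point where [f] is differentiated and the vector fed to the differential vary;
    expanding the vector in a basis leaves products of coordinates with fixed directional
    derivatives of [f]. *)
Lemma smooth_at_dapp U V W (f : V -> W) (g : U -> V) (s : U -> V) x : finite_basis V ->
  smooth_at f (g x) -> smooth_at g x -> smooth_at s x ->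
  smooth_at (fun y => 'd f (g y) (s y)) x.
Proof.
move=> fb; have [m [e [c [cc ce]]]] := fb => fs gs ss.
have : smooth_at (fun y => \sum_i c i (s y) *: ('D_(e i) f \o g) y) x.
  move=> k; apply: Ck_at_sum => i _; apply: Ck_at_scale.
    exact: Ck_at_linear_comp (cc i) (ss k).
  by apply: Ck_at_comp => //; exact: smooth_at_D.
have df : \forall y \near x, differentiable f (g y).
  exact: (Ck_at_continuous (gs 0%N)) (smooth_at_diff fs).
apply: smooth_at_near; apply: filterS df => y df.
rewrite [X in _ = 'd f _ X]ce linear_sum; apply: eq_bigr => i _.
by rewrite linearZ /= deriveE.
Qed.

End Smooth.

(** * Charts, frames and connections *)

Lemma diff_comp_at (R : realType) (U V W : normedModType R) (f : U -> V)
    (g : V -> W) x y v : differentiable f x -> f x = y -> differentiable g y ->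
  'd (g \o f) x v = 'd g y ('d f x v).
Proof. by move=> df <- dg; rewrite diff_comp. Qed.

(** A common interface for the charts of [M] and the induced charts of [TM M]. Nearness is always
    stated in coordinates, so no topology on [TM M] is involved. *)
Record atlas (R : realType) (P : Type) (V : normedModType R) (C : charted P V)
    (D : P -> set P) : Prop := Atlas {
  atlas_center : forall p, D p p ;
  atlasK : forall p q, D p q -> cinv C p (Defs.coord C p q) = q ;
  atlas_near : forall p p' q, D p q -> D p' q ->
    \forall x \near Defs.coord C p q,
      D p (cinv C p x) /\ D p' (cinv C p x) /\ Defs.coord C p (cinv C p x) = x ;
  atlas_smooth : forall p p' q, D p q -> D p' q ->
    smooth_at (Defs.coord C p' \o cinv C p) (Defs.coord C p q) }.

Section Atlas.
Context {R : realType} {P : Type} {V : normedModType R} {C : charted P V}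
  {D : P -> set P}.
Hypothesis HA : atlas C D.
Hypothesis fb : finite_basis V.
Notation coord := (Defs.coord C).
Notation cinv := (cinv C).

(** [tcoord] always starts from the chart attached to the point itself; the cocycle rule needs three
    arbitrary charts around one point [q]. *)
Definition chart_change (C : charted P V) p p' q : {linear V -> V} :=
  'd (Defs.coord C p' \o Defs.cinv C p) (Defs.coord C p q).

Lemma tcoordZ p q (a : R) v : tcoord C p q (a *: v) = a *: chart_change C q p q v.
Proof. exact: (linearZ_LR (chart_change C q p q)). Qed.

Lemma tcoordD p q v w : tcoord C p q (v + w) = tcoord C p q v + tcoord C p q w.
Proof. exact: (linearD (chart_change C q p q)). Qed.

Lemma tcoord0 p q : tcoord C p q 0 = 0.
Proof. exact: (linear0 (chart_change C q p q)). Qed.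

Lemma chart_change_id p q v : D p q -> chart_change C p p q v = v.
Proof.
move=> Dpq; rewrite /chart_change (@near_eq_diffE _ _ _ id).
- by rewrite (@diff_lin _ _ _ idfun)// => x.
- by apply: filterS (atlas_near HA Dpq Dpq) => x [_ [_]].
- by apply: (@linear_differentiable _ _ _ idfun) => x.
Qed.

Lemma chart_change_comp p p' p'' q v : D p q -> D p' q -> D p'' q ->
  chart_change C p' p'' q (chart_change C p p' q v) = chart_change C p p'' q v.
Proof.
move=> Dp Dp' Dp''; rewrite /chart_change.
pose F := (coord p'' \o cinv p') \o (coord p' \o cinv p).
have d1 := smooth_at_differentiable (atlas_smooth HA Dp Dp').
have d2 : differentiable (coord p'' \o cinv p') (coord p' q).
  exact: smooth_at_differentiable (atlas_smooth HA Dp' Dp'').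
rewrite (@near_eq_diffE _ _ _ F (coord p'' \o cinv p) (coord p q)).
- have e : (coord p' \o cinv p) (coord p q) = coord p' q by rewrite /= (atlasK HA Dp).
  exact: esym (diff_comp_at v d1 e d2).
- apply: filterS (atlas_near HA Dp Dp') => x [_ [Hx _]].
  by rewrite /F /= (atlasK HA Hx).
- by apply: differentiable_comp => //; rewrite /= (atlasK HA Dp).
Qed.

Lemma smooth_at_chart (W : normedModType R) (f : P -> W) p q : D p q ->
  smooth_at (f \o cinv q) (coord q q) -> smooth_at (f \o cinv p) (coord p q).
Proof.
move=> Dp fs; have Dq := atlas_center HA q.
have : smooth_at ((f \o cinv q) \o (coord q \o cinv p)) (coord p q).
  apply: smooth_at_comp => //; first exact: (atlas_smooth HA).
  by rewrite /= (atlasK HA Dp).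
apply: smooth_at_near; apply: filterS (atlas_near HA Dp Dq) => x [_ [Hx _]].
by rewrite /= (atlasK HA Hx).
Qed.

End Atlas.

Section ManifoldAtlas.
Context {R : realType} {n : nat} (M : manifold R n).
Notation C := (charts M).
Notation coord := (Defs.coord C).
Notation cinv := (cinv C).

Lemma cinv_continuous_at p q : dom p q -> {for coord p q, continuous (cinv p)}.
Proof.
move=> Dp; have := @cinv_continuous _ _ M p.
rewrite continuous_open_subspace; last exact: image_open.
by apply; apply: mem_set; exists q.
Qed.

Lemma manifold_atlas : atlas C (@dom R n M).
Proof.
split; [exact: dom_center|exact: coordK| |exact: transition_smooth].
move=> p p' q Dp Dp'.
have Op := @image_open _ _ M p.
have cq : (coord p @` dom p) (coord p q) by exists q.
have cc := cinv_continuous_at Dp.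
have N1 : \forall x \near coord p q, (coord p @` dom p) x.
  by apply: open_nbhs_nbhs; split.
have N2 : \forall x \near coord p q, dom p' (cinv p x).
  apply: cc; rewrite /= coordK//; apply: open_nbhs_nbhs; split => //.
  exact: dom_open.
apply: filterS (filterI N1 N2) => x [[r Dr <-]].
by rewrite coordK.
Qed.

Definition tm_dom (u w : TM M) : Prop := dom (Defs.proj u) (Defs.proj w).

Lemma near_fst (U W : normedModType R) (Q : set U) (x : U) (v : W) :
  (\forall y \near x, Q y) -> \forall z \near (x, v), Q z.1.
Proof. by move=> H; apply: (@cvg_fst _ _ (nbhs x) (nbhs v)). Qed.

(** A tangent vector is stored by its components in the chart attached to its own base point, so a
    transition passes through that third chart; the cocycle rule removes it and leaves the tangent
    map of the transition of [M]. *)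
Lemma tm_transE (u u' w : TM M) : tm_dom u w -> tm_dom u' w ->
  \forall z \near Defs.coord (tm_charts M) u w,
  (Defs.coord (tm_charts M) u' \o Defs.cinv (tm_charts M) u) z =
  ((coord (Defs.proj u') \o cinv (Defs.proj u)) (z.1),
   'd (coord (Defs.proj u') \o cinv (Defs.proj u)) (z.1) (z.2)).
Proof.
move=> Du Du'; have HM := manifold_atlas.
have := near_fst (tcoord C (Defs.proj u) (Defs.proj w) w.2) (atlas_near HM Du Du').
apply: filterS => -[x v] /= [D1 [D2 E]].
set r := cinv (Defs.proj u) x in D1 D2 E *.
congr (_, _).
have Dr := atlas_center HM r.
have := chart_change_comp HM v D1 Dr D2.
by rewrite /chart_change E.
Qed.

Lemma tm_atlas : atlas (tm_charts M) tm_dom.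
Proof.
have HM := manifold_atlas; split.
- by move=> u; exact: dom_center.
- move=> u w Du; rewrite /= coordK//; case: w Du => q v /= Du.
  congr (_, _); have Dq := dom_center q.
  exact: etrans (chart_change_comp HM v Dq Du Dq) (chart_change_id HM v Dq).
- move=> u u' w Du Du'.
  have := near_fst (tcoord C (Defs.proj u) (Defs.proj w) w.2) (atlas_near HM Du Du').
  apply: filterS => -[x v] /= [D1 [D2 E]]; split=> //; split=> //.
  rewrite E; congr (_, _).
  set r := cinv (Defs.proj u) x in D1 D2 E *; have Dr := dom_center r.
  have := etrans (chart_change_comp HM v D1 Dr D1) (chart_change_id HM v D1).
  by rewrite /chart_change E.
- move=> u u' w Du Du'.
  have : \forall z \near Defs.coord (tm_charts M) u w,
     ((coord (Defs.proj u') \o cinv (Defs.proj u)) (@linfst _ _ _ z),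
      'd (coord (Defs.proj u') \o cinv (Defs.proj u)) (@linfst _ _ _ z) (@linsnd _ _ _ z)) =
      (Defs.coord (tm_charts M) u' \o Defs.cinv (tm_charts M) u) z.
    by apply: filterS (tm_transE Du Du') => z ->.
  move/smooth_at_near; apply.
  have s1 := atlas_smooth HM Du Du'.
  have sfst : smooth_at (@linfst _ 'rV[R]_n 'rV[R]_n) (Defs.coord (tm_charts M) u w).
    by move=> k; apply: Ck_at_linear; exact: linfst_continuous.
  have ssnd : smooth_at (@linsnd _ 'rV[R]_n 'rV[R]_n) (Defs.coord (tm_charts M) u w).
    by move=> k; apply: Ck_at_linear; exact: linsnd_continuous.
  move=> k; apply: Ck_at_pair.
    by apply: (@Ck_at_comp R _ _ _ _ (@linfst _ _ _)) => //; exact: finite_basis_rV.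
  by apply: smooth_at_dapp => //; exact: finite_basis_rV.
Qed.

End ManifoldAtlas.

(** * Smooth cut-off functions on row spaces *)

Section Bump.
Context {R : realType}.

(** The classical [exp (- 1 / t)] with extra negative powers of [t], so that the derivative of a
    member is a combination of members. *)
Definition flat (m : nat) (t : R) : R :=
  if 0 < t then t^-1 ^+ m * expR (- t^-1) else 0.

Lemma flat_le0 m t : t <= 0 -> flat m t = 0.
Proof. by rewrite /flat leNgt => /negbTE ->. Qed.

Lemma flat_gt0 m t : 0 < t -> 0 < flat m t.
Proof. by move=> t0; rewrite /flat t0 mulr_gt0 ?expR_gt0// exprn_gt0 ?invr_gt0. Qed.

Lemma flat_ge0 m t : 0 <= flat m t.
Proof. by have [/(flat_gt0 m)/ltW//|/(flat_le0 m) ->] := ltP 0 t. Qed.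

(** This is [exp s >= 1 + s^(m+1) / (m+1)!] at [s = 1 / t]. Since dividing by [t] only raises [m],
    the same bound makes the difference quotient at 0 tend to 0. *)
Lemma flat_bound m t : `|flat m t| <= (m.+1)`!%:R * `|t|.
Proof.
have [t0|t0] := ltP 0 t; last first.
  by rewrite flat_le0// normr0 mulr_ge0.
rewrite (ger0_norm (flat_ge0 m t)) (gtr0_norm t0) /flat t0 expRN.
have s0 : 0 < t^-1 by rewrite invr_gt0.
have := expR_ge1Dxn m (ltW s0).
set s := t^-1 in s0 *; have -> : t = s^-1 by rewrite invrK.
set F : R := _%:R => H.
have F0 : 0 < F by rewrite ltr0n fact_gt0.
rewrite ler_pdivrMr ?expR_gt0// mulrAC ler_pdivlMr// -exprSr mulrC -ler_pdivrMr//.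
by apply: le_trans H; rewrite lerDr.
Qed.

Lemma flatS m t : t != 0 -> t^-1 * flat m t = flat m.+1 t.
Proof. by rewrite /flat exprS; case: ifP => // _ _; rewrite ?mulr0// mulrA. Qed.

Lemma is_derive_flat m (t : R) :
  is_derive t 1 (flat m) (flat m.+2 t - m%:R * flat m.+1 t).
Proof.
have [t0|t0|->] := ltgtP t 0.
- rewrite !flat_le0 ?ltW// mulr0 subr0.
  apply: (@near_eq_is_derive _ _ _ (cst 0)).
  near=> s; rewrite flat_le0//; apply: ltW; near: s.
  exact: lt_nbhsl.
- have nE : \forall s \near t, s^-1 ^+ m * expR (- s^-1) = flat m s.
    near=> s; rewrite /flat ifT//; near: s; exact: lt_nbhsr.
  have tn0 : t != 0 by rewrite gt_eqF.
  have dV : is_derive t 1 (fun s : R => s^-1) (- t ^- 2).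
    apply: DeriveDef; first by apply: (@derivableV R R id); [|exact: derivable_id].
    by rewrite (@deriveV R R id)// ?derive_id /GRing.scale/= ?mulr1.
  have dXm : is_derive t^-1 1 (fun x : R => x ^+ m) (m%:R * t^-1 ^+ m.-1).
    apply: DeriveDef; first exact: exprn_derivable.
    by rewrite exp_derive /GRing.scale/= mulr1 mulr_natl.
  have dX := @is_derive1_comp R _ _ t _ _ dXm dV.
  have dN := @is_deriveN R R R (fun s : R => s^-1) t 1 _ dV.
  have dE := @is_derive1_comp R expR (- (fun s : R => s^-1)) t _ _ (is_derive_expR _) dN.
  apply: (near_eq_is_derive nE); have dM := is_deriveM dX dE; apply: (@is_derive_eq _ _ _ _ _ _ _ _ dM).
  rewrite /flat t0 /GRing.scale /= -[(- _) t]/(- t^-1) -exprVn opprK.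
  move: (t^-1) => s; case: m {nE dXm dX dM} => [|m] /=.
    by rewrite !mul0r mulr0 addr0 subr0 expr0 mul1r mulrC.
  by rewrite !exprS expr0; ring.
- rewrite !flat_le0// mulr0 subr0.
  suff H : h^-1 *: (flat m (h *: 1 + 0) - flat m 0) @[h --> 0^'] --> (0 : R).
    by apply: DeriveDef; [apply/cvg_ex; exists 0 | exact: cvg_lim H].
  apply/cvgr0Pnorm_lt => e e0.
  have F0 : 0 < (m.+2)`!%:R :> R by rewrite ltr0n fact_gt0.
  near=> h; have h0 : h != 0 by near: h; exact: nbhs_dnbhs_neq.
  rewrite [flat m 0]flat_le0// subr0 addr0 /GRing.scale/= mulr1 flatS//.
  apply: le_lt_trans (flat_bound _ _) _.
  rewrite mulrC -ltr_pdivlMr//; near: h.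
  by apply: dnbhs0_lt; rewrite divr_gt0.
Unshelve. all: by end_near. Qed.

Lemma Ck_at_flat k m (t : R) : Ck_at k (flat m) t.
Proof.
elim: k m => [|k IH] m.
  near=> s; apply: differentiable_continuous; apply/derivable1_diffP.
  by have [] := is_derive_flat m s.
have dflat s : differentiable (flat m) s.
  by apply/derivable1_diffP; have [] := is_derive_flat m s.
split; first by near=> s; exact: dflat.
move=> v.
have : Ck_at k (fun s => v * (flat m.+2 s - m%:R * flat m.+1 s)) t.
  apply: Ck_at_mul; first exact: Ck_at_cst.
  apply: Ck_at_add => //; apply: Ck_at_opp; apply: Ck_at_mul => //.
  exact: Ck_at_cst.
apply: Ck_at_near; near=> s.
have [_ <-] := is_derive_flat m s.
by rewrite !deriveE// -[v in RHS]mulr1 linearZ.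
Unshelve. all: by end_near. Qed.

(** The two terms of the denominator are positive for [t < 1] and for [t > 1/2] respectively, so
    they never vanish together. *)
Definition step (t : R) : R :=
  flat 0 (1 - t) / (flat 0 (1 - t) + flat 0 (t - 2^-1)).

Lemma step_smooth (t : R) : smooth_at step t.
Proof.
move=> k.
have lin (a b : R) : Ck_at k (fun s : R => a + b * s) t.
  apply: Ck_at_add; first exact: Ck_at_cst.
  apply: Ck_at_mul; first exact: Ck_at_cst.
  by apply: (@Ck_at_linear R R R k idfun) => x.
have f1 : Ck_at k (fun s : R => flat 0 (1 - s)) t.
  have := @Ck_at_comp R R R R k (fun s : R => 1 + (-1) * s) (flat 0) t finite_basis_R (lin _ _)
    (Ck_at_flat _ _ _).
  by apply: Ck_at_near; near=> s; rewrite /= mulN1r.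
have f2 : Ck_at k (fun s : R => flat 0 (s - 2^-1)) t.
  have := @Ck_at_comp R R R R k (fun s : R => - 2^-1 + 1 * s) (flat 0) t finite_basis_R (lin _ _)
    (Ck_at_flat _ _ _).
  by apply: Ck_at_near; near=> s; rewrite /= mul1r addrC.
apply: Ck_at_mul => //; apply: Ck_at_inv; last exact: Ck_at_add.
rewrite gt_eqF//; have [t1|t1] := ltP t 1.
  by rewrite ltr_pwDl ?flat_ge0// flat_gt0// subr_gt0.
by rewrite ltr_wpDl ?flat_ge0// flat_gt0//; lra.
Unshelve. all: by end_near. Qed.

Lemma step1 (t : R) : t <= 2^-1 -> step t = 1.
Proof.
move=> t2; rewrite /step [flat 0 (t - _)]flat_le0 ?subr_le0// addr0 divff//.
by rewrite gt_eqF// flat_gt0//; lra.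
Qed.

Lemma step_neq0 (t : R) : step t != 0 -> t < 1.
Proof.
by apply: contraR; rewrite -leNgt => t1; rewrite /step flat_le0 ?subr_le0// mul0r.
Qed.

(** The norm of a row vector is the maximum norm, which is not smooth. [step] is therefore fed the
    scaled sum of squares, and a sum below 1 bounds every coordinate of [x - a] by [r]. *)
Lemma bump_rV n (a : 'rV[R]_n) (r : R) : 0 < r -> exists b : 'rV[R]_n -> R,
  [/\ forall x, smooth_at b x, \forall x \near a, b x = 1 & forall x, b x != 0 -> `|a - x| <= r].
Proof.
move=> r0.
pose N (x : 'rV[R]_n) := \sum_i ((x 0 i - a 0 i) / r) * ((x 0 i - a 0 i) / r).
have Ns x : smooth_at N x.
  move=> k; apply: Ck_at_sum => i _.
  have H : Ck_at k (fun y : 'rV[R]_n => (y 0 i - a 0 i) / r) x.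
    apply: Ck_at_mul; last exact: Ck_at_cst.
    apply: Ck_at_add; last exact: Ck_at_cst.
    exact: (@Ck_at_linear R _ R k (coordinate 0 i)) (@coordinate_continuous R 1 n 0 i).
  exact: Ck_at_mul.
exists (step \o N); split.
- by move=> x; apply: smooth_at_comp => //; [exact: finite_basis_R|exact: step_smooth].
- have : \forall x \near a, N x < 2^-1.
    apply: (cvgr_lt (N a) (Ck_at_continuous (Ns a 0%N))).
    rewrite /N big1 ?invr_gt0// => i _; by rewrite subrr !mul0r.
  by apply: filterS => x Nx; rewrite /= step1// ltW.
- move=> x /= /step_neq0 Nx.
  rewrite /Num.Def.normr /= mx_normrE; apply: bigmax_le; first exact: ltW.
  move=> [i j] _ /=; rewrite ord1 !mxE distrC.
  have : ((x 0 j - a 0 j) / r) * ((x 0 j - a 0 j) / r) < 1.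
    apply: le_lt_trans Nx; rewrite /N (bigD1 j)//= lerDl sumr_ge0// => l _.
    by rewrite -expr2 sqr_ge0.
  rewrite -expr2 -real_normK ?num_real// => /ltW.
  rewrite expr_le1// normrM [X in _ * X]gtr0_norm ?invr_gt0//.
  by rewrite ler_pdivrMr// mul1r.
Qed.

End Bump.

(** * Bump functions on the manifold and cut-off constant frames *)

Section Frames.
Context {R : realType} {n : nat} (M : manifold R n).
Notation C := (charts M).
Notation T := (tm_charts M).
Notation center u := (Defs.coord T u u).
Notation coord := (Defs.coord C).
Notation cinv := (cinv C).
Notation proj := (@Defs.proj R n M).
Notation V := 'rV[R]_n.
Let HM := manifold_atlas M.
Let HT := tm_atlas M.

(** The closed ball carried to [M] is compact, hence closed because [M] is Hausdorff; on the open
    complement the extension by zero vanishes. The last clause is how smoothness of anything cut off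
    by [phi] is checked: each point lies in the chart or has a neighbourhood where [phi] is zero. *)
Lemma manifold_bump (p : M) : exists phi : M -> R,
  [/\ forall p', smooth_at (phi \o cinv p' : V -> R) (coord p' p'),
      \forall x \near coord p p, phi (cinv p x) = 1 &
      forall p', dom p p' \/ \forall x \near coord p' p', phi (cinv p' x) = 0].
Proof.
have /nbhs_ballP[r' /= r'0 Hr'] : \forall x \near coord p p, (coord p @` dom p) x.
  apply: open_nbhs_nbhs; split; first exact: image_open.
  by exists p => //; exact: dom_center.
(* Halving the radius keeps the closed ball inside the image of the chart. *)
pose r := r' / 2; have r0 : 0 < r by rewrite divr_gt0.
pose B := [set x : V | `|coord p p - x| <= r].
have Bsub : B `<=` coord p @` dom p.
  move=> x Bx; apply: Hr'; rewrite -ball_normE /=.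
  by apply: le_lt_trans Bx _; rewrite /r ltr_pdivrMr// ltr_pMr// ltr1n.
have [b [bs b1 b0]] := bump_rV (coord p p) r0.
pose K := cinv p @` B.
have cK : compact K.
  apply: continuous_compact; last first.
    apply: bounded_closed_compact; last exact: closed_closed_ball_.
    exists (`|coord p p| + r); split; first exact: num_real.
    move=> t ht x Bx; apply: le_trans _ (ltW ht).
    rewrite -[x](subKr (coord p p)) (le_trans (ler_normB _ _))// lerD2l.
    by [].
  by apply: continuous_subspaceW Bsub _; exact: cinv_continuous.
have clK : closed K by apply: compact_closed => //; exact: manifold_hausdorff.
pose phi q := if pselect (dom p q) then b (coord p q) else 0 : R.
have phi0 q : ~ K q -> phi q = 0.
  rewrite /phi; case: pselect => // Dq NK; apply/eqP/negP => /negP /b0 Bq.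
  by apply: NK; exists (coord p q) => //; rewrite coordK.
have far p' : dom p p' \/ \forall x \near coord p' p', phi (cinv p' x) = 0.
  have [Dp'|Dp'] := pselect (dom p p'); [by left|right].
  have NK : (~` K) p'.
    by move=> [x /Bsub[q Dq <-]]; rewrite coordK// => qp; apply: Dp'; rewrite -qp.
  have cc := cinv_continuous_at (dom_center p').
  have : \forall q \near cinv p' (coord p' p'), (~` K) q.
    rewrite (coordK (dom_center p')); apply: open_nbhs_nbhs; split => //.
    exact: closed_openC.
  move=> H; have H2 : \forall x \near coord p' p', (~` K) (cinv p' x) by exact: cc _ H.
  by apply: filterS H2 => x /phi0.
exists phi; split=> //.
- move=> p'; have [Dp'|z0] := far p'; last first.
    have : smooth_at (cst (0 : R)) (coord p' p') by move=> k; exact: Ck_at_cst.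
    by apply: smooth_at_near; apply: filterS z0 => x /= ->.
  have Dc := dom_center p'.
  have : smooth_at (b \o (coord p \o cinv p')) (coord p' p').
    apply: smooth_at_comp => //; first exact: finite_basis_rV.
    exact: (atlas_smooth HM).
  apply: smooth_at_near; apply: filterS (atlas_near HM Dc Dp') => x [_ [Dx _]].
  by rewrite /= /phi; case: pselect.
- have Dc := dom_center p.
  apply: filterS (filterI b1 (atlas_near HM Dc Dc)) => x [bx [Dx [_ Ex]]].
  by rewrite /phi; case: pselect => [Dq|//]; rewrite Ex.
Qed.

Definition base_bump p : M -> R := projT1 (cid (manifold_bump p)).

Lemma base_bump_smooth p p' : smooth_at (base_bump p \o cinv p' : V -> R) (coord p' p').
Proof. by rewrite /base_bump; case: cid => phi [H _ _] /=; exact: H. Qed.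

Lemma base_bump1 p : \forall x \near coord p p, base_bump p (cinv p x) = 1.
Proof. by rewrite /base_bump; case: cid => phi [_ H _] /=; exact: H. Qed.

Lemma base_bump_dom p p' : dom p p' \/ \forall x \near coord p' p', base_bump p (cinv p' x) = 0.
Proof. by rewrite /base_bump; case: cid => phi [_ _ H] /=; exact: H. Qed.

Lemma base_bump_center p : base_bump p p = 1.
Proof. by have /nbhs_singleton := base_bump1 p; rewrite coordK//; exact: dom_center. Qed.

Lemma near_base (u : TM M) (Q : set V) :
  (\forall x \near coord (proj u) (proj u), Q x) ->
  \forall z \near center u, Q z.1.
Proof. exact: near_fst. Qed.

Lemma smooth_base (W : normedModType R) (f : V -> W) (u : TM M) :
  smooth_at f (coord (proj u) (proj u)) ->
  smooth_at (fun z => f (z.1)) (center u).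
Proof.
move=> fs k; apply: (@Ck_at_comp _ _ _ _ _ (@linfst _ _ _)) => //.
- exact: finite_basis_rV.
- by apply: Ck_at_linear; exact: linfst_continuous.
Qed.

Lemma base_bump_smooth_fun p : smooth_fun T (slit M) (fun w => base_bump p (proj w)).
Proof.
move=> u _; apply: (@smooth_base _ (base_bump p \o cinv (proj u)) u).
exact: base_bump_smooth.
Qed.

Lemma proj_cinv (u : TM M) z : proj (Defs.cinv T u z) = cinv (proj u) (z.1).
Proof. by []. Qed.

(** A section that is constant in the chart of [p], made global by the cut-off because [nabla]
    accepts only global sections. *)
Definition frame p (v : V) : TM M -> V := fun w =>
  base_bump p (proj w) *: chart_change C p (proj w) (proj w) v.

Lemma frame_at u v : frame (proj u) v u = v.
Proof.
by rewrite /frame base_bump_center scale1r (chart_change_id HM)//; exact: dom_center.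
Qed.

Lemma sec_in_frameE p v (u : TM M) : dom p (proj u) ->
  \forall z \near center u, sec_in (frame p v) u z =
    base_bump p (cinv (proj u) (z.1)) *: chart_change C p (proj u) (cinv (proj u) (z.1)) v.
Proof.
move=> Du; have Dc := dom_center (proj u).
have := near_base (atlas_near HM Dc Du); apply: filterS => z [D1 [D2 E]].
set q := cinv (proj u) (z.1) in D1 D2 E *.
transitivity (tcoord C (proj u) q (base_bump p q *: chart_change C p q q v)); first by [].
apply: (etrans (tcoordZ (proj u) q (base_bump p q) (chart_change C p q q v))).
exact: (congr1 (GRing.scale (base_bump p q)) (chart_change_comp HM v D2 (dom_center q) D1)).
Qed.

Lemma sec_in_frame p v (u : TM M) : proj u = p ->
  \forall z \near center u, sec_in (frame p v) u z = v.
Proof.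
move=> <-; have Dc := dom_center (proj u).
apply: filterS (filterI (sec_in_frameE v Dc)
  (filterI (near_base (atlas_near HM Dc Dc)) (near_base (base_bump1 (proj u))))).
move=> z [Hz [[D1 _] bz]]; apply: (etrans Hz); rewrite bz scale1r.
exact: (chart_change_id HM v D1).
Qed.

Lemma smooth_at0 (U W : normedModType R) (f : U -> W) x :
  (\forall y \near x, f y = 0) -> smooth_at f x.
Proof.
move=> f0; apply: (@smooth_at_near _ _ _ (cst 0)) => [|k]; last exact: Ck_at_cst.
by apply: filterS f0 => y ->.
Qed.

Lemma frame_smooth p v : smooth_sec (frame p v).
Proof.
move=> u _; have [Du|far] := base_bump_dom p (proj u); last first.
  apply: smooth_at0; apply: filterS (near_base far) => z fz.
  by rewrite /sec_in /frame proj_cinv fz scale0r tcoord0.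
apply: (@smooth_at_near R _ _ (fun z => base_bump p (cinv (proj u) (z.1)) *:
    'd (coord (proj u) \o cinv p) ((coord p \o cinv (proj u)) (z.1)) v)).
  by apply: filterS (sec_in_frameE v Du) => z ->.
have Dc := dom_center (proj u).
apply: (@smooth_base _ (fun x => (base_bump p \o cinv (proj u)) x *:
    'd (coord (proj u) \o cinv p) ((coord p \o cinv (proj u)) x) v)).
move=> k; apply: Ck_at_scale; first exact: base_bump_smooth.
apply: smooth_at_dapp; first exact: finite_basis_rV.
- rewrite /= (coordK Dc); exact: (atlas_smooth HM).
- exact: (atlas_smooth HM).
- by move=> l; exact: Ck_at_cst.
Qed.

(** The analogue of [frame] for vector fields on [TM M]. An induced chart depends only on the base
    point, so the zero vector at [p] serves as its index. *)
Definition vframe p (v : V * V) : TM M -> V * V := fun w =>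
  base_bump p (proj w) *: chart_change T ((p, 0) : TM M) w w v.

Lemma vf_in_vframeE p v (u : TM M) : dom p (proj u) ->
  \forall z \near center u, vf_in T (vframe p v) u z =
    base_bump p (cinv (proj u) (z.1)) *:
    chart_change T ((p, 0) : TM M) u (Defs.cinv T u z) v.
Proof.
move=> Du; have Dc := atlas_center HT u.
have Du' : tm_dom ((p, 0) : TM M) u by [].
have := atlas_near HT Dc Du'; apply: filterS => z [D1 [D2 E]].
set w := Defs.cinv T u z in D1 D2 E *.
transitivity (tcoord T u w (base_bump p (proj w) *: chart_change T ((p, 0) : TM M) w w v)).
  by [].
apply: (etrans (tcoordZ u w _ (chart_change T ((p, 0) : TM M) w w v))).
exact: (congr1 (GRing.scale _) (chart_change_comp HT v D2 (atlas_center HT w) D1)).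
Qed.

Lemma vframe_at u v : vframe (proj u) v u = v.
Proof.
rewrite /vframe base_bump_center scale1r.
exact: (@chart_change_id _ _ _ _ _ HT u u v (atlas_center HT u)).
Qed.

Lemma vf_in_vframe p v (u : TM M) : proj u = p ->
  \forall z \near center u, vf_in T (vframe p v) u z = v.
Proof.
move=> <-; have Dc := atlas_center HT u.
apply: filterS (filterI (vf_in_vframeE v (dom_center (proj u)))
  (filterI (atlas_near HT Dc Dc) (near_base (base_bump1 (proj u))))).
move=> z [Hz [[D1 _] bz]]; apply: (etrans Hz); rewrite bz scale1r.
exact: (@chart_change_id _ _ _ _ _ HT u (Defs.cinv T u z) v D1).
Qed.

Lemma vframe_smooth p v : smooth_vf T (slit M) (vframe p v).
Proof.
move=> u _; have [Du|far] := base_bump_dom p (proj u); last first.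
  apply: smooth_at0; apply: filterS (near_base far) => z fz.
  by rewrite /vf_in /vframe proj_cinv fz scale0r tcoord0.
have Du' : tm_dom ((p, 0) : TM M) u by [].
have Dc := atlas_center HT u.
have : smooth_at (fun z => base_bump p (cinv (proj u) (z.1)) *:
    'd (Defs.coord T u \o Defs.cinv T ((p, 0) : TM M))
       ((Defs.coord T ((p, 0) : TM M) \o Defs.cinv T u) z) v) (center u).
  move=> k; apply: Ck_at_scale.
    by apply: (@smooth_base _ (base_bump p \o cinv (proj u)) u); exact: base_bump_smooth.
  apply: smooth_at_dapp; first exact: finite_basis_rVrV.
  - rewrite /comp (atlasK HT Dc); exact: (atlas_smooth HT).
  - exact: (atlas_smooth HT).
  - by move=> l; exact: Ck_at_cst.
by apply: smooth_at_near; apply: filterS (vf_in_vframeE v Du) => z ->.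
Qed.

(** A component of [S] becomes a global smooth function, as the Leibniz rule demands. As [frame] is
    cut off too, the expansion of [S] comes with the square of the bump. *)
Definition localized p (S : TM M -> V) i : TM M -> R := fun w =>
  base_bump p (proj w) * chart_change C (proj w) p (proj w) (S w) 0 i.

Lemma localized_smooth p S i : smooth_sec S ->
  smooth_fun T (slit M) (localized p S i).
Proof.
move=> Ss u su; have [Du|far] := base_bump_dom p (proj u); last first.
  apply: smooth_at0; apply: filterS (near_base far) => z fz.
  by rewrite /localized /comp proj_cinv fz mul0r.
have Dc := dom_center (proj u).
have : smooth_at (fun z => base_bump p (cinv (proj u) (z.1)) *
    ('d (coord p \o cinv (proj u)) (z.1) (sec_in S u z)) 0 i) (center u).
  move=> k; apply: Ck_at_mul.
    by apply: (@smooth_base _ (base_bump p \o cinv (proj u)) u); exact: base_bump_smooth.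
  apply: Ck_at_coord; apply: smooth_at_dapp; first exact: finite_basis_rV.
  - exact: (atlas_smooth HM).
  - by apply: (@smooth_base _ id u) => l; apply: (@Ck_at_linear _ _ _ _ idfun) => x.
  - exact: Ss.
apply: smooth_at_near; have := near_base (atlas_near HM Dc Du).
apply: filterS => z [D1 [D2 E]]; rewrite /localized /comp proj_cinv.
set q := cinv _ _ in D1 D2 E *; rewrite /sec_in proj_cinv -/q.
have := chart_change_comp HM (S (Defs.cinv T u z)) (dom_center q) D1 D2.
rewrite {1}/chart_change E => K.
exact: (congr1 (fun t : V => base_bump p q * t 0 i) K).
Qed.

Lemma localized_near p S i (u : TM M) : proj u = p ->
  \forall z \near center u, localized p S i (Defs.cinv T u z) = sec_in S u z 0 i.
Proof.
move=> up; have := base_bump1 p; rewrite -up => /near_base.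
by apply: filterS => z bz; rewrite /localized proj_cinv bz mul1r.
Qed.

End Frames.

(** * Algebra of smooth sections and locality of a connection *)

Section SectionAlgebra.
Context {R : realType} {n : nat} (M : manifold R n).
Notation C := (charts M).
Notation T := (tm_charts M).
Notation center u := (Defs.coord T u u).
Notation coord := (Defs.coord C).
Notation cinv := (cinv C).
Notation proj := (@Defs.proj R n M).
Notation V := 'rV[R]_n.
Let HM := manifold_atlas M.
Let HT := tm_atlas M.

Lemma tm_coord_self (u : TM M) : center u = (coord (proj u) (proj u), u.2).
Proof.
congr (_, _); exact: (@chart_change_id _ _ _ _ _ HM _ _ (u.2) (dom_center (proj u))).
Qed.

Lemma near_snd (U W : normedModType R) (Q : set W) (x : U) (v : W) :
  (\forall y \near v, Q y) -> \forall z \near (x, v), Q z.2.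
Proof. by move=> H; apply: (@cvg_snd _ _ (nbhs x) (nbhs v)). Qed.

Lemma near_slit (u : TM M) : slit M u ->
  \forall z \near center u, slit M (Defs.cinv T u z).
Proof.
move=> u0; have Dc := dom_center (proj u).
have H1 : \forall z \near center u, z.2 != 0.
  rewrite tm_coord_self; apply: (@near_snd _ _ (fun y : V => y != 0)).
  have H : nbhs (u.2) `=>` nbhs (u.2) by [].
  exact: (@cvgr_neq0 R V V (nbhs (u.2)) _ id (u.2) H u0).
apply: filterS (filterI H1 (near_base (atlas_near HM Dc Dc))) => z [z0 [D1 [_ E]]].
apply: contra_neq z0 => H.
set q := cinv (proj u) (z.1) in D1 E.
have K : chart_change C (proj u) q q (z.2) = 0 by rewrite /chart_change E; exact: H.
apply: (etrans (esym (chart_change_id HM (z.2) D1))).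
apply: (etrans (esym (chart_change_comp HM (z.2) D1 (dom_center q) D1))).
exact: (etrans (congr1 (chart_change C q (proj u) q) K)
  (linear0 (chart_change C q (proj u) q))).
Qed.

Lemma sec_inZ (f : TM M -> R) (S : TM M -> V) u z :
  sec_in (fun w => f w *: S w) u z = f (Defs.cinv T u z) *: sec_in S u z.
Proof. exact: tcoordZ. Qed.

Lemma sec_inD (S1 S2 : TM M -> V) u z :
  sec_in (fun w => S1 w + S2 w) u z = sec_in S1 u z + sec_in S2 u z.
Proof. exact: tcoordD. Qed.

Lemma sec_in0 u z : sec_in (fun _ : TM M => 0 : V) u z = 0.
Proof. exact: tcoord0. Qed.

Lemma sec_in_center (S : TM M -> V) u : sec_in S u (center u) = S u.
Proof.
rewrite /sec_in (atlasK HT (atlas_center HT u)).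
exact: (@chart_change_id _ _ _ _ _ HM _ _ _ (dom_center (proj u))).
Qed.

Lemma smooth_secZ (f : TM M -> R) (S : TM M -> V) :
  smooth_fun T (slit M) f -> smooth_sec S -> smooth_sec (fun w => f w *: S w).
Proof.
move=> fs Ss u su; have : smooth_at (fun z => f (Defs.cinv T u z) *: sec_in S u z) (center u).
  by move=> k; apply: Ck_at_scale; [exact: fs|exact: Ss].
by apply: smooth_at_near; near=> z; rewrite sec_inZ.
Unshelve. all: by end_near. Qed.

Lemma smooth_secD (S1 S2 : TM M -> V) :
  smooth_sec S1 -> smooth_sec S2 -> smooth_sec (fun w => S1 w + S2 w).
Proof.
move=> Ss1 Ss2 u su; have : smooth_at (fun z => sec_in S1 u z + sec_in S2 u z) (center u).
  by move=> k; apply: Ck_at_add; [exact: Ss1|exact: Ss2].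
by apply: smooth_at_near; near=> z; rewrite sec_inD.
Unshelve. all: by end_near. Qed.

Lemma smooth_sec0 : smooth_sec (fun _ : TM M => 0 : V).
Proof. by move=> u su; apply: smooth_at0; near=> z; rewrite sec_in0.
Unshelve. all: by end_near. Qed.

Lemma smooth_sec_sum (I : Type) (r : seq I) (S : I -> TM M -> V) :
  (forall i, smooth_sec (S i)) -> smooth_sec (fun w => \sum_(i <- r) S i w).
Proof.
move=> H; elim: r => [|i r IH].
  rewrite (_ : (fun w => _) = fun=> 0); first exact: smooth_sec0.
  by apply/funext => w; rewrite big_nil.
rewrite (_ : (fun w => _) = fun w => S i w + \sum_(j <- r) S j w).
  exact: smooth_secD.
by apply/funext => w; rewrite big_cons.
Qed.

Lemma smooth_funM (f g : TM M -> R) : smooth_fun T (slit M) f ->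
  smooth_fun T (slit M) g -> smooth_fun T (slit M) (fun w => f w * g w).
Proof. by move=> fs gs u su k; apply: Ck_at_mul; [exact: fs|exact: gs]. Qed.

Lemma smooth_funD (f g : TM M -> R) : smooth_fun T (slit M) f ->
  smooth_fun T (slit M) g -> smooth_fun T (slit M) (fun w => f w + g w).
Proof. by move=> fs gs u su k; apply: Ck_at_add; [exact: fs|exact: gs]. Qed.

Lemma smooth_fun_cst (a : R) : smooth_fun T (slit M) (fun _ : TM M => a).
Proof. by move=> u su k; exact: Ck_at_cst. Qed.

Lemma smooth_sec_eq (S1 S2 : TM M -> V) : (forall w, slit M w -> S1 w = S2 w) ->
  smooth_sec S1 -> smooth_sec S2.
Proof.
move=> E Ss u su; apply: smooth_at_near (Ss u su).
by apply: filterS (near_slit su) => z sz; rewrite /sec_in E.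
Qed.

Lemma eta_smooth : smooth_sec (@eta R n M).
Proof.
move=> u su; have Dc := dom_center (proj u).
have : smooth_at (fun z : V * V => z.2) (center u).
  by move=> k; apply: (@Ck_at_linear _ _ _ _ (@linsnd _ _ _)); exact: linsnd_continuous.
apply: smooth_at_near; apply: filterS (near_base (atlas_near HM Dc Dc)) => z [D1 [_ E]].
set q := cinv (proj u) (z.1) in D1 E.
have := etrans (chart_change_comp HM (z.2) D1 (dom_center q) D1) (chart_change_id HM (z.2) D1).
by rewrite {2}/chart_change E => <-.
Qed.

Lemma sec_in_eta (u : TM M) : \forall z \near center u, sec_in (@eta R n M) u z = z.2.
Proof.
have Dc := dom_center (proj u).
apply: filterS (near_base (atlas_near HM Dc Dc)) => z [D1 [_ E]].
set q := cinv (proj u) (z.1) in D1 E.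
have := etrans (chart_change_comp HM (z.2) D1 (dom_center q) D1) (chart_change_id HM (z.2) D1).
by rewrite {2}/chart_change E => <-.
Qed.

Section Connection.
Variable nabla : connection_op M.
Hypothesis HN : linear_connection nabla.

Lemma nabla_sec0 u z : slit M u -> nabla u z (fun=> 0) = 0.
Proof.
move=> su; have := nabla_add HN su smooth_sec0 smooth_sec0 z.
rewrite (_ : (fun w => _) = fun _ : TM M => 0 : V); last first.
  by apply/funext => w; rewrite addr0.
by move/eqP; rewrite -subr_eq0 opprD addrA subrr add0r oppr_eq0 => /eqP.
Qed.

Lemma dfun_near_cst (f : TM M -> R) a u z :
  (\forall x \near center u, f (Defs.cinv T u x) = a) -> dfun T f u z = 0.
Proof.
move=> fa; rewrite /dfun (@near_eq_diffE _ _ _ (cst a)).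
- by rewrite diff_cst.
- by apply: filterS fa => x /= ->.
- exact: differentiable_cst.
Qed.

(** Sections are functions on all of [TM M], but only their values on nonzero vectors are
    meaningful. The difference [N] vanishes there, hence equals [f *: N] for the indicator [f] of
    the zero section; [f] counts as smooth, being 0 on [slit M], and the Leibniz rule gives
    [nabla u z N = 0]. *)
Lemma nabla_slit S1 S2 u z : slit M u -> smooth_sec S1 -> 
  (forall w, slit M w -> S1 w = S2 w) -> nabla u z S1 = nabla u z S2.
Proof.
move=> su Ss1 E; have Ss2 := smooth_sec_eq E Ss1.
pose f (w : TM M) : R := (w.2 == 0)%:R.
have fz v : slit M v -> \forall x \near center v, f (Defs.cinv T v x) = 0.
  by move=> sv; apply: filterS (near_slit sv) => x /negbTE; rewrite /f => ->.
have fs : smooth_fun T (slit M) f by move=> v sv; apply: smooth_at0; exact: fz.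
pose N w := S2 w + (-1) *: S1 w.
have Ns : smooth_sec N by apply: smooth_secD => //; apply: smooth_secZ => //; exact: smooth_fun_cst.
have NfN : N = fun w => f w *: N w.
  apply/funext => w; rewrite /f; case: eqP => [_|/eqP w0]; first by rewrite scale1r.
  by rewrite /N E// scaleN1r subrr scaler0.
have N0 : nabla u z N = 0.
  rewrite NfN (nabla_leibniz HN su fs Ns) (dfun_near_cst _ (fz u su)) scale0r addr0.
  by rewrite /f (negbTE (su : u.2 != 0)) scale0r.
have -> : S2 = fun w => S1 w + N w.
  by apply/funext => w; rewrite /N scaleN1r addrC subrK.
by rewrite (nabla_add HN su Ss1 Ns) N0 addr0.
Qed.

Lemma nabla_sum (I : Type) (r : seq I) (S : I -> TM M -> V) u z : slit M u ->
  (forall i, smooth_sec (S i)) ->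
  nabla u z (fun w => \sum_(i <- r) S i w) = \sum_(i <- r) nabla u z (S i).
Proof.
move=> su H; elim: r => [|i r IH].
  rewrite big_nil -[RHS](nabla_sec0 z su); congr nabla.
  by apply/funext => w; rewrite big_nil.
rewrite big_cons -IH -(nabla_add HN su (H i) (smooth_sec_sum _ H)); congr nabla.
by apply/funext => w; rewrite big_cons.
Qed.

Lemma localized_sum p S w :
  \sum_i localized p S i w *: frame p (delta_mx 0 i) w =
  (base_bump p (proj w) * base_bump p (proj w)) *: S w.
Proof.
have Dw := dom_center (proj w).
have [Dp|/nbhs_singleton] := base_bump_dom p (proj w); last first.
  rewrite coordK// => b0; rewrite b0 mul0r scale0r big1// => i _.
  by rewrite /localized b0 mul0r scale0r.
rewrite -[X in _ *: X](chart_change_id HM (S w) Dw).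
rewrite -[X in _ *: X](chart_change_comp HM (S w) Dw Dp Dw).
rewrite [X in chart_change C p (proj w) (proj w) X]row_sum_delta.
rewrite (linear_sum (chart_change C p (proj w) (proj w))) scaler_sumr.
apply: eq_bigr => i _.
rewrite (linearZ_LR (chart_change C p (proj w) (proj w))) /localized /frame !scalerA.
by congr (_ *: _); rewrite mulrAC.
Qed.

(** The local formula [connection coefficients + derivative of the components], for an operator
    whose locality is not assumed. [S] is split into its cut-off expansion in the frame of [proj u]
    and a remainder that vanishes near [u]. *)
Lemma nabla_frame S u z : slit M u -> smooth_sec S ->
  nabla u z S = \sum_i S u 0 i *: nabla u z (frame (proj u) (delta_mx 0 i))
                + 'd (sec_in S u) (center u) z.
Proof.
move=> su Ss; pose p := proj u.
(* One minus the squared bump: it is 0 near [u], so the Leibniz rule kills [nabla u z] of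
   [f *: S]. *)
pose f w : R := 1 + (-1) * (base_bump p (proj w) * base_bump p (proj w)).
have fs : smooth_fun T (slit M) f.
  apply: smooth_funD; first exact: smooth_fun_cst.
  apply: smooth_funM; first exact: smooth_fun_cst.
  by apply: smooth_funM; exact: base_bump_smooth_fun.
have f0 : \forall x \near center u, f (Defs.cinv T u x) = 0.
  apply: filterS (near_base (base_bump1 p)) => x b1.
  by rewrite /f proj_cinv b1 mulr1 mulN1r subrr.
pose F i w := localized p S i w *: frame p (delta_mx 0 i) w.
have Fs i : smooth_sec (F i).
  by apply: smooth_secZ; [exact: localized_smooth|exact: frame_smooth].
have ES : S = fun w => \sum_i F i w + f w *: S w.
  apply/funext => w; rewrite [X in X + _]localized_sum -scalerDl.
  by rewrite /f mulN1r addrCA subrr addr0 scale1r.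
rewrite [in LHS]ES (nabla_add HN su (smooth_sec_sum _ Fs) (smooth_secZ fs Ss)).
rewrite (nabla_leibniz HN su fs Ss) (dfun_near_cst _ f0).
have := nbhs_singleton f0; rewrite (atlasK HT (atlas_center HT u)) => ->.
rewrite !scale0r !addr0 nabla_sum//.
rewrite [X in _ + X]row_sum_delta -big_split; apply: eq_bigr => i _ /=.
rewrite /F (nabla_leibniz HN su (localized_smooth p i Ss) (@frame_smooth _ _ _ p _)).
rewrite frame_at; congr (_ *: _ + _ *: _).
  have /nbhs_singleton := localized_near S i (erefl p).
  by rewrite (atlasK HT (atlas_center HT u)) sec_in_center.
have dS := smooth_at_differentiable (Ss u su).
have cc := @coordinate_continuous R 1 n 0 i.
have dc : differentiable (coordinate 0 i) (sec_in S u (center u)).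
  exact: linear_differentiable.
rewrite /dfun (@near_eq_diffE _ _ _ (coordinate 0 i \o sec_in S u)).
- by rewrite (diff_comp_at _ dS erefl dc) (diff_lin _ cc).
- by apply: filterS (localized_near S i (erefl p)) => x /= ->.
- exact: differentiable_comp.
Qed.

End Connection.
End SectionAlgebra.

(** * The dichotomy in one tangent space *)

Section FamilyDerivative.
Context {R : realType} {U : normedModType R} {n : nat}.
Notation V := 'rV[R]_n.

(** A bare predicate, because the families of forms used below are linear only at nonzero fibre
    points and cannot be bundled linear maps. *)
Definition linear1 (f : V -> R) := forall a u v, f (a *: u + v) = a * f u + f v.

Lemma linear1_0 (f : V -> R) : linear1 f -> f 0 = 0.
Proof. by move=> fl; have := fl 1 0 0; rewrite scale1r addr0 mul1r; lra. Qed.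

Lemma linear1Z (f : V -> R) a u : linear1 f -> f (a *: u) = a * f u.
Proof. by move=> fl; rewrite -[a *: u]addr0 fl linear1_0// addr0. Qed.

Lemma linear1D (f : V -> R) u v : linear1 f -> f (u + v) = f u + f v.
Proof. by move=> fl; rewrite -[u]scale1r fl mul1r scale1r. Qed.

Lemma linear1_sum f (s : V) : linear1 f -> f s = \sum_i s 0 i * f (delta_mx 0 i).
Proof.
move=> fl; have f0 := linear1_0 fl.
rewrite [in LHS](row_sum_delta s).
elim/big_rec2 : _ => // i y1 y2 _ <-; exact: fl.
Qed.

Lemma is_derive_val (W : normedModType R) (f : U -> W) x v a b :
  a = b -> is_derive x v f a -> is_derive x v f b.
Proof. by move=> ->. Qed.

Lemma is_derive_uniq (W : normedModType R) (f : U -> W) x v a b :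
  is_derive x v f a -> is_derive x v f b -> a = b.
Proof. by move=> [_ <-] [_ <-]. Qed.

Lemma is_derive_coord m k (s : U -> 'M[R]_(m, k)) x v ds i j :
  is_derive x v s ds -> is_derive x v (fun z => s z i j) (ds i j).
Proof.
move=> [sd <-]; apply: DeriveDef; first exact: (derivable_mxP _ _ _).1.
by rewrite derive_mx// mxE.
Qed.

(* The bracketed family is linear in its first argument; differentiating the
   composite with a moving argument gives one term for the argument and one for
   the point. *)
Lemma is_derive_app (B : V -> U -> R) (dB : V -> R) (s : U -> V) x v ds :
  (\forall z \near x, linear1 (B ^~ z)) ->
  (forall u, is_derive x v (B u) (dB u)) -> is_derive x v s ds ->
  is_derive x v (fun z => B (s z) z) (dB (s x) + B ds x).
Proof.
move=> lB DB Ds.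
have lBx := nbhs_singleton lB.
have sumE (u : V) : is_derive x v (fun z => \sum_i u 0 i * B (delta_mx 0 i) z)
    (\sum_i u 0 i * dB (delta_mx 0 i)).
  rewrite (_ : (fun z => _) = \sum_(i < n) (u 0 i *: B (delta_mx 0 i))).
    by apply: is_derive_sum => i; apply: is_deriveZ; exact: DB.
  by apply/funext => z; rewrite fct_sumE.
have dBE (u : V) : dB u = \sum_i u 0 i * dB (delta_mx 0 i).
  apply: is_derive_uniq (DB u) _; apply: near_eq_is_derive (sumE u).
  by apply: filterS lB => z lz; rewrite [RHS](linear1_sum _ lz).
have : is_derive x v (fun z => \sum_i s z 0 i * B (delta_mx 0 i) z)
   (\sum_i (s x 0 i * dB (delta_mx 0 i) + B (delta_mx 0 i) x * ds 0 i)).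
  rewrite (_ : (fun z => _) = \sum_(i < n) ((fun z => s z 0 i) * B (delta_mx 0 i))).
    by apply: is_derive_sum => i; exact: (is_deriveM (is_derive_coord 0 i Ds) (DB _)).
  by apply/funext => z; rewrite fct_sumE.
move=> H; have : is_derive x v (fun z => B (s z) z)
   (\sum_i (s x 0 i * dB (delta_mx 0 i) + B (delta_mx 0 i) x * ds 0 i)).
  apply: near_eq_is_derive H.
  by apply: filterS lB => z lz; rewrite [RHS](linear1_sum _ lz).
apply: is_derive_val; rewrite big_split /= -dBE [in RHS](linear1_sum _ lBx).
by congr (_ + _); apply: eq_bigr => i _; rewrite mulrC.
Qed.

End FamilyDerivative.

(** * Totally symmetric quartic forms of C-reducible shape *)

Section QuarticForm.
Context {R : realFieldType} {V : lmodType R}.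
Variables (h : V -> V -> R) (q : V -> V -> V -> V -> R) (kappa : V -> V -> R) (k : R).
Hypothesis hl : forall Y a u v, h (a *: u + v) Y = a * h u Y + h v Y.
Hypothesis hs : forall X Y, h X Y = h Y X.
Hypothesis h0 : forall X, 0 <= h X X.
Hypothesis hnull : forall X, h X X = 0 ->
  (forall Y, h X Y = 0) /\ (forall Y Z W, q X Y Z W = 0).
Hypothesis qs12 : forall X Y Z W, q X Y Z W = q Y X Z W.
Hypothesis qs23 : forall X Y Z W, q X Y Z W = q X Z Y W.
Hypothesis qs34 : forall X Y Z W, q X Y Z W = q X Y W Z.
Hypothesis kl : forall b a u v, kappa b (a *: u + v) = a * kappa b u + kappa b v.
Hypothesis k0 : k != 0.
Hypothesis qk : forall X Y Z a, q X Y Z a =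
  k * (h X Y * kappa a Z + h Y Z * kappa a X + h Z X * kappa a Y).

(** If [h X X > 0], comparing [q X X X a] with [q X X a X] gives [3 kappa a X = kappa X a];
    exchanging the roles gives [3 kappa X a = kappa a X], so both vanish. If [h X X = 0], then
    [q a a X a = 0] already forces it. *)
Let kappa_orth a X : 0 < h a a -> h a X = 0 -> kappa a X = 0.
Proof.
move=> ha aX.
have [hX|hX|hX] := ltgtP (h X X) 0; first by have := h0 X; rewrite leNgt hX.
  have E : q X X X a = q X X a X by rewrite qs34.
  move: E; rewrite !qk [h X a]hs aX => /(mulfI k0) E1.
  have E : q a a a X = q a a X a by rewrite qs34.
  move: E; rewrite !qk [h X a]hs aX => /(mulfI k0) E2.
  have {}E1 : h X X * (3 * kappa a X - kappa X a) = 0 by lra.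
  have {}E2 : h a a * (3 * kappa X a - kappa a X) = 0 by lra.
  move/eqP: E1; rewrite mulf_eq0 gt_eqF//= => /eqP E1.
  move/eqP: E2; rewrite mulf_eq0 gt_eqF//= => /eqP E2.
  lra.
have [_ q0] := hnull hX.
have : q a a X a = 0 by rewrite qs23 qs12 q0.
rewrite qk [h X a]hs aX => /eqP; rewrite mulf_eq0 (negbTE k0)/= => /eqP E.
have : h a a * kappa a X = 0 by lra.
by move/eqP; rewrite mulf_eq0 gt_eqF//= => /eqP.
Qed.

Let kappa_prop a Z : 0 < h a a -> kappa a Z = h a Z * (kappa a a / h a a).
Proof.
move=> ha; have ha' : h a a != 0 by rewrite gt_eqF.
pose c := h a Z / h a a.
have H : h a ((- c) *: a + Z) = 0.
  by rewrite hs hl [h Z a]hs /c mulNr divfK// addNr.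
have := kappa_orth ha H; rewrite kl => E.
have -> : kappa a Z = c * kappa a a by lra.
by rewrite /c; ring.
Qed.

(** By [kappa_prop] the formula holds for each [a] with [h a a > 0], with a factor depending on [a].
    Equating [q a a v v] with [q v v a a] shows that the factor is the one of [v], since the common
    coefficient [h v v * h a a + 2 (h a v)^2] is positive. Null vectors [a] make both sides zero. *)
Lemma quartic_form v : 0 < h v v -> exists mu, forall X Y Z a,
  q X Y Z a = mu * (h X Y * h a Z + h Y Z * h a X + h Z X * h a Y).
Proof.
move=> hv; exists (k * (kappa v v / h v v)) => X Y Z a.
have qS b X' Y' Z' : 0 < h b b -> q X' Y' Z' b = k * (kappa b b / h b b) *
    (h X' Y' * h b Z' + h Y' Z' * h b X' + h Z' X' * h b Y').
  move=> hb; rewrite qk (kappa_prop X' hb) (kappa_prop Y' hb) (kappa_prop Z' hb).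
  ring.
have [ha|ha|ha] := ltgtP (h a a) 0; first by have := h0 a; rewrite leNgt ha.
  rewrite qS//; congr (_ * _).
  have S0 : 0 < h v v * h a a + 2 * (h a v) ^+ 2.
    by rewrite ltr_pwDl ?mulr_gt0// mulr_ge0// sqr_ge0.
  apply: (mulIf (lt0r_neq0 S0)).
  have : q a a v v = q v v a a.
    by rewrite (qs23 a a v v) (qs12 a v a v) (qs34 v a a v) (qs23 v a v a).
  rewrite !qS// [h v a]hs => E.
  transitivity (k * (kappa a a / h a a) * (h v v * h a a + h v a * h a v + h a v * h a v)).
    by rewrite [h v a]hs; ring.
  rewrite [h v a]hs -E; ring.
have [n0 q0] := hnull ha.
have -> : q X Y Z a = 0 by rewrite qs34 qs23 qs12 q0.
by rewrite !n0; ring.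
Qed.

End QuarticForm.

(** * Calculus in one punctured fibre *)

Section Fibre.
Context {R : realType} {n : nat}.
Notation V := 'rV[R]_n.
(** Everything is read at one base point: [G] is the metric, [Cc] the Cartan tensor, [Gx a] and
    [Cx a] their derivatives in the base direction [a], and [Ga y a X] the connection coefficient
    along the horizontal lift of [a] at [y]. *)
Variables (G : V -> V -> V -> R) (Cc : V -> V -> V -> V -> R)
  (Gx : V -> V -> V -> V -> R) (Cx : V -> V -> V -> V -> V -> R)
  (Ga : V -> V -> V -> V).

Hypothesis Gl : forall y : V, y != 0 -> forall Y, linear1 (fun X => G X Y y).
Hypothesis Gs : forall y : V, y != 0 -> forall X Y, G X Y y = G Y X y.
Hypothesis Gp : forall y : V, y != 0 -> forall X, X != 0 -> 0 < G X X y.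
Hypothesis Cl : forall y : V, y != 0 -> forall Y Z, linear1 (fun X => Cc X Y Z y).
Hypothesis Cs12 : forall y : V, y != 0 -> forall X Y Z, Cc X Y Z y = Cc Y X Z y.
Hypothesis Cs23 : forall y : V, y != 0 -> forall X Y Z, Cc X Y Z y = Cc X Z Y y.
Hypothesis Cy : forall y : V, y != 0 -> forall X Y, Cc y X Y y = 0.
Hypothesis Gxl1 : forall y : V, y != 0 -> forall X Y, linear1 (fun a => Gx a X Y y).
Hypothesis Gxl2 : forall y : V, y != 0 -> forall a Y, linear1 (fun X => Gx a X Y y).
Hypothesis Gxs : forall y : V, y != 0 -> forall a X Y, Gx a X Y y = Gx a Y X y.
Hypothesis Cxs12 : forall y : V, y != 0 -> forall a X Y Z, Cx a X Y Z y = Cx a Y X Z y.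
Hypothesis Cxs23 : forall y : V, y != 0 -> forall a X Y Z, Cx a X Y Z y = Cx a X Z Y y.
Hypothesis Cxy : forall y : V, y != 0 -> forall a X Y, Cx a y X Y y = 0.
Hypothesis dG : forall y : V, y != 0 -> forall X Y W,
  is_derive y W (G X Y) (2 * Cc W X Y y).
Hypothesis dGx : forall y : V, y != 0 -> forall a X Y W,
  is_derive y W (Gx a X Y) (2 * Cx a W X Y y).
Hypothesis dC : forall y : V, y != 0 -> forall X Y Z W, derivable (Cc X Y Z) y W.
Hypothesis DCs : forall y : V, y != 0 -> forall X Y Z W,
  'D_W (Cc X Y Z) y = 'D_X (Cc W Y Z) y.

Hypothesis Gal : forall y : V, y != 0 -> forall a (b : R) u v,
  Ga y a (b *: u + v) = b *: Ga y a u + Ga y a v.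
Hypothesis Gas : forall y : V, y != 0 -> forall a X, Ga y a X = Ga y X a.
Hypothesis Gasm : forall y : V, y != 0 -> forall a X, smooth_at (fun y => Ga y a X) y.
(** Parallelism of the metric along the horizontal lift [(a, - Ga y a y)]; the vertical part of the
    lift produces the term in [Cc]. *)
Hypothesis met : forall y : V, y != 0 -> forall a X Y,
  Gx a X Y y - 2 * Cc (Ga y a y) X Y y = G (Ga y a X) Y y + G X (Ga y a Y) y.

Let near_ne0 (P : V -> Prop) (y : V) : y != 0 -> (forall z : V, z != 0 -> P z) -> \forall z \near y, P z.
Proof.
move=> y0 H; have Hn : nbhs y `=>` nbhs y by [].
by apply: filterS (@cvgr_neq0 R V V (nbhs y) _ id y Hn y0) => z /H.
Qed.

Let nondeg (y u v : V) : y != 0 -> (forall Y, G u Y y = G v Y y) -> u = v.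
Proof.
move=> y0 H; apply/eqP; rewrite -subr_eq0; apply/negPn/negP => /(Gp y0).
set w := u - v; have E : G u w y = G (w + v) w y by rewrite /w subrK.
have := H w; rewrite E -[w in G (w + v)]scale1r (Gl y0) mul1r => /eqP.
by rewrite -subr_eq0 addrK => /eqP ->; rewrite ltxx.
Qed.

Let der_eq (f g : V -> R) (y X : V) (a b : R) : (forall z : V, z != 0 -> f z = g z) -> y != 0 ->
  is_derive y X f a -> is_derive y X g b -> a = b.
Proof.
move=> fg y0 df; apply: is_derive_uniq; apply: near_eq_is_derive df.
exact: near_ne0.
Qed.

Let dscale (f : V -> R) (y X : V) (a k : R) : is_derive y X f a -> is_derive y X (fun z => k * f z) (k * a).
Proof. by move=> df; have := @is_deriveZ _ _ _ f k y X a df. Qed.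

Let dadd (f g : V -> R) (y X : V) (a b : R) : is_derive y X f a -> is_derive y X g b ->
  is_derive y X (fun z => f z + g z) (a + b).
Proof. by move=> df dg; have := is_deriveD df dg. Qed.

Let dsub (f g : V -> R) (y X : V) (a b : R) : is_derive y X f a -> is_derive y X g b ->
  is_derive y X (fun z => f z - g z) (a - b).
Proof. by move=> df dg; have := is_deriveB df dg. Qed.

Let did (y X : V) : is_derive y X id X. Proof. exact: is_derive_id. Qed.

Let dGs (s : V -> V) (y X ds Y : V) : y != 0 -> is_derive y X s ds ->
  is_derive y X (fun z => G (s z) Y z) (2 * Cc X (s y) Y y + G ds Y y).
Proof.
move=> y0 Ds; apply: (is_derive_app (B := fun u z => G u Y z)
  (dB := fun u => 2 * Cc X u Y y)) => //.
- by apply: near_ne0 => // z z0; exact: Gl.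
- by move=> u; exact: dG.
Qed.

Let dCs (s : V -> V) (y X ds Y Z : V) : y != 0 -> is_derive y X s ds ->
  is_derive y X (fun z => Cc (s z) Y Z z) ('D_X (Cc (s y) Y Z) y + Cc ds Y Z y).
Proof.
move=> y0 Ds; apply: (is_derive_app (B := fun u z => Cc u Y Z z)
  (dB := fun u => 'D_X (Cc u Y Z) y)) => //.
- by apply: near_ne0 => // z z0; exact: Cl.
- by move=> u; apply: derivableP; exact: dC.
Qed.

Let dGx1 (y X a Y : V) : y != 0 ->
  is_derive y X (fun z => Gx a z Y z) (Gx a X Y y).
Proof.
move=> y0; have : is_derive y X (fun z => Gx a z Y z) (2 * Cx a X y Y y + Gx a X Y y).
  apply: (is_derive_app (s := id) (B := fun u z => Gx a u Y z)
    (dB := fun u => 2 * Cx a X u Y y)) => //.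
  - by apply: near_ne0 => // z z0; exact: Gxl2.
  - by move=> u; exact: dGx.
by apply: is_derive_val; rewrite Cxs12// Cxy// mulr0 add0r.
Qed.

Let dGx0 (y X a Y : V) : y != 0 ->
  is_derive y X (fun z => Gx z a Y z) (2 * Cx y X a Y y + Gx X a Y y).
Proof.
move=> y0; apply: (is_derive_app (s := id) (B := fun u z => Gx u a Y z)
    (dB := fun u => 2 * Cx u X a Y y)) => //.
- by apply: near_ne0 => // z z0; exact: Gxl1.
- by move=> u; exact: dGx.
Qed.

Let dGx01 (y X Y : V) : y != 0 ->
  is_derive y X (fun z => Gx z z Y z) (Gx y X Y y + Gx X y Y y).
Proof.
move=> y0; apply: (is_derive_app (s := id) (B := fun u z => Gx u z Y z)
    (dB := fun u => Gx u X Y y)) => //.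
- by apply: near_ne0 => // z z0; exact: Gxl1.
- by move=> u; exact: dGx1.
Qed.

Let dGx12 (y X Y : V) : y != 0 ->
  is_derive y X (fun z => Gx Y z z z) (2 * Gx Y X y y).
Proof.
move=> y0; have : is_derive y X (fun z => Gx Y z z z) (Gx Y X y y + Gx Y X y y).
  apply: (is_derive_app (s := id) (B := fun u z => Gx Y u z z)
    (dB := fun u => Gx Y X u y)) => //.
  - by apply: near_ne0 => // z z0; exact: Gxl2.
  - move=> u; apply: near_eq_is_derive (dGx1 X Y u y0).
    by apply: near_ne0 => // z z0; rewrite Gxs.
by apply: is_derive_val; ring.
Qed.

Let C2 (y X Y : V) : y != 0 -> Cc X y Y y = 0. Proof. by move=> y0; rewrite Cs12// Cy. Qed.
Let C3 (y X Y : V) : y != 0 -> Cc X Y y y = 0. Proof. by move=> y0; rewrite Cs23// C2. Qed.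

(** Three permutations of [met] combined as in the Levi-Civita case, with the symmetry [Gas] in
    place of vanishing torsion. *)
Let koszul (y a X Y : V) : y != 0 -> 2 * G (Ga y a X) Y y =
  Gx a X Y y + Gx X a Y y - Gx Y a X y - 2 * Cc (Ga y a y) X Y y
  - 2 * Cc (Ga y X y) a Y y + 2 * Cc (Ga y Y y) a X y.
Proof.
move=> y0; have E1 := met y0 a X Y; have E2 := met y0 X a Y; have E3 := met y0 Y a X.
have g1 : G X (Ga y a Y) y = G (Ga y Y a) X y by rewrite Gs// (Gas y0 a Y).
have g2 : G (Ga y X a) Y y = G (Ga y a X) Y y by rewrite (Gas y0 a X).
have g3 : G a (Ga y X Y) y = G a (Ga y Y X) y by rewrite (Gas y0 Y X).
lra.
Qed.

Let E1 (y a Y : V) : y != 0 -> 2 * G (Ga y a y) Y y =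
  Gx a y Y y + Gx y a Y y - Gx Y a y y - 2 * Cc (Ga y y y) a Y y.
Proof. by move=> y0; have := koszul a y Y y0; rewrite C2// C3//; lra. Qed.

Let E2 (y Y : V) : y != 0 -> 2 * G (Ga y y y) Y y = 2 * Gx y y Y y - Gx Y y y y.
Proof. by move=> y0; have := E1 y Y y0; rewrite C2//; lra. Qed.

Let Ga_expand (y a X : V) : y != 0 -> Ga y a X = \sum_i X 0 i *: Ga y a (delta_mx 0 i).
Proof.
move=> y0; have g0 : Ga y a 0 = 0.
  have := Gal y0 a 1 0 0; rewrite !scale1r addr0 => /eqP.
  by rewrite -subr_eq0 opprD addrA subrr add0r oppr_eq0 => /eqP.
rewrite [in LHS](row_sum_delta X).
by elim/big_rec2 : _ => // i y1 y2 _ <-; exact: Gal.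
Qed.

Let coord_smooth i (y : V) : smooth_at (fun z : V => z 0 i) y.
Proof.
move=> k; exact: (@Ck_at_linear R _ R k (coordinate 0 i)) (@coordinate_continuous R 1 n 0 i).
Qed.

Let N_smooth (a y : V) : y != 0 -> smooth_at (fun z => Ga z a z) y.
Proof.
move=> y0; have : smooth_at (fun z : V => \sum_i z 0 i *: Ga z a (delta_mx 0 i)) y.
  move=> k; apply: Ck_at_sum => i _; apply: Ck_at_scale; first exact: coord_smooth.
  exact: Gasm.
by apply: smooth_at_near; apply: near_ne0 => // z z0; rewrite -Ga_expand.
Qed.

Let S_smooth (y : V) : y != 0 -> smooth_at (fun z => Ga z z z) y.
Proof.
move=> y0; have : smooth_at (fun z : V => \sum_i z 0 i *: Ga z (delta_mx 0 i) z) y.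
  move=> k; apply: Ck_at_sum => i _; apply: Ck_at_scale; first exact: coord_smooth.
  exact: N_smooth.
apply: smooth_at_near; apply: near_ne0 => // z z0; rewrite [RHS]Ga_expand//.
by apply: eq_bigr => i _; rewrite Gas.
Qed.

Let smooth_derive (s : V -> V) (y X : V) : smooth_at s y -> is_derive y X s ('D_X s y).
Proof. by move=> ss; apply: derivableP; apply: diff_derivable; exact: smooth_at_differentiable. Qed.

(** The fibre derivative of [E2], which determines the spray, is matched against [E1]: the classical
    fact that the nonlinear connection is half the derivative of the spray. *)
Lemma derive_spray (y X : V) : y != 0 -> 'D_X (fun z => Ga z z z) y = 2 *: Ga y X y.
Proof.
move=> y0; apply: (nondeg y0) => Y.
have E := der_eq (fun z => @E2 z Y) y0
  (dscale 2 (dGs Y y0 (smooth_derive X (S_smooth y0))))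
  (dsub (dscale 2 (dGx01 X Y y0)) (dGx12 X Y y0)).
have E' := E1 X Y y0; have e1 := Cs12 y0 X (Ga y y y) Y.
rewrite -[2 *: _]addr0 (Gl y0).
have -> : G 0 Y y = 0.
  have := Gl y0 Y 1 0 0; rewrite scale1r addr0 mul1r; lra.
lra.
Qed.

Hypothesis land : forall y : V, y != 0 -> forall X Y Z,
  Cx y X Y Z y - 'D_(Ga y y y) (Cc X Y Z) y =
  Cc (Ga y y X) Y Z y + Cc X (Ga y y Y) Z y + Cc X Y (Ga y y Z) y.

(** Landsberg spaces are those where the Berwald coefficients, fibre derivatives of the nonlinear
    connection, equal the Cartan ones. Differentiating [E1] yields the right side of [koszul] up to
    the terms that [land] supplies. *)
Lemma derive_nonlinear (y a X : V) : y != 0 -> 'D_X (fun z => Ga z a z) y = Ga y a X.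
Proof.
move=> y0; apply: (nondeg y0) => Y.
have E := der_eq (fun z => @E1 z a Y) y0
  (dscale 2 (dGs Y y0 (smooth_derive X (N_smooth a y0))))
  (dsub (dsub (dadd (dGx1 X a Y y0) (dGx0 X a Y y0))
     (near_eq_is_derive (near_ne0 y0 (fun z z0 => Gxs z0 Y z a)) (dGx1 X Y a y0)))
     (dscale 2 (dCs a Y y0 (smooth_derive X (S_smooth y0))))).
have K := koszul a X Y y0; have L := land y0 X a Y.
have L2 : Cc ('D_X (fun z => Ga z z z) y) a Y y = 2 * Cc (Ga y X y) a Y y.
  rewrite derive_spray// -[2 *: _]addr0 (Cl y0).
  by have := Cl y0 a Y 1 0 0; rewrite scale1r addr0 mul1r; lra.
(* Exchanging the direction with the first argument turns the derivative into the one along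
   [Ga y y y], which is the derivative occurring in [land]. *)
rewrite L2 (DCs y0 _ a Y X) (Gxs y0 Y X a) in E.
have e1 : Cc X (Ga y a y) Y y = Cc (Ga y a y) X Y y by rewrite Cs12.
have e2 : Cc (Ga y y X) a Y y = Cc (Ga y X y) a Y y by rewrite (Gas y0 y X).
have e3 : Cc X (Ga y y a) Y y = Cc (Ga y a y) X Y y by rewrite (Gas y0 y a) Cs12.
have e4 : Cc X a (Ga y y Y) y = Cc (Ga y Y y) a X y.
  by rewrite (Gas y0 y Y) Cs23// Cs12// Cs23// Cs12// Cs23// Cs12.
lra.
Qed.

(** The covariant derivative of the Cartan tensor along the horizontal lift of [a]. *)
Definition fibreT (a X Y Z y : V) : R :=
  Cx a X Y Z y - 'D_(Ga y a y) (Cc X Y Z) y - Cc (Ga y a X) Y Z y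
  - Cc X (Ga y a Y) Z y - Cc X Y (Ga y a Z) y.

Let Dcs12 (y X Y Z W : V) : y != 0 -> 'D_W (Cc X Y Z) y = 'D_W (Cc Y X Z) y.
Proof. by move=> y0; apply: near_eq_derive; apply: near_ne0 => // z z0; exact: Cs12. Qed.
Let Dcs23 (y X Y Z W : V) : y != 0 -> 'D_W (Cc X Y Z) y = 'D_W (Cc X Z Y) y.
Proof. by move=> y0; apply: near_eq_derive; apply: near_ne0 => // z z0; exact: Cs23. Qed.

Let fT12 (y a X Y Z : V) : y != 0 -> fibreT a X Y Z y = fibreT a Y X Z y.
Proof.
move=> y0; rewrite /fibreT (Cxs12 y0 a X) (Dcs12 X Y Z _ y0) (Cs12 y0 (Ga y a X)).
by rewrite (Cs12 y0 X (Ga y a Y)) (Cs12 y0 X Y); lra.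
Qed.

Let fT23 (y a X Y Z : V) : y != 0 -> fibreT a X Y Z y = fibreT a X Z Y y.
Proof.
move=> y0; rewrite /fibreT (Cxs23 y0 a X) (Dcs23 X Y Z _ y0) (Cs23 y0 (Ga y a X)).
by rewrite (Cs23 y0 X (Ga y a Y)) (Cs23 y0 X Y); lra.
Qed.

(** Under [land] this is the hv-curvature of the Berwald connection, half the third fibre derivative
    of the spray. *)
Definition hv_curvature (a X Z z : V) : V := 'D_Z (fun z => Ga z a X) z.

Let Q12 (y a X Z : V) : y != 0 -> hv_curvature a X Z y = hv_curvature X a Z y.
Proof.
by move=> y0; apply: near_eq_derive; apply: near_ne0 => // z z0; rewrite Gas.
Qed.

Let DD_spray (y a X : V) : y != 0 ->
  'D_X ('D_a (fun z => Ga z z z)) y = 2 *: Ga y a X.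
Proof.
move=> y0; rewrite -(derive_nonlinear a X y0).
have E : \forall z \near y, 'D_a (fun z => Ga z z z) z = 2 *: Ga z a z.
  by apply: near_ne0 => // z z0; exact: derive_spray.
rewrite (near_eq_derive X E); apply: deriveZ.
by have [] := smooth_derive X (N_smooth a y0).
Qed.

Let Q23 (y a X Z : V) : y != 0 -> hv_curvature a X Z y = hv_curvature a Z X y.
Proof.
move=> y0.
have K X' Z' : 2 *: hv_curvature a X' Z' y = 'D_Z' ('D_X' ('D_a (fun z => Ga z z z))) y.
  have E : \forall z \near y, 'D_X' ('D_a (fun z => Ga z z z)) z = 2 *: Ga z a X'.
    by apply: near_ne0 => // z z0; exact: DD_spray.
  rewrite (near_eq_derive Z' E); apply: esym; apply: deriveZ.
  by have [] := smooth_derive Z' (Gasm y0 a X').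
have n2 : (2 : R) != 0 by rewrite pnatr_eq0.
apply: (scalerI n2); rewrite !K; apply: schwarz_rV.
by apply: smooth_at_D; exact: S_smooth.
Qed.

(** The derivative of [met] along [Z]. By [derive_nonlinear] the moving argument [Ga z a z]
    contributes [Ga y a Z], the last ingredient of [fibreT]. *)
Lemma hv_curvature_fibreT (y a X Y Z : V) : y != 0 ->
  2 * fibreT a Z X Y y = G (hv_curvature a X Z y) Y y + G (hv_curvature a Y Z y) X y.
Proof.
move=> y0.
have E := der_eq (fun z z0 => met z0 a X Y) y0
  (dsub (dGx y0 a X Y Z) (dscale 2 (dCs X Y y0 (smooth_derive Z (N_smooth a y0)))))
  (dadd (dGs Y y0 (smooth_derive Z (Gasm y0 a X)))
     (near_eq_is_derive (near_ne0 y0 (fun z z0 => Gs z0 (Ga z a Y) X))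
        (dGs X y0 (smooth_derive Z (Gasm y0 a Y))))).
rewrite (derive_nonlinear a Z y0) (DCs y0 _ X Y Z) in E.
rewrite /fibreT /hv_curvature (Cs23 y0 Z X).
lra.
Qed.

(** [fibreT] is symmetric in [Z] and [X], and the curvature in its last two arguments, so the vector
    paired by [G] may be exchanged with an argument of the curvature. Hence the two terms of
    [hv_curvature_fibreT] are equal. *)
Lemma fibreTE (y a X Y Z : V) : y != 0 -> fibreT a Z X Y y = G (hv_curvature a X Z y) Y y.
Proof.
move=> y0.
suff S : G (hv_curvature a Y Z y) X y = G (hv_curvature a X Z y) Y y.
  have := hv_curvature_fibreT a X Y Z y0; lra.
have swap X' Y' Z' : G (hv_curvature a Y' Z' y) X' y = G (hv_curvature a Y' X' y) Z' y.
  have H1 := hv_curvature_fibreT a X' Y' Z' y0.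
  have H2 := hv_curvature_fibreT a Z' Y' X' y0.
  rewrite (fT12 a Z' X' Y' y0) (Q23 a X' Z' y0) in H1; lra.
by rewrite (swap X Y Z) (Q23 a Y X y0) (swap Z X Y).
Qed.

Let fTy (y a X Y : V) : y != 0 -> fibreT a y X Y y = 0.
Proof.
move=> y0; have D0 : is_derive y (Ga y a y) (fun z => Cc z X Y z) 0.
  have := @is_derive_cst R V R 0 y (Ga y a y); apply: near_eq_is_derive.
  by apply: near_ne0 => // z z0; rewrite Cy.
have D1 := dCs (s := id) X Y y0 (did y (Ga y a y)).
have E := is_derive_uniq D0 D1.
by rewrite /fibreT (Cxy y0) !(Cy y0) -[Cc y]/(Cc (id y)); lra.
Qed.

(* [h] is the angular metric, with [L^2] written as [G y y y]. *)
Let h (X Y z : V) : R := G X Y z - G z X z * G z Y z / G z z z.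

Variables (Cf : V -> V -> R) (kappa : V -> V -> V -> R) (k : R).
Hypothesis k0 : k != 0.
Hypothesis Cfl : forall y : V, y != 0 -> linear1 (fun X => Cf X y).
Hypothesis kl : forall y : V, y != 0 -> forall a, linear1 (kappa y a).
Hypothesis Cred : forall y : V, y != 0 -> forall X Y Z, Cc X Y Z y =
  k * (h X Y y * Cf Z y + h Y Z y * Cf X y + h Z X y * Cf Y y).
Hypothesis Tred : forall y : V, y != 0 -> forall a X Y Z, fibreT a X Y Z y =
  k * (h X Y y * kappa y a Z + h Y Z y * kappa y a X + h Z X y * kappa y a Y).
Hypothesis n3 : (3 <= n)%N.

Let Gl2 (y X : V) : y != 0 -> linear1 (fun Y => G X Y y).
Proof. by move=> y0 a u v; rewrite Gs// Gl// (Gs y0 u) (Gs y0 v). Qed.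

Let hl (y Y : V) : y != 0 -> linear1 (fun X => h X Y y).
Proof.
move=> y0 a u v; have g0 : G y y y != 0 by rewrite gt_eqF// Gp.
by rewrite /h (Gl y0) (Gl2 y y0); field.
Qed.

Let hs (y X Y : V) : y != 0 -> h X Y y = h Y X y.
Proof. by move=> y0; rewrite /h (Gs y0 X) [G y X y * _]mulrC. Qed.

Let hperp (y X Y : V) : y != 0 -> G X y y = 0 -> h X Y y = G X Y y.
Proof. by move=> y0; rewrite (Gs y0) /h => ->; rewrite !mul0r subr0. Qed.

Let hy (y Y : V) : y != 0 -> h y Y y = 0.
Proof.
move=> y0; have g0 : G y y y != 0 by rewrite gt_eqF// Gp.
by rewrite /h; field.
Qed.

Let radial (y X : V) := G y X y / G y y y.

Let perp_part (y X : V) : y != 0 -> G (X - radial y X *: y) y y = 0.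
Proof.
move=> y0; have g0 : G y y y != 0 by rewrite gt_eqF// Gp.
rewrite addrC -scaleNr (Gl y0) (Gs y0 X) /radial; by field.
Qed.

Let h_part (y X : V) : y != 0 ->
  h X X y = G (X - radial y X *: y) (X - radial y X *: y) y.
Proof.
move=> y0; have g0 : G y y y != 0 by rewrite gt_eqF// Gp.
rewrite [in RHS]addrC -scaleNr (Gl y0) !(Gl2 _ y0) (Gs y0 X y) /h /radial; by field.
Qed.

Let h_ge0 (y X : V) : y != 0 -> 0 <= h X X y.
Proof.
move=> y0; rewrite h_part//; set w := _ - _.
have [->|w0] := eqVneq w 0; first by rewrite (linear1_0 (Gl y0 0)).
exact/ltW/Gp.
Qed.

Let h_null (y X : V) : y != 0 -> h X X y = 0 -> X = radial y X *: y.
Proof.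
move=> y0; rewrite h_part// => H; apply/eqP; rewrite -subr_eq0.
by apply/negPn/negP => /(Gp y0); rewrite H ltxx.
Qed.

Let S4 (X Y Z a z : V) := h X Y z * h a Z z + h Y Z z * h a X z + h Z X z * h a Y z.

Let fTrot (y a X Y Z : V) : y != 0 -> fibreT a X Y Z y = fibreT a Z X Y y.
Proof. by move=> y0; rewrite (fT23 a X Y Z y0) (fT12 a X Z Y y0). Qed.

(** The direction of differentiation joins the symmetry: in the form [fibreTE] it is an argument of
    the totally symmetric curvature. *)
Let fT34 (y a X Y Z : V) : y != 0 -> fibreT Z X Y a y = fibreT a X Y Z y.
Proof.
move=> y0; rewrite (fTrot Z X Y a y0) (fTrot a X Y Z y0).
rewrite (fibreTE Z X Y a y0) (fibreTE a X Y Z y0).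
by rewrite (Q23 Z X a y0) (Q12 Z a X y0) (Q23 a Z X y0).
Qed.

Let fT_quartic (y v : V) : y != 0 -> 0 < h v v y -> exists mu, forall X Y Z a,
  fibreT a X Y Z y = mu * S4 X Y Z a y.
Proof.
move=> y0 hv.
(* A null vector of [h] is a multiple of [y], and [fibreT] vanishes on [y]. Homogeneity of [fibreT]
   in that slot is read off the metric in [fibreTE]. *)
have qnull X : h X X y = 0 -> (forall Y, h X Y y = 0) /\
    (forall Y Z W, fibreT W X Y Z y = 0).
  move=> hX; rewrite (h_null y0 hX); move: (radial y X) => c; split=> [Y|Y Z W].
    by rewrite (linear1Z _ _ (hl Y y0)) hy// mulr0.
  have E u : fibreT W u Y Z y = G (hv_curvature W Z Y y) u y.
    by rewrite -(fTrot W Y Z u y0) (fT23 W Y Z u y0) (fT23 W Y u Z y0) fibreTE.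
  by rewrite E (linear1Z _ _ (Gl2 _ y0)) -E fTy// mulr0.
exact: (@quartic_form R V (fun X Y => h X Y y) (fun X Y Z a => fibreT a X Y Z y)
  (kappa y) k (fun Y => hl Y y0) (fun X Y => hs X Y y0) (fun X => h_ge0 X y0) qnull
  (fun X Y Z W => fT12 W X Y Z y0) (fun X Y Z W => fT23 W X Y Z y0)
  (fun X Y Z W => fT34 Z X Y W y0) (kl y0) k0 (fun X Y Z a => Tred y0 a X Y Z) v hv).
Qed.

(** The values on the basis form a matrix with two columns, whose rank is less than [n]. *)
Lemma common_kernel (f g : V -> R) : linear1 f -> linear1 g ->
  exists v, [/\ v != 0, f v = 0 & g v = 0].
Proof.
move=> fl gl.
pose A : 'M[R]_(n, 2) := \matrix_(i, j) (if j == 0 then f (delta_mx 0 i) else g (delta_mx 0 i)).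
have : kermx A != 0.
  rewrite -mxrank_eq0 mxrank_ker -lt0n subn_gt0.
  by apply: leq_ltn_trans (rank_leq_col A) _; exact: n3.
case/rowV0Pn => v /sub_kermxP vA v0; exists v; split=> //.
  rewrite (linear1_sum v fl); have := congr1 (fun B : 'rV_2 => B 0 0) vA.
  by rewrite !mxE => E; rewrite -[RHS]E; apply: eq_bigr => i _; rewrite mxE.
rewrite (linear1_sum v gl); have := congr1 (fun B : 'rV_2 => B 0 1) vA.
by rewrite !mxE => E; rewrite -[RHS]E; apply: eq_bigr => i _; rewrite mxE.
Qed.

Section AtPoint.
Variables (y : V) (v : V).
Hypotheses (y0 : y != 0) (v0 : v != 0) (vy : G v y y = 0).

(** [h v v] vanishes at [z] only if [v] is a multiple of [z]. Then [z] is orthogonal to [y] for the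
    metric frozen at [y], which the continuous function [F] excludes near [y]. *)
Let near_h : \forall z \near y, z != 0 /\ 0 < h v v z.
Proof.
pose F (z : V) : R := \sum_i z 0 i * G (delta_mx 0 i) y y.
have fc : {for y, continuous F}.
  apply: (@Ck_at_continuous R V R 0); apply: Ck_at_sum => i _.
  by apply: Ck_at_mul; [exact: coord_smooth|exact: Ck_at_cst].
have f0 : F y != 0.
  by rewrite /F -(linear1_sum y (Gl y0 y)) gt_eqF// Gp.
have fn0 : \forall z \near y, F z != 0.
  exact: cvgr_neq0 _ fc f0.
have zn0 : \forall z \near y, z != 0 by apply: near_ne0.
apply: filterS (filterI zn0 fn0) => z [z0 fz]; split=> //.
rewrite lt_neqAle h_ge0// andbT eq_sym; apply/eqP => hz.
move: fz; rewrite /F -(linear1_sum z (Gl y0 y)) => /eqP; apply.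
have Ez := h_null z0 hz.
have c0 : radial z v != 0.
  by apply: contra_neq v0 => c0; rewrite Ez c0 scale0r.
have : G (radial z v *: z) y y = 0 by rewrite -Ez.
by rewrite (linear1Z _ _ (Gl y0 y)) => /eqP; rewrite mulf_eq0 (negbTE c0)/= => /eqP.
Qed.

(** The factor from [fT_quartic], solved for at [X = Y = Z = a = v], where [S4] equals
    [3 * h v v * h v v]. An explicit formula is required because [mu] will be differentiated. *)
Let mu (z : V) := G (hv_curvature v v v z) v z * (3 * (h v v z * h v v z))^-1.

Let muE : \forall z \near y, forall X Y Z a,
  G (hv_curvature a X Z z) Y z = mu z * S4 X Y Z a z.
Proof.
apply: filterS near_h => z [z0 hz] X Y Z a.
have [m Em] := fT_quartic z0 hz.
have -> : mu z = m.
  rewrite /mu -fibreTE// Em /S4; field; by rewrite gt_eqF.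
by rewrite -fibreTE// -Em (fTrot a X Y Z z0).
Qed.

Let GD (X X' Y : V) : G (X + X') Y y = G X Y y + G X' Y y.
Proof. by rewrite -[X]scale1r (Gl y0) scale1r mul1r. Qed.
Let GZ b (X Y : V) : G (b *: X) Y y = b * G X Y y.
Proof. exact: (linear1Z _ _ (Gl y0 Y)). Qed.
Let CD (X X' Y Z : V) : Cc (X + X') Y Z y = Cc X Y Z y + Cc X' Y Z y.
Proof. by rewrite -[X]scale1r (Cl y0) scale1r mul1r. Qed.
Let CZ b (X Y Z : V) : Cc (b *: X) Y Z y = b * Cc X Y Z y.
Proof. exact: (linear1Z _ _ (Cl y0 Y Z)). Qed.

Let dprod (f g : V -> R) (X : V) (a b : R) : is_derive y X f a -> is_derive y X g b ->
  is_derive y X (fun z => f z * g z) (f y * b + g y * a).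
Proof. by move=> df dg; have := is_deriveM df dg. Qed.

Let dinv (f : V -> R) (X : V) (a : R) : f y != 0 -> is_derive y X f a ->
  is_derive y X (fun z => (f z)^-1) (- f y ^- 2 * a).
Proof.
move=> f0 [df <-]; apply: DeriveDef; first exact: derivableV.
by rewrite deriveV.
Qed.

Let dGy (X W : V) : is_derive y W (fun z => G z X z) (G W X y).
Proof.
have := dGs (s := id) X y0 (did y W).
by apply: is_derive_val; rewrite C2// mulr0 add0r.
Qed.

Let dGyy (W : V) : is_derive y W (fun z => G z z z) (G W y y + G W y y).
Proof.
apply: (is_derive_app (s := id) (B := fun u z => G u z z) (dB := fun u => G W u y)) => //.
- by apply: near_ne0 => // z z0 a u w; exact: Gl.
- move=> u; apply: near_eq_is_derive (dGy u W).
  by apply: near_ne0 => // z z0; rewrite Gs.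
Qed.

(** The witness [i] is the derivative of the inverse of [G z z z]. It can stay unnamed: [dmu] uses
    only derivability, and in [dh] its coefficient vanishes on vectors orthogonal to [y]. *)
Let dh_gen (X Y W : V) : exists i, is_derive y W (h X Y) (2 * Cc W X Y y -
  (G y X y * G y Y y * i + (G y y y)^-1 * (G y X y * G W Y y + G y Y y * G W X y))).
Proof.
have g0 : G y y y != 0 by rewrite gt_eqF// Gp.
eexists; exact: (dsub (dG y0 X Y W) (dprod (dprod (dGy X W) (dGy Y W)) (dinv g0 (dGyy W)))).
Qed.

Let dh (X Y W : V) : G X y y = 0 -> G Y y y = 0 -> is_derive y W (h X Y) (2 * Cc W X Y y).
Proof.
move=> Xy Yy; have [i] := dh_gen X Y W; apply: is_derive_val.
by rewrite !(Gs y0 y) Xy Yy; ring.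
Qed.

Let dmu W : is_derive y W mu ('D_W mu y).
Proof.
have [i dhv] := dh_gen v v W.
have h0 : 3 * (h v v y * h v v y) != 0.
  have [_ /lt0r_neq0 hv] := nbhs_singleton near_h.
  by rewrite !mulf_neq0// pnatr_eq0.
have dQ := smooth_derive W (smooth_at_D v (Gasm y0 v v)).
have [D _] := dprod (dGs v y0 dQ) (dinv h0 (dscale 3 (dprod dhv dhv))).
exact: derivableP.
Qed.

Let dS4 (X Y Z a W : V) : G X y y = 0 -> G Y y y = 0 -> G Z y y = 0 -> G a y y = 0 ->
  is_derive y W (S4 X Y Z a)
  (h X Y y * (2 * Cc W a Z y) + h a Z y * (2 * Cc W X Y y) +
   (h Y Z y * (2 * Cc W a X y) + h a X y * (2 * Cc W Y Z y)) +
   (h Z X y * (2 * Cc W a Y y) + h a Y y * (2 * Cc W Z X y))).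
Proof.
move=> Xy Yy Zy ay; exact: (dadd (dadd (dprod (dh W Xy Yy) (dh W ay Zy))
  (dprod (dh W Yy Zy) (dh W ay Xy))) (dprod (dh W Zy Xy) (dh W ay Yy))).
Qed.

Let hvE (X Z a : V) : G X y y = 0 -> G Z y y = 0 -> G a y y = 0 ->
  hv_curvature a X Z y = mu y *: (h a Z y *: X + h a X y *: Z + h Z X y *: a).
Proof.
move=> Xy Zy ay; apply: (nondeg y0) => Y.
rewrite (nbhs_singleton muE) GZ !GD !GZ /S4 (hs Y Z y0).
by rewrite (hperp Y y0 Xy) (hperp Y y0 Zy) (hperp Y y0 ay); ring.
Qed.

(** The derivative of [muE] along [W]. Besides that of [mu], it contains derivatives of the metric
    on both sides, each a value of [2 Cc]; on the left they are expanded by [hvE]. *)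
Let derive_identity (X Y Z a W : V) :
  G X y y = 0 -> G Y y y = 0 -> G Z y y = 0 -> G a y y = 0 -> G W y y = 0 ->
  G ('D_W (hv_curvature a X Z) y) Y y = S4 X Y Z a y * 'D_W mu y + 2 * mu y *
   (h X Y y * Cc W a Z y + h Y Z y * Cc W a X y + h a Y y * Cc W Z X y).
Proof.
move=> Xy Yy Zy ay Wy.
have dQ := smooth_derive W (smooth_at_D Z (Gasm y0 a X)).
have E : \forall z \near y, G (hv_curvature a X Z z) Y z = mu z * S4 X Y Z a z.
  by apply: filterS muE => z.
have D1 := near_eq_is_derive E (dGs Y y0 dQ).
have := is_derive_uniq D1 (dprod (dmu W) (dS4 W Xy Yy Zy ay)).
rewrite -/(hv_curvature a X Z y) (hvE Xy Zy ay) (Cs12 y0 W) CZ !CD !CZ.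
rewrite (Cs12 y0 X W Y) (Cs12 y0 Z W Y) (Cs12 y0 a W Y) (Cs23 y0 W Z Y).
rewrite -/(hv_curvature a X Z).
move: ('D_W mu y) (G _ Y y) (mu y) => m1 g m E'; lra.
Qed.

(** The part of [derive_identity] skew in [W] and [Z]: since [hv_curvature a X Z] is itself a
    derivative along [Z], Schwarz's theorem cancels the left sides. *)
Let codazzi (W X Y Z a : V) :
  G X y y = 0 -> G Y y y = 0 -> G Z y y = 0 -> G a y y = 0 -> G W y y = 0 ->
  S4 X Y Z a y * 'D_W mu y - S4 X Y W a y * 'D_Z mu y + 2 * mu y *
   (h Y Z y * Cc W a X y - h Y W y * Cc Z a X y) = 0.
Proof.
move=> Xy Yy Zy ay Wy.
have F1 := derive_identity Xy Yy Zy ay Wy.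
have F2 := derive_identity Xy Yy Wy ay Zy.
have F3 : 'D_W (hv_curvature a X Z) y = 'D_Z (hv_curvature a X W) y.
  exact: (schwarz_rV _ _ (Gasm y0 a X)).
have e1 : Cc W a Z y = Cc Z a W y by rewrite (Cs23 y0 W) (Cs12 y0 W) (Cs23 y0 Z).
have e2 : Cc W Z X y = Cc Z W X y by rewrite (Cs12 y0 W).
rewrite F3 e1 e2 in F1; lra.
Qed.

(** With [Z] orthogonal to [y] and to [W], three cases of [codazzi] are linear in ['D_W mu y],
    [Cc W Z Z y] and [Cc W W W y]. [F1] and [F3] carry the same Cartan term but different multiples
    of ['D_W mu y], namely [3 h Z Z] and [- h Z Z], so that derivative vanishes; [F2] then leaves
    only the cubic term. *)
Let cubic_zero (W : V) : mu y != 0 -> G W y y = 0 -> Cc W W W y = 0.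
Proof.
move=> mu0 Wy; have [->|W0] := eqVneq W 0; first by rewrite (linear1_0 (Cl y0 0 0)).
have [Z [Z0 Zy ZW]] := common_kernel (Gl y0 y) (Gl y0 W).
have hZZ : 0 < h Z Z y by rewrite hperp// Gp.
have hWW : 0 < h W W y by rewrite hperp// Gp.
have hZW : h Z W y = 0 by rewrite hperp.
have hWZ : h W Z y = 0 by rewrite hs.
have F1 := codazzi Zy Zy Zy Zy Wy.
have F2 := codazzi Wy Zy Zy Wy Wy.
have F3 := codazzi Zy Wy Wy Wy Zy.
rewrite /S4 hZW hWZ in F1 F2 F3.
rewrite (Cs12 y0 Z W Z) in F3.
have {}F1 : h Z Z y * (3 * h Z Z y * 'D_W mu y + 2 * mu y * Cc W Z Z y) = 0 by lra.
have {}F2 : h Z Z y * (h W W y * 'D_W mu y + 2 * mu y * Cc W W W y) = 0 by lra.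
have {}F3 : h W W y * (- h Z Z y * 'D_W mu y + 2 * mu y * Cc W Z Z y) = 0 by lra.
move/eqP: F1; rewrite mulf_eq0 gt_eqF//= => /eqP F1.
move/eqP: F2; rewrite mulf_eq0 gt_eqF//= => /eqP F2.
move/eqP: F3; rewrite mulf_eq0 gt_eqF//= => /eqP F3.
have : h Z Z y * 'D_W mu y = 0 by lra.
move/eqP; rewrite mulf_eq0 gt_eqF//= => /eqP d0.
rewrite d0 mulr0 add0r in F2.
have m2 : 2 * mu y != 0 by apply: mulf_neq0 => //; rewrite pnatr_eq0.
by move/eqP: F2; rewrite mulf_eq0 (negbTE m2) => /eqP.
Qed.

(** If [mu y = 0], then [muE] gives the first case. Otherwise [cubic_zero] and the C-reducible form
    give [Cf W = 0] for [W] orthogonal to [y], and the direction of [y] is settled separately. *)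
Lemma fibre_dichotomy_at : (forall a X Y Z, fibreT a X Y Z y = 0) \/ (forall X, Cf X y = 0).
Proof.
have [mu0|mu0] := eqVneq (mu y) 0.
  left=> a X Y Z; rewrite fTrot// fTrot// fTrot// (fibreTE a Y Z X y0).
  by rewrite (nbhs_singleton muE) mu0 mul0r.
right=> X.
have perp0 W : G W y y = 0 -> Cf W y = 0.
  move=> Wy; have [->|W0] := eqVneq W 0; first by rewrite (linear1_0 (Cfl y0)).
  have := cubic_zero mu0 Wy; rewrite Cred// => /eqP.
  rewrite mulf_eq0 (negbTE k0) /= => /eqP E.
  have : h W W y * Cf W y = 0 by lra.
  move/eqP; rewrite mulf_eq0 hperp// gt_eqF ?Gp//=.
  by move/eqP.
have hv : 0 < h v v y by rewrite hperp// Gp.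
(* The Cartan tensor vanishes on [(v, v, y)], where its C-reducible form reduces to
   [k * h v v * Cf y]. *)
have Cfy : Cf y y = 0.
  have := C3 v v y0; rewrite Cred// => /eqP; rewrite mulf_eq0 (negbTE k0) /= => /eqP E.
  have hvy : h v y y = 0 by rewrite hs// hy.
  rewrite hvy (hy v y0) in E.
  have : h v v y * Cf y y = 0 by lra.
  by move/eqP; rewrite mulf_eq0 gt_eqF//= => /eqP.
have EX : X = radial y X *: y + (X - radial y X *: y) by rewrite addrC subrK.
by rewrite EX (Cfl y0) Cfy mulr0 add0r perp0// perp_part.
Qed.

End AtPoint.

Lemma fibre_dichotomy (y : V) : y != 0 ->
  (forall a X Y Z, fibreT a X Y Z y = 0) \/ (forall X, Cf X y = 0).
Proof.
(* The same form is given twice: a single vector orthogonal to [y] is wanted. *)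
move=> y0; have [v [v0 vy _]] := common_kernel (Gl y0 y) (Gl y0 y).
exact: fibre_dichotomy_at y0 v0 vy.
Qed.

End Fibre.

(** * The metric and the Cartan tensor in a chart *)

Section Energy.
Context {R : realType} {n : nat}.
Notation V := 'rV[R]_n.
Notation VV := (V * V)%type.
Variables (Om : set VV) (E : VV -> R).
Hypothesis Oo : open Om.
Hypothesis Es : forall z, Om z -> smooth_at E z.

(** With constant [X] and [Y] the metric is a function on an open set of the whole chart, so base
    derivatives commute with fibre derivatives. *)
Definition vmetric (X Y : V) (z : VV) : R := 2^-1 * 'D_(0, X) ('D_(0, Y) E) z.
Definition vcubic (X Y Z : V) (z : VV) : R := 2^-1 * 'D_(0, X) (vmetric Y Z) z.

Lemma near_open (P : VV -> Prop) z : Om z -> (forall z, Om z -> P z) -> \forall z \near z, P z.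
Proof.
move=> Oz H; have : \forall z \near z, Om z by apply: open_nbhs_nbhs; split.
by apply: filterS => w /H.
Qed.

Lemma smooth_at_Z (f : VV -> R) k z : smooth_at f z -> smooth_at (fun z => k * f z) z.
Proof. by move=> fs l; apply: Ck_at_mul => //; exact: Ck_at_cst. Qed.

Lemma derive_Z (f : VV -> R) k v z : smooth_at f z -> 'D_v (fun z => k * f z) z = k * 'D_v f z.
Proof. by move=> fs; apply: deriveZ; exact/diff_derivable/smooth_at_differentiable. Qed.

Lemma derive_lin (f : VV -> R) a u v z : smooth_at f z ->
  'D_(a *: u + v) f z = a * 'D_u f z + 'D_v f z.
Proof. by move=> fs; rewrite !deriveE ?linearP//; exact: smooth_at_differentiable. Qed.

Lemma smooth_is_derive (f : VV -> R) v z : smooth_at f z -> is_derive z v f ('D_v f z).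
Proof. by move=> fs; apply: derivableP; exact/diff_derivable/smooth_at_differentiable. Qed.

Lemma derive_schwarz (f : VV -> R) u v z : smooth_at f z -> 'D_u ('D_v f) z = 'D_v ('D_u f) z.
Proof. by move=> fs; apply: schwarz; exact: fs. Qed.

Lemma vert_lin a (u v : V) : (0, a *: u + v) = a *: (0, u) + (0, v) :> VV.
Proof.
transitivity (a *: (0 : V) + 0, a *: u + v) => //.
by rewrite scaler0 addr0.
Qed.

Lemma hor_lin a (u v : V) : (a *: u + v, 0) = a *: (u, 0) + (v, 0) :> VV.
Proof.
transitivity (a *: u + v, a *: (0 : V) + 0) => //.
by rewrite scaler0 addr0.
Qed.

Lemma vmetric_smooth X Y z : Om z -> smooth_at (vmetric X Y) z.
Proof. by move=> Oz; apply: smooth_at_Z; do 2!apply: smooth_at_D; exact: Es. Qed.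

Lemma vcubic_smooth X Y Z z : Om z -> smooth_at (vcubic X Y Z) z.
Proof. by move=> Oz; apply: smooth_at_Z; apply: smooth_at_D; exact: vmetric_smooth. Qed.

Lemma vmetric_lin Y z : Om z -> linear1 (fun X => vmetric X Y z).
Proof.
move=> Oz a u v; rewrite /vmetric vert_lin derive_lin; last by apply: smooth_at_D; exact: Es.
by rewrite mulrDr mulrCA.
Qed.

Lemma vmetricC X Y z : Om z -> vmetric X Y z = vmetric Y X z.
Proof. by move=> Oz; exact: (congr1 (GRing.mul 2^-1) (derive_schwarz _ _ (Es Oz))). Qed.

Lemma vcubic_lin Y Z z : Om z -> linear1 (fun X => vcubic X Y Z z).
Proof.
move=> Oz a u v; rewrite /vcubic vert_lin derive_lin; last exact: vmetric_smooth.
by rewrite mulrDr mulrCA.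
Qed.

Lemma vcubicC12 X Y Z z : Om z -> vcubic X Y Z z = vcubic Y X Z z.
Proof.
move=> Oz; have Ez := Es Oz.
have H A B : vcubic A B Z z = 2^-1 * (2^-1 * 'D_(0, A) ('D_(0, B) ('D_(0, Z) E)) z).
  congr (_ * _); apply: (@derive_Z ('D_(0, B) ('D_(0, Z) E))).
  by do 2!apply: smooth_at_D.
apply: (etrans (H X Y)); apply: (etrans _ (esym (H Y X))).
exact: (congr1 (fun t => 2^-1 * (2^-1 * t)) (derive_schwarz _ _ (smooth_at_D _ Ez))).
Qed.

Lemma vcubicC23 X Y Z z : Om z -> vcubic X Y Z z = vcubic X Z Y z.
Proof.
move=> Oz; apply: (congr1 (GRing.mul 2^-1)); apply: near_eq_derive.
apply: (near_open Oz) => w Ow; exact: vmetricC.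
Qed.

Lemma derive_vmetric W X Y z : 'D_(0, W) (vmetric X Y) z = 2 * vcubic W X Y z.
Proof. by rewrite /vcubic mulrA divff ?mul1r// pnatr_eq0. Qed.

Lemma derive_vmetric_hor a W X Y z : Om z ->
  'D_(0, W) ('D_(a, 0) (vmetric X Y)) z = 2 * 'D_(a, 0) (vcubic W X Y) z.
Proof.
move=> Oz; apply: (etrans (derive_schwarz _ _ (vmetric_smooth X Y Oz))).
apply: (etrans _ (derive_Z 2 (a, 0) (vcubic_smooth W X Y Oz))).
apply: (congr1 (fun f => 'D_(a, 0) f z)); apply/funext => w.
exact: derive_vmetric.
Qed.

Lemma derive_vcubicC X Y Z W z : Om z ->
  'D_(0, W) (vcubic X Y Z) z = 'D_(0, X) (vcubic W Y Z) z.
Proof.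
move=> Oz; have H A B : 'D_(0, A) (vcubic B Y Z) z = 2^-1 * 'D_(0, A) ('D_(0, B) (vmetric Y Z)) z.
  apply: (@derive_Z ('D_(0, B) (vmetric Y Z))); apply: smooth_at_D.
  exact: vmetric_smooth.
apply: (etrans (H W X)); apply: (etrans _ (esym (H X W))).
exact: (congr1 (GRing.mul 2^-1) (derive_schwarz _ _ (vmetric_smooth Y Z Oz))).
Qed.

Lemma derive_vmetric_lin v Y z : Om z -> linear1 (fun X => 'D_v (vmetric X Y) z).
Proof.
move=> Oz a X X'; have gs Z := vmetric_smooth Z Y Oz.
have E1 : \forall w \near z, vmetric (a *: X + X') Y w = a * vmetric X Y w + vmetric X' Y w.
  apply: (near_open Oz) => w Ow; exact: vmetric_lin.
apply: (etrans (near_eq_derive v E1)).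
apply: (etrans _ (congr1 (fun t => t + 'D_v (vmetric X' Y) z) (derive_Z a v (gs X)))).
apply: deriveD.
  by have [] := smooth_is_derive v (smooth_at_Z a (gs X)).
by have [] := smooth_is_derive v (gs X').
Qed.

Lemma derive_vmetricC v X Y z : Om z -> 'D_v (vmetric X Y) z = 'D_v (vmetric Y X) z.
Proof.
move=> Oz; apply: near_eq_derive; apply: (near_open Oz) => w Ow; exact: vmetricC.
Qed.

Lemma derive_vcubicC12 v X Y Z z : Om z -> 'D_v (vcubic X Y Z) z = 'D_v (vcubic Y X Z) z.
Proof.
move=> Oz; apply: near_eq_derive; apply: (near_open Oz) => w Ow; exact: vcubicC12.
Qed.

Lemma derive_vcubicC23 v X Y Z z : Om z -> 'D_v (vcubic X Y Z) z = 'D_v (vcubic X Z Y) z.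
Proof.
move=> Oz; apply: near_eq_derive; apply: (near_open Oz) => w Ow; exact: vcubicC23.
Qed.

Lemma is_derive_snd (z v : VV) : is_derive z v (snd : VV -> V) (v.2).
Proof.
have dl (w : VV) : differentiable (@linsnd R V V) w.
  by apply: linear_differentiable; exact: linsnd_continuous.
apply: DeriveDef; first exact/diff_derivable/(dl z).
by rewrite (@deriveE _ _ _ (@linsnd R V V))// diff_lin//; exact: linsnd_continuous.
Qed.

Lemma is_derive_vmetric (s : VV -> V) z v ds Y : Om z -> is_derive z v s ds ->
  is_derive z v (fun w => vmetric (s w) Y w) ('D_v (vmetric (s z) Y) z + vmetric ds Y z).
Proof.
move=> Oz Ds; apply: (is_derive_app (B := fun u w => vmetric u Y w)
  (dB := fun u => 'D_v (vmetric u Y) z)) => //.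
- apply: (near_open Oz) => w Ow; exact: vmetric_lin.
- by move=> u; apply: smooth_is_derive; exact: vmetric_smooth.
Qed.

Lemma is_derive_vcubic (s : VV -> V) z v ds Y Z : Om z -> is_derive z v s ds ->
  is_derive z v (fun w => vcubic (s w) Y Z w) ('D_v (vcubic (s z) Y Z) z + vcubic ds Y Z z).
Proof.
move=> Oz Ds; apply: (is_derive_app (B := fun u w => vcubic u Y Z w)
  (dB := fun u => 'D_v (vcubic u Y Z) z)) => //.
- apply: (near_open Oz) => w Ow; exact: vcubic_lin.
- by move=> u; apply: smooth_is_derive; exact: vcubic_smooth.
Qed.

Hypothesis Eh : forall z t, 0 < t -> E (z.1, t *: z.2) = t ^+ 2 * E z.

Lemma euler_energy z : Om z -> 'D_(0, z.2) E z = 2 * E z.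
Proof.
move=> Oz; have df := smooth_at_differentiable (Es Oz).
have := @is_derive_line R VV E z (0, z.2) 0.
rewrite scale0r addr0 => /(_ df) D1.
have nE : \forall t \near (0 : R), (1 + t) ^+ 2 * E z = E (z + t *: (0, z.2)).
  near=> t; have t1 : 0 < 1 + t.
    rewrite -ltrBlDl sub0r; near: t; apply: lt_nbhsr; lra.
  rewrite -Eh//; congr E; case: z {Oz df D1} => x y /=.
  transitivity (x + t *: (0 : V), y + t *: y); last by [].
  by rewrite scaler0 addr0 scalerDl scale1r.
have D2 : is_derive (0 : R) 1 (fun t : R => (1 + t) ^+ 2 * E z) (2 * E z).
  have d1 : is_derive (0 : R) 1 (fun t : R => (1 + t)) 1.
    have := is_deriveD (is_derive_cst (1 : R) (0 : R) (1 : R)) (is_derive_id (0 : R) 1).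
    by rewrite add0r.
  have := is_deriveM (is_deriveM d1 d1) (is_derive_cst (E z) (0 : R) (1 : R)).
  apply: is_derive_val; rewrite /cst /GRing.scale /= !fctE; ring.
apply: is_derive_uniq D1 _; apply: near_eq_is_derive D2.
exact: nE.
Unshelve. all: by end_near. Qed.

(* Euler's relation for [E], differentiated along the fibre. *)
Lemma vmetric_eta Y z : Om z -> 2 * vmetric (z.2) Y z = 'D_(0, Y) E z.
Proof.
move=> Oz.
have vl w : Om w -> linear1 (fun u : V => 'D_(0, u) E w).
  by move=> Ow a u v; rewrite vert_lin derive_lin//; exact: Es.
have D1 : is_derive z (0, Y) (fun w : VV => 'D_(0, w.2) E w)
    ('D_(0, Y) ('D_(0, z.2) E) z + 'D_(0, Y) E z).
  apply: (is_derive_app (s := snd) (B := fun u w => 'D_(0, u) E w)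
    (dB := fun u => 'D_(0, Y) ('D_(0, u) E) z)).
  - apply: (near_open Oz) => w Ow; exact: vl.
  - by move=> u; apply: smooth_is_derive; apply: smooth_at_D; exact: Es.
  - exact: (is_derive_snd z (0, Y)).
have D2 : is_derive z (0, Y) (fun w : VV => 'D_(0, w.2) E w) (2 * 'D_(0, Y) E z).
  have D3 := smooth_is_derive (0, Y) (smooth_at_Z 2 (Es Oz)).
  rewrite derive_Z in D3; last exact: Es.
  apply: near_eq_is_derive D3.
  apply: (near_open Oz) => w Ow; exact: esym (euler_energy Ow).
have := is_derive_uniq D1 D2.
rewrite vmetricC// /vmetric mulrA divff ?mul1r ?pnatr_eq0//; lra.
Qed.

Lemma vmetric_eta2 z : Om z -> vmetric (z.2) (z.2) z = E z.
Proof. by move=> Oz; have := vmetric_eta (z.2) Oz; rewrite euler_energy//; lra. Qed.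

(** Differentiating [g(y, Y) = 1/2 D_Y E] along [X] gives [g(X, Y)] from the moving argument and
    again [g(X, Y)] from the right side, leaving no room for the Cartan term. *)
Lemma vcubic_eta X Y z : Om z -> vcubic (z.2) X Y z = 0.
Proof.
move=> Oz; have D1 := is_derive_vmetric Y Oz (is_derive_snd z (0, X)).
have D2 := smooth_is_derive (0, X) (smooth_at_Z 2^-1 (smooth_at_D (0, Y) (Es Oz))).
have D3 : is_derive z (0, X) (fun w : VV => vmetric (w.2) Y w) (vmetric X Y z).
  rewrite derive_Z in D2; last by apply: smooth_at_D; exact: Es.
  apply: near_eq_is_derive D2; apply: (near_open Oz) => w Ow.
  by rewrite -vmetric_eta// mulrA mulVf ?mul1r// pnatr_eq0.
have := is_derive_uniq D1 D3; rewrite derive_vmetric vcubicC12//; lra.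
Qed.

Lemma derive_vcubic_eta v X Y z : Om z ->
  'D_v (vcubic (z.2) X Y) z = - vcubic (v.2) X Y z.
Proof.
move=> Oz; have D1 := is_derive_vcubic X Y Oz (is_derive_snd z v).
have D2 : is_derive z v (fun w : VV => vcubic (w.2) X Y w) 0.
  have := @is_derive_cst R VV R 0 z v; apply: near_eq_is_derive.
  apply: (near_open Oz) => w Ow; exact: esym (vcubic_eta X Y Ow).
have := is_derive_uniq D1 D2; lra.
Qed.

End Energy.

(** * The Finsler metric under change of chart *)

Section ChartMetric.
Context {R : realType} {n : nat} (M : manifold R n) (L : TM M -> R).
Hypothesis HL : finsler L.
Notation C := (charts M).
Notation T := (tm_charts M).
Notation center u := (Defs.coord T u u).
Notation coord := (Defs.coord C).
Notation proj := (@Defs.proj R n M).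
Notation V := 'rV[R]_n.
Let HM := manifold_atlas M.
Let HT := tm_atlas M.

Definition chart_image (p : M) : set (V * V) :=
  [set z | (coord p @` dom p) z.1 /\ z.2 != 0].

Lemma chart_image_open p : open (chart_image p).
Proof.
have -> : chart_image p = fst @^-1` (coord p @` dom p) `&` snd @^-1` [set v : V | v != 0] by [].
apply: openI.
  apply: open_comp; last exact: image_open.
  by move=> z _; exact: cvg_fst.
apply: open_comp; first by move=> z _; exact: cvg_snd.
rewrite openE => v v0 /=; have H : nbhs v `=>` nbhs v by [].
exact: (@cvgr_neq0 R V V (nbhs v) _ id v H v0).
Qed.

Lemma chart_imageP p z : chart_image p z -> exists w : TM M,
  [/\ slit M w, dom p (proj w), z = Defs.coord T ((p, 0) : TM M) w &
      Defs.cinv T ((p, 0) : TM M) z = w].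
Proof.
case: z => x v [[q Dq /= <-] v0].
pose w : TM M := (q, chart_change C p q q v); have Dc := dom_center q.
have E1 : chart_change C q p q (chart_change C p q q v) = v.
  exact: etrans (chart_change_comp HM v Dq Dc Dq) (chart_change_id HM v Dq).
exists w; split; [ |exact: Dq|exact: (congr1 (pair (coord p q)) (esym E1))| ].
  apply: contra_neq v0 => w0.
  exact: (etrans (esym E1) (etrans (congr1 (chart_change C q p q) w0) (linear0 _))).
by rewrite /= (coordK Dq).
Qed.

Lemma chart_image_coord p (w : TM M) : slit M w -> dom p (proj w) ->
  chart_image p (Defs.coord T ((p, 0) : TM M) w).
Proof.
move=> sw Dw; split; first by exists (proj w).
apply: contra_neq sw => H; have Dc := dom_center (proj w).
have := etrans (chart_change_comp HM (w.2) Dc Dw Dc) (chart_change_id HM (w.2) Dc) => <-.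
exact: (etrans (congr1 (chart_change C p (proj w) (proj w)) H) (linear0 _)).
Qed.

Definition energy (p : M) (z : V * V) : R := L (Defs.cinv T ((p, 0) : TM M) z) ^+ 2.

Lemma energy_smooth p z : chart_image p z -> smooth_at (energy p) z.
Proof.
move=> /chart_imageP[w [sw Dw -> _]].
have : smooth_at ((fun w => L w ^+ 2) \o Defs.cinv T w) (center w).
  by move=> k; apply: Ck_at_mul; exact: (finsler_smooth HL sw).
exact: (@smooth_at_chart _ _ _ _ _ HT (finite_basis_rVrV n) _ (fun w => L w ^+ 2)
  ((p, 0) : TM M) w Dw).
Qed.

Lemma energy_homog p z t : 0 < t -> energy p (z.1, t *: z.2) = t ^+ 2 * energy p z.
Proof.
move=> t0; rewrite /energy -exprMn -(finsler_homogeneous HL)//; congr (L (_, _) ^+ 2).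
by rewrite linearZ.
Qed.

Lemma energy_fibre p q v : dom p q ->
  L ((q, v) : TM M) ^+ 2 = energy p (coord p q, chart_change C q p q v).
Proof.
move=> Dq; rewrite /energy.
by have -> := atlasK HT (Dq : tm_dom ((p, 0) : TM M) ((q, v) : TM M)).
Qed.

(** A chart change is linear along a fibre, so fibre derivatives transform by that linear map alone.
    This is why the metric and the Cartan tensor, defined through the chart of each point, can be
    read in one fixed chart. *)
Lemma derive_fibre (W : normedModType R) (f : V * V -> W) (A : {linear V -> V}) x v X : continuous A ->
  differentiable f (x, A v) ->
  'D_X (fun v => f (x, A v)) v = 'D_(0, A X) f (x, A v).
Proof.
move=> Ac df; have dA : differentiable A v by exact: linear_differentiable.
have dp : differentiable (fun v => (x, A v)) v.
  by apply: differentiable_pair => //; exact: differentiable_cst.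
have dc : differentiable (f \o (fun v => (x, A v))) v by exact: differentiable_comp.
rewrite (deriveE _ df).
apply: (etrans (deriveE X dc)).
apply: (etrans (diff_comp_at X dp erefl df)); congr ('d f _ _).
have dcst : differentiable (cst x : V -> V) v by exact: differentiable_cst.
apply: (etrans (congr1 (fun F => F X) (diff_pair dcst dA))).
exact: (congr2 pair (congr1 (fun F => F X) (diff_cst x v))
  (congr1 (fun F => F X) (diff_lin v Ac))).
Qed.

Lemma chart_change_continuous p p' q : dom p q -> dom p' q ->
  continuous (chart_change C p p' q).
Proof.
move=> Dp Dp'; apply: diff_continuous.
exact: smooth_at_differentiable (atlas_smooth HM Dp Dp').
Qed.

Lemma fibre_near (w : TM M) : slit M w -> \forall v \near (w.2), slit M ((proj w, v) : TM M).
Proof.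
move=> sw; have H : nbhs (w.2) `=>` nbhs (w.2) by [].
exact: (@cvgr_neq0 R V V (nbhs (w.2)) _ id (w.2) H sw).
Qed.

Lemma metric_chart p (w : TM M) X Y : slit M w -> dom p (proj w) ->
  metric L w X Y = vmetric (energy p) (chart_change C (proj w) p (proj w) X)
    (chart_change C (proj w) p (proj w) Y) (Defs.coord T ((p, 0) : TM M) w).
Proof.
move=> sw Dw; apply: (congr1 (GRing.mul 2^-1)).
have Dc := dom_center (proj w); have Ac := chart_change_continuous Dc Dw.
set A := chart_change C (proj w) p (proj w) in Ac *.
have E1 : \forall v \near (w.2), 'D_Y (fun v' => L ((proj w, v') : TM M) ^+ 2) v =
    'D_(0, A Y) (energy p) (coord p (proj w), A v).
  apply: filterS (fibre_near sw) => v sv.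
  have -> : (fun v' => L ((proj w, v') : TM M) ^+ 2) =
      (fun v' => energy p (coord p (proj w), A v')).
    by apply/funext => v'; exact: energy_fibre.
  apply: derive_fibre => //; apply: smooth_at_differentiable; apply: energy_smooth.
  exact: (chart_image_coord sv Dw).
apply: (etrans (near_eq_derive X E1)).
apply: (@derive_fibre _ ('D_(0, A Y) (energy p)) A _ _ _ Ac).
apply: smooth_at_differentiable; apply: smooth_at_D; apply: energy_smooth.
exact: (chart_image_coord sw Dw).
Qed.

Lemma metric_center (w : TM M) X Y : slit M w ->
  metric L w X Y = vmetric (energy (proj w)) X Y (center w).
Proof.
move=> sw; have Dc := dom_center (proj w).
by rewrite (metric_chart _ _ sw Dc) !(chart_change_id HM).
Qed.

Lemma vcubic_chart p (w : TM M) X Y Z : slit M w -> dom p (proj w) ->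
  vcubic (energy (proj w)) X Y Z (center w) =
  vcubic (energy p) (chart_change C (proj w) p (proj w) X)
    (chart_change C (proj w) p (proj w) Y) (chart_change C (proj w) p (proj w) Z)
    (Defs.coord T ((p, 0) : TM M) w).
Proof.
move=> sw Dw; apply: (congr1 (GRing.mul 2^-1)).
have Dc := dom_center (proj w); have Ac := chart_change_continuous Dc Dw.
set A := chart_change C (proj w) p (proj w) in Ac *.
have E1 : \forall v \near (w.2),
    vmetric (energy (proj w)) Y Z (coord (proj w) (proj w), v) =
    vmetric (energy p) (A Y) (A Z) (coord p (proj w), A v).
  apply: filterS (fibre_near sw) => v sv.
  have := etrans (esym (metric_center Y Z sv)) (metric_chart Y Z sv Dw).
  by rewrite tm_coord_self.
have ic : chart_image (proj w) (coord (proj w) (proj w), w.2).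
  by rewrite -tm_coord_self; exact: (chart_image_coord sw Dc).
have idc : continuous (idfun : {linear V -> V}) by move=> x.
have D1 := @derive_fibre _ (vmetric (energy (proj w)) Y Z) idfun (coord (proj w) (proj w)) (w.2) X idc.
rewrite tm_coord_self; apply: (etrans (esym (D1 _))).
  exact/smooth_at_differentiable/(vmetric_smooth (@energy_smooth (proj w))).
apply: (etrans (near_eq_derive X E1)).
apply: (@derive_fibre _ (vmetric (energy p) (A Y) (A Z)) A _ _ _ Ac).
apply/smooth_at_differentiable/(vmetric_smooth (@energy_smooth p)).
exact: (chart_image_coord sw Dw).
Qed.

End ChartMetric.

(** * The Cartan connection *)

Section TangentMaps.
Context {R : realType} {n : nat} (M : manifold R n).
Notation C := (charts M).
Notation T := (tm_charts M).
Notation center u := (Defs.coord T u u).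
Notation coord := (Defs.coord C).
Notation cinv := (cinv C).
Notation proj := (@Defs.proj R n M).
Notation V := 'rV[R]_n.
Let HM := manifold_atlas M.
Let HT := tm_atlas M.

Lemma rhoE (u : TM M) z : Defs.rho u z = z.1.
Proof.
have Dc := dom_center (proj u).
have fstd : differentiable (@linfst R V V) (center u).
  by apply: linear_differentiable; exact: linfst_continuous.
have E : \forall z \near center u,
    @linfst R V V z = (coord (proj u) \o proj \o Defs.cinv T u) z.
  by apply: filterS (near_base (atlas_near HM Dc Dc)) => x [_ [_]].
apply: (etrans (congr1 (fun F => F z) (near_eq_diffE E fstd))).
exact: (congr1 (fun F => F z) (diff_lin _ (@linfst_continuous R V V))).
Qed.

Lemma gamE (u : TM M) v : gam u v = (0, v).
Proof.
have Dc := dom_center (proj u).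
have Ef : (fun v : V => Defs.coord T u ((proj u, v) : TM M)) =
    (fun v => (coord (proj u) (proj u), v)).
  by apply/funext => v'; exact: (congr1 (pair _) (chart_change_id HM v' Dc)).
apply: (etrans (congr1 (fun f : V -> V * V => 'd f (u.2) v) Ef)).
have dcst : differentiable (cst (coord (proj u) (proj u)) : V -> V) (u.2).
  exact: differentiable_cst.
have [did vid] := is_diff_id (u.2).
apply: (etrans (congr1 (fun F => F v) (diff_pair dcst did))).
exact: (congr2 pair (congr1 (fun F => F v) (diff_cst (coord (proj u) (proj u)) (u.2)))
  (congr1 (fun F => F v) vid)).
Qed.

Section Change.
Variables u w : TM M.
Hypothesis Dw : tm_dom u w.
Let tau := coord (proj u) \o cinv (proj w).
Let Dc := dom_center (proj w).

Let G_smooth : smooth_at (Defs.coord T u \o Defs.cinv T w) (center w).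
Proof. exact: (atlas_smooth HT (atlas_center HT w) Dw). Qed.

Let tau_smooth : smooth_at tau (coord (proj w) (proj w)).
Proof. exact: (atlas_smooth HM Dc Dw). Qed.

Let tcoord_derive z : tcoord T u w z =
  'D_z (Defs.coord T u \o Defs.cinv T w) (center w).
Proof. by rewrite deriveE//; exact: smooth_at_differentiable. Qed.

Lemma tcoord_fst z : (tcoord T u w z).1 = chart_change C (proj w) (proj u) (proj w) z.1.
Proof.
have dG := smooth_at_differentiable G_smooth.
have dt := smooth_at_differentiable tau_smooth.
have fstd : differentiable (@linfst R V V) (center w).
  by apply: linear_differentiable; exact: linfst_continuous.
rewrite tcoord_derive.
apply: (etrans (esym (derive_linear_comp z (@linfst_continuous R V V) dG))).
have E : \forall x \near center w,
   (@linfst R V V \o (Defs.coord T u \o Defs.cinv T w)) x = (tau \o @linfst R V V) x.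
  apply: filterS (tm_transE (atlas_center HT w) Dw) => x H; exact: (congr1 fst H).
apply: (etrans (near_eq_derive z E)).
have dc : differentiable (tau \o @linfst R V V) (center w).
  exact: differentiable_comp.
apply: (etrans (deriveE z dc)); apply: (etrans (diff_comp_at z fstd erefl dt)).
congr ('d tau _ _).
exact: (congr1 (fun F => F z) (diff_lin _ (@linfst_continuous R V V))).
Qed.

(** The differential of the tangent transition is block triangular with twice the same diagonal
    block. Restricting to the fibre isolates the vertical block and avoids the second derivatives of
    [tau]. *)
Lemma tcoord_vert b :
  tcoord T u w (0, b) = (0, chart_change C (proj w) (proj u) (proj w) b).
Proof.
have dG := smooth_at_differentiable G_smooth.
have E1 := tcoord_fst (0, b); rewrite linear0 in E1.
suff E2 : (tcoord T u w (0, b)).2 = chart_change C (proj w) (proj u) (proj w) b.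
  by rewrite [LHS]surjective_pairing E1 E2.
rewrite tcoord_derive.
apply: (etrans (esym (derive_linear_comp (0, b) (@linsnd_continuous R V V) dG))).
pose F (z : V * V) : V := 'd tau (z.1) (z.2).
have E : \forall x \near center w,
   (@linsnd R V V \o (Defs.coord T u \o Defs.cinv T w)) x = F x.
  apply: filterS (tm_transE (atlas_center HT w) Dw) => x H; exact: (congr1 snd H).
apply: (etrans (near_eq_derive (0, b) E)).
have Fs : smooth_at F (center w).
  apply: smooth_at_dapp; first exact: finite_basis_rV.
  - exact: tau_smooth.
  - by move=> k; apply: (@Ck_at_linear _ _ _ _ (@linfst _ _ _)); exact: linfst_continuous.
  - by move=> k; apply: (@Ck_at_linear _ _ _ _ (@linsnd _ _ _)); exact: linsnd_continuous.
have dF := smooth_at_differentiable Fs.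
rewrite tm_coord_self in dF *.
have idc : continuous (idfun : {linear V -> V}) by move=> x.
apply: (etrans (esym (derive_fibre (A := idfun) b idc dF))).
have tc := diff_continuous (smooth_at_differentiable tau_smooth).
have td : differentiable ('d tau (coord (proj w) (proj w))) (w.2).
  exact: linear_differentiable.
apply: (etrans (deriveE b td)).
exact: (congr1 (fun F => F b) (diff_lin _ tc)).
Qed.

End Change.

Lemma tcoordK (u w : TM M) z : tm_dom u w ->
  chart_change T u w w (tcoord T u w z) = z.
Proof.
move=> Dw; have Dc := atlas_center HT w.
exact: etrans (chart_change_comp HT z Dc Dw Dc) (chart_change_id HT z Dc).
Qed.

Lemma smooth_fst (U : normedModType R) (f : U -> V * V) x : smooth_at f x -> smooth_at (fun y => (f y).1) x.
Proof.
by move=> fs k; exact: (@Ck_at_linear_comp R U _ _ k (@linfst R V V) f x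
  (@linfst_continuous R V V) (fs k)).
Qed.

Lemma near_dom (u : TM M) : \forall z \near center u,
  [/\ tm_dom u (Defs.cinv T u z), z = Defs.coord T u (Defs.cinv T u z) &
      proj (Defs.cinv T u z) = cinv (proj u) z.1].
Proof.
have Dc := atlas_center HT u.
by apply: filterS (atlas_near HT Dc Dc) => z [D1 [_ E]]; split => //; rewrite E.
Qed.

Lemma gam_smooth (X : TM M -> V) : smooth_sec X ->
  smooth_vf T (slit M) (fun w => gam w (X w)).
Proof.
move=> Xs u su.
have : smooth_at (fun z => (0 : V, sec_in X u z)) (center u).
  by move=> k; apply: Ck_at_pair; [exact: Ck_at_cst|exact: Xs].
apply: smooth_at_near; apply: filterS (near_dom u) => z [Dw Ez _].
by rewrite /vf_in gamE tcoord_vert.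
Qed.

Lemma bracket_fst (X Y : TM M -> V * V) u :
  smooth_vf T (slit M) X -> smooth_vf T (slit M) Y -> slit M u ->
  (lie_bracket T X Y u).1 =
  'd (fun z => (vf_in T Y u z).1) (center u) (X u) -
  'd (fun z => (vf_in T X u z).1) (center u) (Y u).
Proof.
move=> Xs Ys su.
have key (Z : TM M -> V * V) v : smooth_vf T (slit M) Z ->
    ('d (vf_in T Z u) (center u) v).1 =
    'd (fun z => (vf_in T Z u z).1) (center u) v.
  move=> Zs; have dZ := smooth_at_differentiable (Zs u su).
  have dZ1 := smooth_at_differentiable (smooth_fst (Zs u su)).
  rewrite -(deriveE v dZ) -(deriveE v dZ1).
  exact: esym (derive_linear_comp v (@linfst_continuous R V V) dZ).
rewrite /lie_bracket; apply: (etrans _ (congr2 (fun a b => a - b) (key Y (X u) Ys) (key X (Y u) Xs))).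
by [].
Qed.

End TangentMaps.

(** * Connection coefficients and horizontal lifts *)

Section Christoffel.
Context {R : realType} {n : nat} (M : manifold R n).
Variable nabla : connection_op M.
Hypothesis HN : linear_connection nabla.
Hypothesis Hreg : regular nabla.
Notation T := (tm_charts M).
Notation center u := (Defs.coord T u u).
Notation proj := (@Defs.proj R n M).
Notation V := 'rV[R]_n.

Definition christoffel (u : TM M) (z : V * V) (X : V) : V :=
  \sum_i X 0 i *: nabla u z (frame (proj u) (delta_mx 0 i)).

Lemma christoffel_linear u z a X Y :
  christoffel u z (a *: X + Y) = a *: christoffel u z X + christoffel u z Y.
Proof.
rewrite /christoffel scaler_sumr -big_split; apply: eq_bigr => i _ /=.
by rewrite !mxE scalerDl scalerA.
Qed.

Lemma christoffel_dir u a z1 z2 X : slit M u ->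
  christoffel u (a *: z1 + z2) X = a *: christoffel u z1 X + christoffel u z2 X.
Proof.
move=> su; rewrite /christoffel scaler_sumr -big_split; apply: eq_bigr => i _ /=.
rewrite (nabla_linear HN su (@frame_smooth _ _ _ _ _)) scalerDr !scalerA.
by rewrite [a * _]mulrC.
Qed.

Lemma nablaE u z S : slit M u -> smooth_sec S ->
  nabla u z S = christoffel u z (S u) + 'd (sec_in S u) (center u) z.
Proof. exact: nabla_frame. Qed.

Lemma nabla_frame_const u z X : slit M u ->
  nabla u z (frame (proj u) X) = christoffel u z X.
Proof.
move=> su; rewrite (nablaE z su (@frame_smooth _ _ _ _ _)) frame_at.
have dcst : differentiable (cst X : V * V -> V) (center u).
  exact: differentiable_cst.
have E : \forall z \near center u, cst X z = sec_in (frame (proj u) X) u z.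
  by apply: filterS (sec_in_frame X (erefl (proj u))) => x ->.
by rewrite (near_eq_diffE E dcst) diff_cst addr0.
Qed.

Lemma nabla_eta u z : slit M u -> nabla u z (@eta R n M) = christoffel u z (u.2) + z.2.
Proof.
move=> su; rewrite (nablaE z su (@eta_smooth _ _ M)); congr (_ + _).
have sndd : differentiable (@linsnd R V V) (center u).
  by apply: linear_differentiable; exact: linsnd_continuous.
have E : \forall z \near center u, @linsnd R V V z = sec_in (@eta R n M) u z.
  by apply: filterS (sec_in_eta u) => x ->.
apply: (etrans (congr1 (fun F => F z) (near_eq_diffE E sndd))).
exact: (congr1 (fun F => F z) (diff_lin _ (@linsnd_continuous R V V))).
Qed.

(** The horizontal part of [(a, 0)] in the regular splitting keeps the first component, since
    vertical vectors have first component 0. It shows that the [xget] in [beta] never falls back on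
    its default on [slit M]. *)
Lemma horizontal_lift u a : slit M u -> exists b, nabla u (a, b) (@eta R n M) = 0.
Proof.
move=> su; have [/(_ (a, 0))[v [h [Hv Hh E]]] _] := Hreg su.
exists h.2; rewrite [X in nabla u X](_ : _ = h)//.
have : v.1 = 0 by move: Hv; rewrite /vertical /= rhoE.
move: (congr1 fst E) => /= -> ->; rewrite add0r; by case: h {Hh E}.
Qed.

Lemma beta_spec u a : slit M u ->
  nabla u (beta nabla u a) (@eta R n M) = 0 /\ (beta nabla u a).1 = a.
Proof.
move=> su; have [b Hb] := horizontal_lift a su.
have : [set z | horizontal nabla u z /\ rho u z = a] (beta nabla u a).
  by rewrite /beta; apply: (@xgetPex _ _ [set z | horizontal nabla u z /\ rho u z = a]);
     exists (a, b); split=> //=; rewrite rhoE.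
by move=> [H1 H2]; split; [exact: H1|exact: etrans (esym (rhoE _ _)) H2].
Qed.

Lemma horizontal_vert0 u b : slit M u -> nabla u (0, b) (@eta R n M) = 0 -> b = 0.
Proof.
move=> su Hb; have [_ /(_ (0, b))] := Hreg su.
move=> H; have E : (0, b) = 0 :> V * V.
  by apply: H; [exact: rhoE|exact: Hb].
exact: (congr1 snd E).
Qed.

Lemma beta_snd u a : slit M u -> (beta nabla u a).2 = - christoffel u (beta nabla u a) (u.2).
Proof.
move=> su; have [] := beta_spec a su; rewrite nabla_eta// => /eqP.
by rewrite addrC addr_eq0 => /eqP.
Qed.

Lemma vframe_tcoord (u : TM M) v : \forall z \near center u,
  vframe (proj u) v (Defs.cinv T u z) = chart_change T u (Defs.cinv T u z) (Defs.cinv T u z) v.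
Proof.
apply: filterS (filterI (near_dom u) (vf_in_vframe v (erefl (proj u)))) => z [[Dw _ _] H].
exact: etrans (esym (tcoordK _ Dw)) (congr1 _ H).
Qed.

Lemma rV_pair_sum (z : V * V) :
  z = \sum_i z.1 0 i *: (delta_mx 0 i, 0 : V) + \sum_i z.2 0 i *: (0 : V, delta_mx 0 i).
Proof.
have E1 (u : 'I_n -> V) : \sum_i (u i, 0 : V) = (\sum_i u i, 0).
  elim/big_rec2 : _ => // i y1 _ _ ->.
  by transitivity (u i + y1, (0 : V) + 0) => //; rewrite addr0.
have E2 (u : 'I_n -> V) : \sum_i (0 : V, u i) = (0, \sum_i u i).
  elim/big_rec2 : _ => // i y1 _ _ ->.
  by transitivity ((0 : V) + 0, u i + y1) => //; rewrite addr0.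
rewrite (eq_bigr (fun i => (z.1 0 i *: delta_mx 0 i, 0 : V))); last first.
  by move=> i _; transitivity (z.1 0 i *: delta_mx 0 i : V, z.1 0 i *: (0 : V)) => //; rewrite scaler0.
rewrite [X in _ + X](eq_bigr (fun i => (0 : V, z.2 0 i *: delta_mx 0 i))); last first.
  by move=> i _; transitivity (z.2 0 i *: (0 : V), z.2 0 i *: delta_mx 0 i : V) => //; rewrite scaler0.
rewrite E1 E2 -!row_sum_delta; case: z => x y /=.
by transitivity (x + 0, 0 + y) => //; rewrite addr0 add0r.
Qed.

Lemma nabla_dir_sum u S z (f : 'I_n -> V * V) (c : 'I_n -> R) : slit M u -> smooth_sec S ->
  nabla u (\sum_i c i *: f i + z) S = \sum_i c i *: nabla u (f i) S + nabla u z S.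
Proof.
move=> su Ss; elim: (index_enum _) => [|i r IH]; first by rewrite !big_nil !add0r.
by rewrite !big_cons -!addrA (nabla_linear HN su Ss) IH.
Qed.

Lemma nabla_dir0 u S : slit M u -> smooth_sec S -> nabla u 0 S = 0.
Proof.
move=> su Ss; have := nabla_linear HN su Ss 1 0 0; rewrite scale1r addr0 scale1r => /eqP.
by rewrite -subr_eq0 opprD addrA subrr add0r oppr_eq0 => /eqP.
Qed.

Lemma nabla_components u S z : slit M u -> smooth_sec S ->
  nabla u z S = \sum_i z.1 0 i *: nabla u (delta_mx 0 i, 0) S
              + \sum_i z.2 0 i *: nabla u (0, delta_mx 0 i) S.
Proof.
move=> su Ss; rewrite [in LHS](rV_pair_sum z) nabla_dir_sum//; congr (_ + _).
by rewrite -[X in nabla u X]addr0 nabla_dir_sum// nabla_dir0// addr0.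
Qed.

End Christoffel.

Lemma unitmx_inj (F : fieldType) n (A : 'M[F]_n) :
  (forall b : 'rV_n, b *m A = 0 -> b = 0) -> A \in unitmx.
Proof.
move=> H; rewrite -row_free_unit -kermx_eq0; apply/eqP/row_matrixP => i.
by rewrite row0; apply: H; rewrite -row_mul mulmx_ker row0.
Qed.

Lemma torsion_cancel (U : zmodType) (a b c d : U) : a + c - (b + d) - (c - d) = a - b.
Proof. by rewrite opprD opprB !addrA subrK addrAC addrK. Qed.

(** * Smoothness of horizontal lifts, and the torsion in a chart *)

Section Torsion.
Context {R : realType} {n : nat} (M : manifold R n).
Variable nabla : connection_op M.
Hypothesis HN : linear_connection nabla.
Hypothesis Hreg : regular nabla.
Notation C := (charts M).
Notation T := (tm_charts M).
Notation center u := (Defs.coord T u u).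
Notation proj := (@Defs.proj R n M).
Notation V := 'rV[R]_n.

(** In the chart of [u] the first component of the lift is [Y]. The condition that [eta] be parallel
    is a linear system for the second component, with smooth coefficients [nabla] of [eta] along the
    frame fields, so Cramer's rule applies. *)
Lemma beta_smooth (Y : TM M -> V) : smooth_sec Y ->
  smooth_vf T (slit M) (fun w => beta nabla w (Y w)).
Proof.
move=> Ys u su; pose p := proj u.
pose eh j : V * V := (delta_mx 0 j, 0); pose ev j : V * V := (0, delta_mx 0 j).
pose K v w := nabla w (vframe p v w) (@eta R n M).
have Ks v : smooth_sec (K v).
  by apply: (nabla_smooth HN) (@eta_smooth _ _ M); exact: vframe_smooth.
pose X w := beta nabla w (Y w).
pose A z : 'M[R]_n := \matrix_(j, k) sec_in (K (ev j)) u z 0 k.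
pose b z : V := - \sum_j sec_in Y u z 0 j *: sec_in (K (eh j)) u z.
have As k : Ck_at k A (center u).
  apply: Ck_at_mx => i j; rewrite (_ : (fun z => _) = fun z => sec_in (K (ev i)) u z 0 j).
    by apply: Ck_at_coord; exact: Ks.
  by apply/funext => z; rewrite mxE.
have bs k : Ck_at k b (center u).
  apply: Ck_at_opp; apply: Ck_at_sum => j _; apply: Ck_at_scale; last exact: Ks.
  by apply: Ck_at_coord; exact: Ys.
have rowA z j : row j (A z) = sec_in (K (ev j)) u z.
  by apply/rowP => k; rewrite !mxE.
(* The rows of [A] at the centre are [nabla] of [eta] along the vertical basis; a kernel vector
   would be both vertical and horizontal, which regularity forbids. *)
have Au : A (center u) \in unitmx.
  apply: unitmx_inj => d; rewrite mulmx_sum_row => Hd.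
  apply: (horizontal_vert0 Hreg su).
  rewrite (nabla_components HN (0, d) su (@eta_smooth _ _ M)) big1; last first.
    by move=> i _; rewrite mxE scale0r.
  rewrite add0r -[RHS]Hd; apply: eq_bigr => j _; congr (_ *: _).
  by rewrite rowA sec_in_center /K /p vframe_at.
have fst_eq : \forall z \near center u, sec_in Y u z = (vf_in T X u z).1.
  apply: filterS (filterI (near_dom u) (near_slit su)) => z [[Dw _ _] sw].
  rewrite /vf_in (tcoord_fst Dw) /X.
  by rewrite (beta_spec Hreg (Y (Defs.cinv T u z)) sw).2.
pose P j z := vframe p (eh j) (Defs.cinv T u z) =
    chart_change T u (Defs.cinv T u z) (Defs.cinv T u z) (eh j) /\
  vframe p (ev j) (Defs.cinv T u z) =
    chart_change T u (Defs.cinv T u z) (Defs.cinv T u z) (ev j).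
have vfj j : \forall z \near center u, P j z.
  exact: (filterI (vframe_tcoord u (eh j)) (vframe_tcoord u (ev j))).
have vfr : \forall z \near center u, forall j, P j z.
  exact: (@filter_forall _ 'I_n P (nbhs (center u)) _ vfj).
have solve : \forall z \near center u, (vf_in T X u z).2 *m A z = b z.
  apply: filterS (filterI (filterI (near_dom u) (near_slit su)) (filterI fst_eq vfr)).
  move=> z [[[Dw _ _] sw] [F1 vf]]; set w := Defs.cinv T u z in Dw sw vf.
  pose zeta := tcoord T u w (X w).
  have Xw : X w = \sum_j zeta.1 0 j *: vframe p (eh j) w + \sum_j zeta.2 0 j *: vframe p (ev j) w.
    apply: (etrans (esym (tcoordK (X w) Dw))).
    rewrite -/zeta [in LHS](rV_pair_sum zeta).
    rewrite (linearD (chart_change T u w w)) !(linear_sum (chart_change T u w w)).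
    congr (_ + _); apply: eq_bigr => j _; rewrite (linearZ_LR (chart_change T u w w)).
      exact: (congr1 (GRing.scale _) (esym (vf j).1)).
    exact: (congr1 (GRing.scale _) (esym (vf j).2)).
  have := (beta_spec Hreg (Y w) sw).1; rewrite -/(X w) Xw.
  rewrite (nabla_dir_sum HN _ _ _ sw (@eta_smooth _ _ M)).
  rewrite -[X in nabla w X]addr0 (nabla_dir_sum HN _ _ _ sw (@eta_smooth _ _ M)).
  rewrite (nabla_dir0 HN sw (@eta_smooth _ _ M)) addr0.
  move/(congr1 (chart_change C (proj w) (proj u) (proj w))).
  rewrite linear0 linearD !linear_sum => E.
  rewrite mulmx_sum_row /b F1; apply/eqP; rewrite -addr_eq0 addrC; apply/eqP.
  rewrite -[RHS]E; congr (_ + _); apply: eq_bigr => j _; rewrite ?rowA linearZ //.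
move=> k.
have s2 : Ck_at k (fun z => (vf_in T X u z).2) (center u).
  exact: (Ck_at_solve Au (As k) (bs k) solve).
have : Ck_at k (fun z => ((vf_in T X u z).1, (vf_in T X u z).2)) (center u).
  by apply: Ck_at_pair s2; apply: Ck_at_near fst_eq _; exact: Ys.
by apply: Ck_at_near; near=> z; case: (vf_in _ _ _ _).
Unshelve. all: by end_near. Qed.

Lemma beta_sec_fst (Y : TM M -> V) u : slit M u ->
  \forall z \near center u,
    (vf_in T (fun w => beta nabla w (Y w)) u z).1 = sec_in Y u z.
Proof.
move=> su; apply: filterS (filterI (near_dom u) (near_slit su)) => z [[Dw _ _] sw].
rewrite /vf_in (tcoord_fst Dw).
by rewrite (beta_spec Hreg (Y (Defs.cinv T u z)) sw).2.
Qed.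

Lemma gam_sec_fst (X : TM M -> V) u :
  \forall z \near center u, (vf_in T (fun w => gam w (X w)) u z).1 = 0.
Proof.
by apply: filterS (near_dom u) => z [Dw _ _]; rewrite /vf_in gamE tcoord_vert.
Qed.

Lemma beta_derive_fst (Y : TM M -> V) u z : slit M u -> smooth_sec Y ->
  'd (fun z => (vf_in T (fun w => beta nabla w (Y w)) u z).1) (center u) z =
  'd (sec_in Y u) (center u) z.
Proof.
move=> su Ys; have dY := smooth_at_differentiable (Ys u su).
have E : \forall z \near center u, sec_in Y u z =
    (vf_in T (fun w => beta nabla w (Y w)) u z).1.
  by apply: filterS (beta_sec_fst Y su) => x ->.
exact: (congr1 (fun F => F z) (near_eq_diffE E dY)).
Qed.

Lemma gam_derive_fst (X : TM M -> V) u z :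
  'd (fun z => (vf_in T (fun w => gam w (X w)) u z).1) (center u) z = 0.
Proof.
have d0 : differentiable (cst 0 : V * V -> V) (center u) by exact: differentiable_cst.
have E : \forall z \near center u, cst 0 z =
    (vf_in T (fun w => gam w (X w)) u z).1.
  by apply: filterS (gam_sec_fst X u) => x ->.
apply: (etrans (congr1 (fun F => F z) (near_eq_diffE E d0))).
by rewrite diff_cst.
Qed.

Lemma nabla_rho_beta u z (Y : TM M -> V) : slit M u -> smooth_sec Y ->
  nabla u z (fun w => rho w (beta nabla w (Y w))) = nabla u z Y.
Proof.
move=> su Ys; apply: esym; apply: (nabla_slit HN z su Ys) => w sw.
by rewrite rhoE (beta_spec Hreg (Y w) sw).2.
Qed.

(** On [slit M], [rho] undoes [beta] and kills [gam]; the first component of the bracket is the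
    derivative of [Y] along the vertical lift of [X], which cancels the one in [nablaE]. *)
Lemma torsionTE (X Y : TM M -> V) u : slit M u -> smooth_sec X -> smooth_sec Y ->
  torsionT nabla X Y u = christoffel nabla u (0, X u) (Y u).
Proof.
move=> su Xs Ys.
have t1 : nabla u (gam u (X u)) (fun w => rho w (beta nabla w (Y w))) =
    christoffel nabla u (0, X u) (Y u) + 'd (sec_in Y u) (center u) (gam u (X u)).
  by rewrite nabla_rho_beta// -(gamE u (X u)); exact: nablaE.
have t2 : nabla u (beta nabla u (Y u)) (fun w => rho w (gam w (X w))) = 0.
  rewrite (_ : (fun w => rho w (gam w (X w))) = fun=> 0); first exact: nabla_sec0.
  by apply/funext => w; rewrite rhoE gamE.
have t3 : rho u (lie_bracket T (fun w => gam w (X w)) (fun w => beta nabla w (Y w)) u) =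
    'd (sec_in Y u) (center u) (gam u (X u)).
  apply: (etrans (rhoE _ _)).
  apply: (etrans (bracket_fst (gam_smooth Xs) (beta_smooth Ys) su)).
  apply: (etrans (congr2 (fun a b => a - b) (beta_derive_fst _ su Ys) (gam_derive_fst _ _ _))).
  exact: subr0.
rewrite /torsionT /torsion t1 t2 t3 subr0; exact: addrK.
Qed.

Lemma torsionQE (X Y : TM M -> V) u : slit M u -> smooth_sec X -> smooth_sec Y ->
  torsionQ nabla X Y u = christoffel nabla u (beta nabla u (X u)) (Y u)
    - christoffel nabla u (beta nabla u (Y u)) (X u).
Proof.
move=> su Xs Ys.
have t1 A B (As : smooth_sec A) (Bs : smooth_sec B) :
    nabla u (beta nabla u (A u)) (fun w => rho w (beta nabla w (B w))) =
    christoffel nabla u (beta nabla u (A u)) (B u)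
      + 'd (sec_in B u) (center u) (beta nabla u (A u)).
  by rewrite nabla_rho_beta//; exact: nablaE.
have t3 : rho u (lie_bracket T (fun w => beta nabla w (X w)) (fun w => beta nabla w (Y w)) u) =
    'd (sec_in Y u) (center u) (beta nabla u (X u))
    - 'd (sec_in X u) (center u) (beta nabla u (Y u)).
  apply: (etrans (rhoE _ _)).
  apply: (etrans (bracket_fst (beta_smooth Xs) (beta_smooth Ys) su)).
  exact: (congr2 (fun a b => a - b) (beta_derive_fst _ su Ys) (beta_derive_fst _ su Xs)).
rewrite /torsionQ /torsion (t1 X Y Xs Ys) (t1 Y X Ys Xs) t3.
exact: torsion_cancel.
Qed.

Lemma extensionP (u : TM M) v : smooth_sec (extension u v) /\ extension u v u = v.
Proof.
rewrite /extension.
have : [set S | smooth_sec S /\ S u = v] (frame (proj u) v).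
  by split; [exact: frame_smooth|exact: frame_at].
by move=> H; have := @xgetPex _ (fun=> 0) [set S | smooth_sec S /\ S u = v] (ex_intro _ _ H).
Qed.

Lemma tensorTE u X Y : slit M u -> tensorT nabla u X Y = christoffel nabla u (0, X) Y.
Proof.
move=> su; have [Xs Xu] := extensionP u X; have [Ys Yu] := extensionP u Y.
by rewrite /tensorT torsionTE// Xu Yu.
Qed.

End Torsion.

Lemma subr_eq_add (U : zmodType) (a b c : U) : a - b - c = 0 -> a = b + c.
Proof. by move/eqP; rewrite -addrA -opprD subr_eq0 => /eqP. Qed.

Lemma half_sum (F : realFieldType) (a b c d : F) : 2 * d = a + c -> a = b -> c = b -> a = d.
Proof. by move=> E1 E2 E3; lra. Qed.

Lemma covT_arith (F : realType) (Dvm vds D' D e1 e1' e2 a b w c1 c2 : F) :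
  Dvm + vds = D' + e1 + e2 -> Dvm = a + b -> b = w -> D' = D -> e1' = e1 ->
  a + vds - (c1 + e2) - (c2 + e1') = D - c1 - c2 - w.
Proof. by move=> E1 E2 E3 E4 E5; lra. Qed.

Lemma linear1B2 (R : realType) n (f : 'rV[R]_n -> R) a b d : linear1 f ->
  f (a - b - d) = f a - f b - f d.
Proof.
move=> fl; have fN u : f (- u) = - f u by rewrite -scaleN1r (linear1Z _ _ fl) mulN1r.
by rewrite (linear1D _ _ fl) (linear1D _ _ fl) !fN.
Qed.

(** * Metric compatibility and the Cartan tensor *)

Section Cartan.
Context {R : realType} {n : nat} (M : manifold R n) (L : TM M -> R).
Variable nabla : connection_op M.
Hypothesis HL : finsler L.
Hypothesis HC : cartan_connection L nabla.
Notation C := (charts M).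
Notation T := (tm_charts M).
Notation center u := (Defs.coord T u u).
Notation proj := (@Defs.proj R n M).
Notation V := 'rV[R]_n.
Let HM := manifold_atlas M.
Let HN := cartan_linear HC.
Let Hreg := cartan_regular HC.
Notation chr := (christoffel nabla).
Notation vm p := (vmetric (energy L p)).
Notation vc p := (vcubic (energy L p)).

Let Es p := @energy_smooth R n M L HL p.
Let Oo (p : M) : open (chart_image p). Proof. exact: chart_image_open. Qed.

Lemma chart_image_self (u : TM M) : slit M u -> chart_image (proj u) (center u).
Proof. by move=> su; exact: (chart_image_coord su (dom_center (proj u))). Qed.

Lemma near_chart (u : TM M) : slit M u -> \forall z \near center u,
  [/\ chart_image (proj u) z, slit M (Defs.cinv T u z), tm_dom u (Defs.cinv T u z) &
      z = Defs.coord T u (Defs.cinv T u z)].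
Proof.
move=> su.
have O1 : \forall z \near center u, chart_image (proj u) z.
  by apply: open_nbhs_nbhs; split; [exact: chart_image_open|exact: chart_image_self].
by apply: filterS (filterI O1 (filterI (near_slit su) (near_dom u))) => z [? [? []]].
Qed.

Lemma metric_sec (u : TM M) (X Y : TM M -> V) : slit M u ->
  \forall z \near center u, metric L (Defs.cinv T u z) (X (Defs.cinv T u z))
    (Y (Defs.cinv T u z)) = vm (proj u) (sec_in X u z) (sec_in Y u z) z.
Proof.
move=> su; apply: filterS (near_chart su) => z [_ sw Dw Ez].
apply: (etrans (metric_chart HL _ _ sw Dw)).
exact: (congr1 (vm (proj u) (sec_in X u z) (sec_in Y u z)) (esym Ez)).
Qed.

Lemma cartan_compat u z X Y : slit M u -> 'D_z (vm (proj u) X Y) (center u) =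
  vm (proj u) (chr u z X) Y (center u) + vm (proj u) X (chr u z Y) (center u).
Proof.
move=> su; set p := proj u; have ci := chart_image_self su.
have Xs := frame_smooth p X; have Ys := frame_smooth p Y.
have H := cartan_metric HC su z Xs Ys.
have dv := smooth_at_differentiable (vmetric_smooth (@Es p) X Y ci).
have E : \forall x \near center u, vm p X Y x =
    ((fun w => metric L w (frame p X w) (frame p Y w)) \o Defs.cinv T u) x.
  apply: filterS (filterI (metric_sec (frame p X) (frame p Y) su)
    (filterI (sec_in_frame X (erefl p)) (sec_in_frame Y (erefl p)))) => x [H1 [H2 H3]].
  exact: (esym (etrans H1 (congr2 (fun A B => vm p A B x) H2 H3))).
have D : dfun T (fun w => metric L w (frame p X w) (frame p Y w)) u z =
    'D_z (vm p X Y) (center u).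
  apply: (etrans (congr1 (fun F => F z) (near_eq_diffE E dv))).
  exact: esym (deriveE z dv).
apply: (etrans (esym D)).
have M1 : metric L u (nabla u z (frame p X)) (frame p Y u) = vm p (chr u z X) Y (center u).
  by rewrite (nabla_frame_const HN z X su) frame_at; exact: metric_center.
have M2 : metric L u (frame p X u) (nabla u z (frame p Y)) = vm p X (chr u z Y) (center u).
  by rewrite (nabla_frame_const HN z Y su) frame_at; exact: metric_center.
exact: (etrans (subr_eq_add H) (congr2 +%R M1 M2)).
Qed.

(** Compatibility along the vertical vector [(0, X)] writes [2 vcubic X Y Z] as the sum of
    [g(T(X, Y), Z)] and [g(Y, T(X, Z))]. The symmetry axiom on [T] makes the two terms equal. *)
Lemma formTE u X Y Z : slit M u ->
  formT L nabla u X Y Z = vc (proj u) X Y Z (center u).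
Proof.
move=> su; set p := proj u; have ci := chart_image_self su.
rewrite /formT (tensorTE HN Hreg _ _ su) (metric_center HL _ _ su).
have S := cartan_T HC (frame_smooth p X) (frame_smooth p Y) (frame_smooth p Z) su.
have S1 A B : metric L u (torsionT nabla (frame p X) (frame p A) u) (frame p B u) =
    vm p (chr u (0, X) A) B (center u).
  rewrite (torsionTE HN Hreg su (frame_smooth p X) (frame_smooth p A)) !frame_at.
  exact: metric_center.
have S2 := etrans (esym (S1 Y Z)) (etrans S (S1 Z Y)).
have E := cartan_compat (0, X) Y Z su.
have E1 := derive_vmetric (energy L p) X Y Z (center u).
have E2 := vmetricC (@Es p) Y (chr u (0, X) Z) ci.
have E3 := etrans (esym E1) E.
exact: (half_sum E3 S2 E2).
Qed.

Lemma christoffel_sym u X Y : slit M u ->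
  chr u (beta nabla u X) Y = chr u (beta nabla u Y) X.
Proof.
move=> su; have := cartan_Q HC (frame_smooth (proj u) X) (frame_smooth (proj u) Y) su.
rewrite (torsionQE HN Hreg su (frame_smooth _ X) (frame_smooth _ Y)) !frame_at.
by move/eqP; rewrite subr_eq0 => /eqP.
Qed.

Lemma formT_sec (u : TM M) (X Y : TM M -> V) : slit M u ->
  \forall z \near center u, forall W,
   vm (proj u) (sec_in (fun w => tensorT nabla w (X w) (Y w)) u z) W z =
   vc (proj u) (sec_in X u z) (sec_in Y u z) W z.
Proof.
move=> su; apply: filterS (near_chart su) => z [_ sw Dw Ez] W.
set w := Defs.cinv T u z in sw Dw Ez *.
have Dc := dom_center (proj w).
pose B := chart_change C (proj u) (proj w) (proj w) W.
have AB : chart_change C (proj w) (proj u) (proj w) B = W.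
  exact: etrans (chart_change_comp HM W Dw Dc Dw) (chart_change_id HM W Dw).
have H1 := metric_chart HL (tensorT nabla w (X w) (Y w)) B sw Dw; rewrite AB in H1.
have H2 := vcubic_chart HL (X w) (Y w) B sw Dw; rewrite AB in H2.
have H := etrans (esym H1) (etrans (formTE (X w) (Y w) B sw) H2).
apply: (etrans (congr1 (vm (proj u) _ W) Ez)); apply: (etrans H).
exact: (congr1 (vc (proj u) _ _ W) (esym Ez)).
Qed.

Lemma metric_unitmx (u : TM M) : slit M u ->
  \matrix_(j, k) vm (proj u) (delta_mx 0 j) (delta_mx 0 k) (center u) \in unitmx.
Proof.
move=> su; have ci := chart_image_self su; apply: unitmx_inj => b Hb.
apply/eqP/negPn/negP => /(finsler_posdef HL su).
suff -> : metric L u b b = 0 by rewrite ltxx.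
apply: (etrans (metric_center HL b b su)).
apply: (etrans (linear1_sum b (vmetric_lin (@Es (proj u)) b ci))).
apply: big1 => k _.
have E : vm (proj u) (delta_mx 0 k) b (center u) = 0.
  apply: (etrans (vmetricC (@Es (proj u)) _ _ ci)).
  apply: (etrans (linear1_sum b (vmetric_lin (@Es (proj u)) (delta_mx 0 k) ci))).
  have := congr1 (fun B : V => B 0 k) Hb; rewrite !mxE => E.
  by rewrite -[RHS]E; apply: eq_bigr => j _; rewrite !mxE.
exact: (etrans (congr1 _ E) (mulr0 _)).
Qed.

Lemma vcubic_sec_smooth (u : TM M) (X Y : TM M -> V) W : slit M u ->
  smooth_sec X -> smooth_sec Y ->
  smooth_at (fun z => vc (proj u) (sec_in X u z) (sec_in Y u z) W z) (center u).
Proof.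
move=> su Xs Ys; have ci := chart_image_self su.
have : smooth_at (fun z => \sum_i \sum_j sec_in X u z 0 i * (sec_in Y u z 0 j *
    vc (proj u) (delta_mx 0 j) (delta_mx 0 i) W z)) (center u).
  move=> k; apply: Ck_at_sum => i _; apply: Ck_at_sum => j _; apply: Ck_at_mul.
    by apply: Ck_at_coord; exact: Xs.
  apply: Ck_at_mul; first by apply: Ck_at_coord; exact: Ys.
  exact: (vcubic_smooth (@Es (proj u))).
apply: smooth_at_near; apply: filterS (near_chart su) => z [cz _ _ _].
apply: (etrans _ (esym (linear1_sum _ (vcubic_lin (@Es (proj u)) _ _ cz)))).
apply: eq_bigr => i _; rewrite -mulr_sumr; apply: (congr1 (GRing.mul _)).
apply: (etrans (esym (linear1_sum _ (vcubic_lin (@Es (proj u)) _ _ cz)))).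
exact: (vcubicC12 (@Es (proj u))).
Qed.

(** [tensorT] is defined pointwise through chosen extensions, so smoothness is not visible. By
    [formT_sec] its components solve a linear system whose matrix is the metric and whose right side
    is the Cartan tensor. *)
Lemma tensorT_smooth (X Y : TM M -> V) : smooth_sec X -> smooth_sec Y ->
  smooth_sec (fun w => tensorT nabla w (X w) (Y w)).
Proof.
move=> Xs Ys u su k; have ci := chart_image_self su.
pose A z : 'M[R]_n := \matrix_(i, j) vm (proj u) (delta_mx 0 i) (delta_mx 0 j) z.
pose b z : V := \row_j vc (proj u) (sec_in X u z) (sec_in Y u z) (delta_mx 0 j) z.
apply: (@Ck_at_solve _ _ k n A _ b _ (metric_unitmx su)).
- apply: Ck_at_mx => i j.
  rewrite (_ : (fun z => _) = vm (proj u) (delta_mx 0 i) (delta_mx 0 j)).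
    exact: (vmetric_smooth (@Es (proj u))).
  by apply/funext => z; rewrite mxE.
- apply: Ck_at_rV => j.
  rewrite (_ : (fun z => _) = fun z => vc (proj u) (sec_in X u z) (sec_in Y u z) (delta_mx 0 j) z).
    exact: vcubic_sec_smooth.
  by apply/funext => z; rewrite mxE.
apply: filterS (filterI (near_chart su) (formT_sec X Y su)) => z [[cz _ _ _] H].
apply/rowP => j; rewrite !mxE.
apply: (etrans _ (H (delta_mx 0 j))).
apply: (etrans _ (esym (linear1_sum _ (vmetric_lin (@Es (proj u)) _ cz)))).
by apply: eq_bigr => i _; rewrite mxE.
Qed.

Definition nablaT (u : TM M) (z : V * V) (X Y W : V) : R :=
  'D_z (vc (proj u) X Y W) (center u)
  - vc (proj u) (chr u z X) Y W (center u)
  - vc (proj u) X (chr u z Y) W (center u)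
  - vc (proj u) X Y (chr u z W) (center u).

Let sec_derive (S : TM M -> V) u z : slit M u -> smooth_sec S ->
  is_derive (center u) z (sec_in S u) ('d (sec_in S u) (center u) z).
Proof.
move=> su Ss; have ds := smooth_at_differentiable (Ss u su).
by apply: DeriveDef; [exact: diff_derivable|exact: deriveE].
Qed.

(** Both sides of [formT_sec] are differentiated with moving arguments; the derivatives of the
    sections cancel against those in [nablaE], so [covT] depends only on the values of [X] and [Y]
    at [u]. *)
Lemma covTE u z (X Y : TM M -> V) W : slit M u -> smooth_sec X -> smooth_sec Y ->
  vm (proj u) (covT nabla u z X Y) W (center u) = nablaT u z (X u) (Y u) W.
Proof.
move=> su Xs Ys; set p := proj u; set c := center u.
have ci : chart_image p c by exact: chart_image_self.
pose S w := tensorT nabla w (X w) (Y w).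
have Ss : smooth_sec S by exact: tensorT_smooth.
have vml Y' : linear1 (fun X => vm p X Y' c) := vmetric_lin (@Es p) Y' ci.
have vcl Y' Z' : linear1 (fun X => vc p X Y' Z' c) := vcubic_lin (@Es p) Y' Z' ci.
set dx := 'd (sec_in X u) c z; set dy := 'd (sec_in Y u) c z; set ds := 'd (sec_in S u) c z.
have D1 : is_derive c z (fun w => vm p (sec_in S u w) W w)
    ('D_z (vm p (S u) W) c + vm p ds W c).
  have := is_derive_vmetric (@Oo p) (@Es p) W ci (sec_derive z su Ss).
  by rewrite sec_in_center.
have DY B : is_derive c z (fun w => vc p B (sec_in Y u w) W w)
    ('D_z (vc p (Y u) B W) c + vc p dy B W c).
  have := is_derive_vcubic (@Oo p) (@Es p) B W ci (sec_derive z su Ys).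
  rewrite sec_in_center; apply: near_eq_is_derive.
  apply: filterS (near_chart su) => w [cw _ _ _].
  exact: (vcubicC12 (@Es p)).
have D2 : is_derive c z (fun w => vc p (sec_in X u w) (sec_in Y u w) W w)
    ('D_z (vc p (Y u) (X u) W) c + vc p dy (X u) W c + vc p dx (Y u) W c).
  have nl : \forall w \near c, linear1 (fun B => vc p B (sec_in Y u w) W w).
    by apply: filterS (near_chart su) => w [cw _ _ _]; exact: (vcubic_lin (@Es p)).
  have := is_derive_app nl DY (sec_derive z su Xs).
  by rewrite !sec_in_center.
have D1' : is_derive c z (fun w => vm p (sec_in S u w) W w)
    ('D_z (vc p (Y u) (X u) W) c + vc p dy (X u) W c + vc p dx (Y u) W c).
  apply: near_eq_is_derive D2.
  by apply: filterS (formT_sec X Y su) => w ->.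
have E := is_derive_uniq D1 D1'.
have F A B D : vm p (tensorT nabla u A B) D c = vc p A B D c.
  apply: (etrans (esym (metric_center HL _ _ su))); exact: formTE.
have E0 : covT nabla u z X Y = chr u z (S u) + ds
    - tensorT nabla u (chr u z (X u) + dx) (Y u) - tensorT nabla u (X u) (chr u z (Y u) + dy).
  exact: (f_equal3 (fun a b d => a - tensorT nabla u b (Y u) - tensorT nabla u (X u) d)
    (nablaE HN z su Ss) (nablaE HN z su Xs) (nablaE HN z su Ys)).
apply: (etrans (congr1 (fun A => vm p A W c) E0)).
apply: (etrans (linear1B2 _ _ _ (vml W))).
have G1 := linear1D (chr u z (S u)) ds (vml W).
have G2 := etrans (F (chr u z (X u) + dx) (Y u) W) (linear1D _ _ (vcl (Y u) W)).
have G3 : vm p (tensorT nabla u (X u) (chr u z (Y u) + dy)) W c =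
    vc p (X u) (chr u z (Y u)) W c + vc p (X u) dy W c.
  apply: (etrans (F _ _ _)); apply: (etrans (vcubicC12 (@Es p) _ _ _ ci)).
  apply: (etrans (linear1D _ _ (vcl (X u) W))).
  by apply: (congr2 +%R); exact: (vcubicC12 (@Es p) _ _ _ ci).
apply: (etrans (f_equal3 (fun a b d => a - b - d) G1 G2 G3)).
rewrite /nablaT -/p -/c.
have K := cartan_compat z (S u) W su; rewrite -/p -/c in K.
refine (covT_arith _ _ E K _ _ _).
- exact: F.
- exact: (derive_vcubicC12 (@Oo p) (@Es p)).
- exact: (vcubicC12 (@Es p)).
Qed.

End Cartan.

(** * C-reducible manifolds *)

(** [formC] takes a trace in the chart of each point; invariance under conjugation lets it be
    computed in the fixed chart of a nearby point. *)
Lemma trace_conj (R : realType) n (A B f : 'rV[R]_n -> 'rV[R]_n) :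
  linear A -> linear B -> linear f -> (forall x, A (B x) = x) ->
  \sum_i B (f (A (delta_mx 0 i))) 0 i = \tr (lin1_mx f).
Proof.
move=> Al Bl fl AB.
have mulE (g : 'rV[R]_n -> 'rV[R]_n) : linear g -> forall u, u *m lin1_mx g = g u.
  move=> gl u; pose g' : {linear 'rV[R]_n -> 'rV[R]_n} :=
    HB.pack g (GRing.isLinear.Build _ _ _ _ _ gl).
  exact: (mul_rV_lin1 g').
have E : lin1_mx (fun x => B (f (A x))) = lin1_mx A *m lin1_mx f *m lin1_mx B.
  apply/row_matrixP => i; rewrite !row_mul rowE !mulE// => [|a u v].
    by rewrite rowE !mulE.
  by rewrite Al fl Bl.
transitivity (\tr (lin1_mx (fun x => B (f (A x))))).
  by apply: eq_bigr => i _; rewrite !mxE.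
rewrite E -mulmxA mxtrace_mulC -mulmxA.
suff -> : lin1_mx B *m lin1_mx A = 1%:M by rewrite mulmx1.
by apply/row_matrixP => i; rewrite row_mul rowE !mulE// AB rowE mulmx1.
Qed.

Lemma is_derive_quot0 (R : realType) (U : normedModType R) (f g e : U -> R) x v df dg :
  e x != 0 -> is_derive x v f df -> is_derive x v g dg -> is_derive x v e 0 ->
  is_derive x v (fun z => f z * g z / e z) ((df * g x + f x * dg) / e x).
Proof.
move=> e0 Df Dg De.
have Di : is_derive x v (fun z => (e z)^-1) 0.
  have de : derivable e x v by case: De.
  apply: DeriveDef; first exact: derivableV.
  by rewrite deriveV// (_ : 'D_v e x = 0) ?scaler0//; case: De.
have := is_deriveM (is_deriveM Df Dg) Di.
by apply: is_derive_val; rewrite /GRing.scale /=; ring.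
Qed.

Lemma subrDKr (F : zmodType) (a b c : F) : a + b - (c + b) = a - c.
Proof. by rewrite opprD addrACA subrr addr0. Qed.

Lemma subr_lin (F : comPzRingType) (a d1 d2 c1 c2 d : F) :
  d = a * d1 + d2 -> d - (a * c1 + c2) = a * (d1 - c1) + (d2 - c2).
Proof. by move->; ring. Qed.

Section Reducible.
Context {R : realType} {n : nat} (M : manifold R n) (L : TM M -> R).
Variable nabla : connection_op M.
Hypothesis HL : finsler L.
Hypothesis HC : cartan_connection L nabla.
Notation C := (charts M).
Notation T := (tm_charts M).
Notation center u := (Defs.coord T u u).
Notation proj := (@Defs.proj R n M).
Notation V := 'rV[R]_n.
Let HM := manifold_atlas M.
Let HT := tm_atlas M.
Let HN := cartan_linear HC.
Let Hreg := cartan_regular HC.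
Notation chr := (christoffel nabla).

Let cinv_self (u : TM M) : Defs.cinv T u (center u) = u.
Proof. exact: (atlasK HT (atlas_center HT u)). Qed.

Lemma christoffel_vert_linear u : slit M u -> linear1 (fun X => \tr (lin1_mx (chr u (0, X)))) .
Proof.
move=> su a X Y; rewrite mulr_sumr -big_split; apply: eq_bigr => i _ /=.
by rewrite !mxE vert_lin (christoffel_dir HN _ _ _ _ su) !mxE.
Qed.

Lemma formCE u X : slit M u -> Defs.formC nabla u X = \tr (lin1_mx (chr u (0, X))).
Proof.
move=> su; congr (\tr (lin1_mx _)); apply/funext => Y.
exact: (tensorTE HN Hreg).
Qed.

Lemma formC_linear u : slit M u -> linear1 (Defs.formC nabla u).
Proof.
move=> su a X Y; rewrite !(formCE _ su).
exact: (@christoffel_vert_linear u).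
Qed.

(* The one-form C, read in the chart of [u]. *)
Definition chartC (u : TM M) (v : V) (z : V * V) : R :=
  let w := Defs.cinv T u z in
  Defs.formC nabla w (chart_change C (proj u) (proj w) (proj w) v).

Lemma chartC_self u v : chartC u v (center u) = Defs.formC nabla u v.
Proof.
rewrite /chartC cinv_self; congr (Defs.formC _ _ _).
exact: (chart_change_id HM v (dom_center (proj u))).
Qed.

Lemma chartC_linear u : slit M u ->
  \forall z \near center u, linear1 (fun v => chartC u v z).
Proof.
move=> su; apply: filterS (near_slit su) => z sw a X Y.
by rewrite /chartC linearP; exact: formC_linear.
Qed.

Lemma chartC_sec u (S : TM M -> V) : slit M u -> \forall z \near center u,
  Defs.formC nabla (Defs.cinv T u z) (S (Defs.cinv T u z)) = chartC u (sec_in S u z) z.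
Proof.
move=> su; apply: filterS (near_chart su) => z [_ sw Dw _].
have Dc := dom_center (proj (Defs.cinv T u z)).
apply: (congr1 (Defs.formC nabla (Defs.cinv T u z))).
exact: esym (etrans (chart_change_comp HM _ Dc Dw Dc) (chart_change_id HM _ Dc)).
Qed.

Lemma chartC_smooth u v : slit M u -> smooth_at (chartC u v) (center u).
Proof.
move=> su; pose p := proj u.
pose S i w := tensorT nabla w (frame p v w) (frame p (delta_mx 0 i) w).
have Ss i : smooth_sec (S i) by apply: (tensorT_smooth HL HC); exact: frame_smooth.
have : smooth_at (fun z => \sum_i sec_in (S i) u z 0 i) (center u).
  by move=> k; apply: Ck_at_sum => i _; apply: Ck_at_coord; exact: Ss.
apply: smooth_at_near.
pose P i z := sec_in (frame p (delta_mx 0 i)) u z = delta_mx 0 i.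
have fr : \forall z \near center u, forall i, P i z.
  apply: (@filter_forall _ 'I_n P (nbhs (center u)) _) => i.
  exact: sec_in_frame.
apply: filterS (filterI (near_chart su) (filterI (sec_in_frame v (erefl p)) fr)).
move=> z [[_ sw Dw _] [Fv Fi]]; set w := Defs.cinv T u z in sw Dw *.
have Dc := dom_center (proj w).
set A := chart_change C p (proj w) (proj w).
set B := chart_change C (proj w) p (proj w).
have AB x : A (B x) = x.
  exact: (etrans (chart_change_comp HM x Dc Dw Dc) (chart_change_id HM x Dc)).
have FA x : sec_in (frame p x) u z = x -> frame p x w = A x.
  by move=> E; rewrite -[LHS]AB; exact: (congr1 A E).
rewrite /chartC (formCE _ sw).
rewrite -(@trace_conj R n A B (chr w (0, A v))) //.
- apply: eq_bigr => i _; apply: (congr1 (fun X : V => X 0 i)).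
  apply: (congr1 B); rewrite /S (FA _ Fv) (FA _ (Fi i)).
  exact: (tensorTE HN Hreg _ _ sw).
- exact: linearP.
- exact: linearP.
- by move=> a X Y; exact: christoffel_linear.
Qed.

Definition covCform (u : TM M) (z : V * V) (X : V) : R :=
  'D_z (chartC u X) (center u) - Defs.formC nabla u (chr u z X).

Lemma covCform_linear u z : slit M u -> linear1 (covCform u z).
Proof.
move=> su a X Y; rewrite /covCform christoffel_linear (formC_linear su).
have sm v := smooth_is_derive z (chartC_smooth v su).
apply: subr_lin; apply: (is_derive_uniq (sm _)).
have := is_deriveD (is_deriveZ a (sm X)) (sm Y).
apply: near_eq_is_derive; apply: filterS (chartC_linear su) => w lw.
exact: esym (lw a X Y).
Qed.

Lemma covCE u z X : slit M u -> smooth_sec X -> covC nabla u z X = covCform u z (X u).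
Proof.
move=> su Xs; set c := center u.
have Fs : smooth_at (fun w => chartC u (sec_in X u w) w) c.
  have : smooth_at (fun w => \sum_i sec_in X u w 0 i * chartC u (delta_mx 0 i) w) c.
    move=> k; apply: Ck_at_sum => i _; apply: Ck_at_mul.
      by apply: Ck_at_coord; exact: Xs.
    exact: chartC_smooth.
  apply: smooth_at_near; apply: filterS (chartC_linear su) => w lw.
  exact: esym (linear1_sum _ lw).
have dF := smooth_at_differentiable Fs.
have E : \forall w \near c, chartC u (sec_in X u w) w =
    ((fun w => Defs.formC nabla w (X w)) \o Defs.cinv T u) w.
  by apply: filterS (chartC_sec X su) => w H; exact: esym H.
have dX := smooth_at_differentiable (Xs u su).
have D : is_derive c z (sec_in X u) ('d (sec_in X u) c z).
  by apply: DeriveDef; [exact: diff_derivable|exact: deriveE].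
have D1 := is_derive_app (chartC_linear su) (fun v => smooth_is_derive z (chartC_smooth v su)) D.
have E1 : dfun T (fun w => Defs.formC nabla w (X w)) u z =
    'D_z (chartC u (X u)) c + Defs.formC nabla u ('d (sec_in X u) c z).
  apply: (etrans (congr1 (fun F => F z) (near_eq_diffE E dF))).
  apply: (etrans (esym (deriveE z dF))).
  have [_ E2] := D1; apply: (etrans E2).
  exact: (congr2 (fun a b => 'D_z (chartC u a) c + b) (sec_in_center X u) (chartC_self u _)).
have E2 : Defs.formC nabla u (nabla u z X) =
    Defs.formC nabla u (chr u z (X u)) + Defs.formC nabla u ('d (sec_in X u) c z).
  apply: (etrans (congr1 _ (nablaE HN z su Xs))).
  exact: (linear1D _ _ (formC_linear su)).
apply: (etrans (congr2 (fun a b => a - b) E1 E2)).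
exact: subrDKr.
Qed.

End Reducible.

Lemma is_derive_sub_quot0 (R : realType) (U : normedModType R) (m f g e : U -> R) x v m1 m2 df dg :
  e x != 0 -> is_derive x v m (m1 + m2) -> is_derive x v f df -> is_derive x v g dg ->
  is_derive x v e 0 -> is_derive x v (fun z => m z - f z * g z / e z)
    ((m1 - df * g x / e x) + (m2 - f x * dg / e x)).
Proof.
move=> e0 Dm Df Dg De; have := is_deriveB Dm (is_derive_quot0 e0 Df Dg De).
by apply: is_derive_val; ring.
Qed.

Lemma angular_in_linear_arith (F : fieldType) (a m m1 m2 x x1 x2 y e : F) :
  m = a * m1 + m2 -> x = a * x1 + x2 ->
  m - x * y / e = a * (m1 - x1 * y / e) + (m2 - x2 * y / e).
Proof. by move=> -> ->; ring. Qed.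

Lemma angular_arith (F : fieldType) (m x y l e : F) : l ^+ 2 = e ->
  m - l^-1 * x * (l^-1 * y) = m - x * y / e.
Proof. by move=> <-; rewrite -exprVn; ring. Qed.

Lemma horizontal_eta_arith (F : zmodType) (a b c : F) : c = - a -> 
  a + b + c = b.
Proof. by move=> ->; rewrite addrAC subrr add0r. Qed.

(** * The angular metric is parallel in horizontal directions *)

Section Angular.
Context {R : realType} {n : nat} (M : manifold R n) (L : TM M -> R).
Variable nabla : connection_op M.
Hypothesis HL : finsler L.
Hypothesis HC : cartan_connection L nabla.
Notation C := (charts M).
Notation T := (tm_charts M).
Notation center u := (Defs.coord T u u).
Notation proj := (@Defs.proj R n M).
Notation V := 'rV[R]_n.
Let HT := tm_atlas M.
Let HN := cartan_linear HC.
Notation chr := (christoffel nabla).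
Notation vm p := (vmetric (energy L p)).

Let Es p := @energy_smooth R n M L HL p.
Let Oo (p : M) : open (chart_image p). Proof. exact: chart_image_open. Qed.
Let Eh p := @energy_homog R n M L HL p.

(** At [(x, y)] with [x] fixed, this is the [h] of the fibre calculus. Writing [L^2] as a metric
    value makes every term differentiable by [is_derive_vmetric]. *)
Definition angular_in (p : M) (X Y : V) (z : V * V) : R :=
  vm p X Y z - vm p z.2 X z * vm p z.2 Y z / vm p z.2 z.2 z.

Lemma tm_coord_snd (u : TM M) : (center u).2 = u.2.
Proof. by rewrite tm_coord_self. Qed.

Lemma energy_self (u : TM M) : energy L (proj u) (center u) = L u ^+ 2.
Proof. by rewrite /energy; congr (L _ ^+ 2); exact: (atlasK HT (atlas_center HT u)). Qed.

Lemma vm_eta2 u : slit M u -> vm (proj u) u.2 u.2 (center u) = L u ^+ 2.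
Proof.
move=> su; have := vmetric_eta2 (@Oo (proj u)) (@Es (proj u)) (@Eh (proj u)) (chart_image_self su).
by rewrite energy_self tm_coord_self.
Qed.

Lemma vm_posdef u X : slit M u -> X != 0 -> 0 < vm (proj u) X X (center u).
Proof. by move=> su X0; rewrite -metric_center//; exact: (finsler_posdef HL). Qed.

Lemma vm_eta2_neq0 u : slit M u -> vm (proj u) u.2 u.2 (center u) != 0.
Proof. by move=> su; apply: lt0r_neq0; apply: vm_posdef. Qed.

Lemma angularE u X Y : slit M u -> angular L u X Y = angular_in (proj u) X Y (center u).
Proof.
move=> su; rewrite /angular_in /angular /ell /eta.
have mC A B := vmetricC (@Es (proj u)) A B (chart_image_self su).
have E A : metric L u A u.2 = vm (proj u) u.2 A (center u).
  exact: (etrans (metric_center HL A u.2 su) (mC A u.2)).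
have F := angular_arith (vm (proj u) X Y (center u)) (vm (proj u) u.2 X (center u))
  (vm (proj u) u.2 Y (center u)) (esym (vm_eta2 su)).
apply: (etrans _ (etrans F _)).
  exact: (f_equal3 (fun a b c => a - (L u)^-1 * b * ((L u)^-1 * c))
    (metric_center HL X Y su) (E X) (E Y)).
exact: (congr1 (fun v : V => vm (proj u) X Y (center u)
  - vm (proj u) v X (center u) * vm (proj u) v Y (center u)
    / vm (proj u) v v (center u)) (esym (tm_coord_snd u))).
Qed.

Lemma angular_chart u (w : TM M) X Y : slit M w -> tm_dom u w ->
  angular L w X Y = angular_in (proj u) (chart_change C (proj w) (proj u) (proj w) X)
    (chart_change C (proj w) (proj u) (proj w) Y) (Defs.coord T u w).
Proof.
move=> sw Dw; apply: (etrans (angularE X Y sw)).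
have E A B := etrans (esym (metric_center HL A B sw)) (metric_chart HL A B sw Dw).
apply: (etrans (congr1 (fun v : V => vm (proj w) X Y (center w)
  - vm (proj w) v X (center w) * vm (proj w) v Y (center w)
    / vm (proj w) v v (center w)) (tm_coord_snd w))).
exact: (congr2 (fun a b => a - b) (E X Y)
  (f_equal3 (fun a b c => a * b / c) (E w.2 X) (E w.2 Y) (E w.2 w.2))).
Qed.

Lemma angular_in_linear u Y : slit M u -> linear1 (fun X => angular_in (proj u) X Y (center u)).
Proof.
move=> su a X X'; have ci := chart_image_self su.
have ml Z := vmetric_lin (@Es (proj u)) Z ci.
have ml2 : linear1 (fun X => vm (proj u) (center u).2 X (center u)).
  move=> b A B; have mC D := vmetricC (@Es (proj u)) (center u).2 D ci.
  exact: (etrans (mC _) (etrans (ml _ b A B) (congr2 (fun s t => b * s + t) (esym (mC A)) (esym (mC B))))).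
exact: (angular_in_linear_arith _ _ (ml Y a X X') (ml2 a X X')).
Qed.

Lemma angular_inC u X Y : slit M u ->
  angular_in (proj u) X Y (center u) = angular_in (proj u) Y X (center u).
Proof.
move=> su; apply: (congr2 (fun a b => a - b / _)); last exact: mulrC.
exact: (vmetricC (@Es (proj u)) X Y (chart_image_self su)).
Qed.

(** Horizontality says that the fibre component of [z] is minus the coefficient applied to [eta].
    The variation of [eta] thus cancels against its coefficient term in [D1], and makes [L^2]
    constant along [z] in [D2]. *)
Lemma is_derive_angular_in u z X Y : slit M u -> nabla u z (@eta R n M) = 0 ->
  is_derive (center u) z (angular_in (proj u) X Y)
    (angular_in (proj u) (chr u z X) Y (center u) + angular_in (proj u) X (chr u z Y) (center u)).
Proof.
move=> su Hz; set p := proj u; set c := center u.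
have ci : chart_image p c by exact: chart_image_self.
have c2 : c.2 = u.2 by rewrite /c tm_coord_self.
have z2 : z.2 = - chr u z u.2.
  by move: Hz; rewrite (nabla_eta HN)// addrC => /eqP; rewrite addr_eq0 => /eqP.
have ml Z := vmetric_lin (@Es p) Z ci.
have mN A B : vm p (- A) B c = - vm p A B c.
  by rewrite -scaleN1r (linear1Z _ _ (ml B)) mulN1r.
have comp A B : 'D_z (vm p A B) c = vm p (chr u z A) B c + vm p A (chr u z B) c.
  exact: (cartan_compat HL HC).
have D1 A : is_derive c z (fun w : V * V => vm p w.2 A w) (vm p c.2 (chr u z A) c).
  have := is_derive_vmetric (@Oo p) (@Es p) A ci (is_derive_snd c z).
  apply: is_derive_val; apply: (etrans (congr1 (fun v : V => 'D_z (vm p v A) c + vm p z.2 A c) c2)).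
  apply: (etrans (congr1 (fun t => t + vm p z.2 A c) (comp u.2 A))).
  apply: (etrans (horizontal_eta_arith _ (etrans (congr1 (fun v : V => vm p v A c) z2) (mN _ A)))).
  exact: (congr1 (fun v : V => vm p v (chr u z A) c) (esym c2)).
have D2 : is_derive c z (fun w : V * V => vm p w.2 w.2 w) 0.
  have nl : \forall w \near c, linear1 (fun B : V => vm p w.2 B w).
    apply: filterS (near_chart su) => w [cw _ _ _] b A B.
    have mC D := vmetricC (@Es p) w.2 D cw.
    exact: (etrans (mC _) (etrans (vmetric_lin (@Es p) _ cw b A B)
      (congr2 (fun s t => b * s + t) (esym (mC A)) (esym (mC B))))).
  have := is_derive_app (B := fun (B : V) (w : V * V) => vm p w.2 B w) nl D1 (is_derive_snd c z).
  apply: is_derive_val.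
  apply: (etrans (congr2 (fun v v' : V => vm p v (chr u z v) c + vm p v v' c) c2 z2)).
  apply: (etrans (congr1 (fun t => vm p u.2 (chr u z u.2) c + t) (etrans (vmetricC (@Es p) _ _ ci)
    (etrans (mN _ _) (congr1 -%R (vmetricC (@Es p) _ _ ci)))))).
  exact: subrr.
have e0 : vm p c.2 c.2 c != 0.
  apply/eqP => E; apply: (elimN eqP (vm_eta2_neq0 su)).
  exact: (etrans (congr1 (fun v : V => vm p v v c) (esym c2)) E).
have Dm : is_derive c z (vm p X Y) (vm p (chr u z X) Y c + vm p X (chr u z Y) c).
  have := smooth_is_derive z (vmetric_smooth (@Es p) X Y ci).
  apply: is_derive_val; exact: comp.
have H := @is_derive_sub_quot0 R _ (vm p X Y) (fun w : V * V => vm p w.2 X w)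
  (fun w : V * V => vm p w.2 Y w) (fun w : V * V => vm p w.2 w.2 w) c z
  (vm p (chr u z X) Y c) (vm p X (chr u z Y) c) (vm p c.2 (chr u z X) c)
  (vm p c.2 (chr u z Y) c) e0 Dm (D1 X) (D1 Y) D2.
exact: H.
Qed.

End Angular.

Lemma is_derive_mul2 (R : realType) (U : normedModType R) (f g : U -> R) x v f1 f2 dg :
  is_derive x v f (f1 + f2) -> is_derive x v g dg ->
  is_derive x v (fun z => f z * g z) ((f1 + f2) * g x + f x * dg).
Proof.
move=> Df Dg; have := is_deriveM Df Dg.
by apply: is_derive_val; rewrite /GRing.scale /=; ring.
Qed.

Lemma is_derive_lin3 (R : realType) (U : normedModType R) (f g h : U -> R) k x v df dg dh :
  is_derive x v f df -> is_derive x v g dg -> is_derive x v h dh ->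
  is_derive x v (fun z => k * (f z + g z + h z)) (k * (df + dg + dh)).
Proof.
by move=> Df Dg Dh; have := is_deriveZ k (is_deriveD (is_deriveD Df Dg) Dh).
Qed.

Lemma nablaT_arith (F : comPzRingType) (k d a1 a2 a3 b1 b2 c1 c2 e1 e2 cx cy cw cx' cy' cw'
    kx ky kw px py pw hxy hyw hwx : F) :
  d = k * (((b1 + b2) * cw' + hxy * kw) + ((c1 + c2) * cx' + hyw * kx) + ((e1 + e2) * cy' + hwx * ky)) ->
  cw' = cw -> cx' = cx -> cy' = cy ->
  a1 = k * (b1 * cw + hyw * px + e2 * cy) ->
  a2 = k * (b2 * cw + c1 * cx + hwx * py) ->
  a3 = k * (hxy * pw + c2 * cx + e1 * cy) ->
  d - a1 - a2 - a3 = k * (hxy * (kw - pw) + hyw * (kx - px) + hwx * (ky - py)).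
Proof. by move=> -> -> -> -> -> -> ->; ring. Qed.

(* [f] vanishes at [e], hence is constant along the lines directed by [e], on
   which [h] takes nonzero values. *)
Lemma quadratic_kill (R : realType) n (h : 'rV[R]_n -> 'rV[R]_n -> R) (f : 'rV[R]_n -> R) e :
  (forall B, linear1 (h^~ B)) -> (forall A B, h A B = h B A) -> h e e != 0 -> linear1 f ->
  (forall v, h v v * f v = 0) -> forall v, f v = 0.
Proof.
move=> hl hC hee fl H.
have fe : f e = 0 by move/eqP: (H e); rewrite mulf_eq0 (negbTE hee) => /eqP.
move=> v; apply/eqP/negPn/negP => fv.
have hvt t : h v v + 2 * t * h e v + t ^+ 2 * h e e = 0.
  have E : f (t *: e + v) = f v by rewrite fl fe mulr0 add0r.
  move: (H (t *: e + v)); rewrite E => /eqP; rewrite mulf_eq0 (negbTE fv) orbF => /eqP.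
  rewrite hl (hC e) (hC v) !hl (hC v e); lra.
have := hvt 0; have := hvt 1; have := hvt (-1); move/eqP: hee; lra.
Qed.

(** * C-reducibility differentiated *)

Section Consequences.
Context {R : realType} {n : nat} (M : manifold R n) (L : TM M -> R).
Variable nabla : connection_op M.
Hypothesis HL : finsler L.
Hypothesis HC : cartan_connection L nabla.
Hypothesis Hred : C_reducible L nabla.
Notation C := (charts M).
Notation T := (tm_charts M).
Notation center u := (Defs.coord T u u).
Notation proj := (@Defs.proj R n M).
Notation V := 'rV[R]_n.
Let HM := manifold_atlas M.
Notation chr := (christoffel nabla).
Notation vm p := (vmetric (energy L p)).
Notation vc p := (vcubic (energy L p)).
Notation angular_in := (angular_in L).
Notation chartC := (chartC nabla).
Notation covCform := (covCform nabla).
Notation k := (n.+1%:R^-1 : R).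

Let Es p := @energy_smooth R n M L HL p.

(** C-reducibility is assumed in the chart of each point; it can only be differentiated once it
    holds in one chart for all nearby points. *)
Lemma vcubic_reducible u : slit M u -> \forall z \near center u, forall X Y Z,
  vc (proj u) X Y Z z = k * (angular_in (proj u) X Y z * chartC u Z z
    + angular_in (proj u) Y Z z * chartC u X z + angular_in (proj u) Z X z * chartC u Y z).
Proof.
move=> su; apply: filterS (near_chart su) => z [_ sw Dw Ez] X Y Z.
set p := proj u; set w := Defs.cinv T u z in sw Dw Ez *.
have Dc := dom_center (proj w).
set A := chart_change C p (proj w) (proj w).
set B := chart_change C (proj w) p (proj w).
have BA x : B (A x) = x.
  exact: (etrans (chart_change_comp HM x Dw Dc Dw) (chart_change_id HM x Dw)).
have E1 : vc p X Y Z z = formT L nabla w (A X) (A Y) (A Z).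
  apply: (etrans (congr1 (vc p X Y Z) Ez)).
  apply: (etrans (f_equal3 (fun a b c => vc p a b c (Defs.coord T u w))
    (esym (BA X)) (esym (BA Y)) (esym (BA Z)))).
  apply: (etrans (esym (vcubic_chart HL (A X) (A Y) (A Z) sw Dw))).
  exact: esym (formTE HL HC _ _ _ sw).
have E2 x y : angular L w (A x) (A y) = angular_in p x y z.
  apply: (etrans (angular_chart HL (A x) (A y) sw Dw)).
  apply: (etrans (congr2 (fun a b => angular_in p a b (Defs.coord T u w)) (BA x) (BA y))).
  exact: (congr1 (angular_in p x y) (esym Ez)).
apply: (etrans E1); apply: (etrans (Hred.2 w sw (A X) (A Y) (A Z))).
exact: (f_equal3 (fun a b c => k * (a * chartC u Z z + b * chartC u X z + c * chartC u Y z))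
  (E2 X Y) (E2 Y Z) (E2 Z X)).
Qed.

Lemma vcubic_reducible_at u X Y Z : slit M u ->
  vc (proj u) X Y Z (center u) = k * (angular_in (proj u) X Y (center u) * Defs.formC nabla u Z
    + angular_in (proj u) Y Z (center u) * Defs.formC nabla u X
    + angular_in (proj u) Z X (center u) * Defs.formC nabla u Y).
Proof.
move=> su; have H := nbhs_singleton (vcubic_reducible su).
apply: (etrans (H X Y Z)).
exact: (f_equal3 (fun a b c => k * (angular_in (proj u) X Y (center u) * a
  + angular_in (proj u) Y Z (center u) * b + angular_in (proj u) Z X (center u) * c))
  (chartC_self _ _ _) (chartC_self _ _ _) (chartC_self _ _ _)).
Qed.

Lemma nablaT_reducible u z X Y W : slit M u -> nabla u z (@eta R n M) = 0 ->
  nablaT L nabla u z X Y W = k * (angular_in (proj u) X Y (center u) * covCform u z W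
    + angular_in (proj u) Y W (center u) * covCform u z X
    + angular_in (proj u) W X (center u) * covCform u z Y).
Proof.
move=> su Hz; set p := proj u; set c := center u.
have DH A B := is_derive_angular_in HL HC A B su Hz.
have DC A : is_derive c z (chartC u A) ('D_z (chartC u A) c).
  exact: (smooth_is_derive z (chartC_smooth HL HC A su)).
have D := is_derive_lin3 k (is_derive_mul2 (DH X Y) (DC W)) (is_derive_mul2 (DH Y W) (DC X))
  (is_derive_mul2 (DH W X) (DC Y)).
have [_ E0] := D.
have E1 := near_eq_derive z (filterS (fun w (H : forall X Y Z, _) => H X Y W) (vcubic_reducible su)).
have H := (nablaT_arith (etrans (E1 _) E0) (chartC_self _ _ _) (chartC_self _ _ _) (chartC_self _ _ _)
  (vcubic_reducible_at (chr u z X) Y W su) (vcubic_reducible_at X (chr u z Y) W su)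
  (vcubic_reducible_at X Y (chr u z W) su)).
exact: H.
Qed.

Lemma angular_in_kill u (f : V -> R) : slit M u -> linear1 f ->
  (forall v, angular_in (proj u) v v (center u) * f v = 0) -> forall v, f v = 0.
Proof.
move=> su fl H.
have ci := chart_image_self su.
have ml Z : linear1 (fun X => vm (proj u) X Z (center u)) := vmetric_lin (@Es (proj u)) Z ci.
have [e [e0 ev _]] := common_kernel Hred.1 (ml u.2) (ml u.2).
pose h A B := angular_in (proj u) A B (center u).
have hl B : linear1 (h^~ B) := angular_in_linear HL B su.
have hC A B : h A B = h B A := angular_inC HL A B su.
have hee : h e e != 0.
  have ev' : vm (proj u) (center u).2 e (center u) = 0.
    apply: (etrans (vmetricC (@Es (proj u)) _ _ ci)).
    exact: (etrans (congr1 (fun v : V => vm (proj u) e v (center u)) (tm_coord_snd u)) ev).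
  have E : h e e = vm (proj u) e e (center u).
    by apply: (etrans (congr1 (fun t => _ - t * t / _) ev')); rewrite mul0r mul0r subr0.
  by rewrite E; apply: lt0r_neq0; exact: vm_posdef.
exact: (quadratic_kill hl hC hee fl H).
Qed.

End Consequences.

Lemma sum0_of_terms (F : pzRingType) (k a b c x y z : F) :
  x = 0 -> y = 0 -> z = 0 -> k * (a * x + b * y + c * z) = 0.
Proof. by move=> -> -> ->; rewrite !mulr0 !addr0 mulr0. Qed.

Lemma triple_eq0 (F : numFieldType) (k h f : F) : k != 0 -> k * (h * f + h * f + h * f) = 0 -> h * f = 0.
Proof.
move=> k0 /eqP; rewrite mulf_eq0 (negbTE k0) /= -mulr2n -mulrSr -mulr_natl mulf_eq0.
by rewrite pnatr_eq0 => /eqP.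
Qed.

(** * The three conditions as identities between tensors at a point *)

Section Equivalences.
Context {R : realType} {n : nat} (M : manifold R n) (L : TM M -> R).
Variable nabla : connection_op M.
Hypothesis HL : finsler L.
Hypothesis HC : cartan_connection L nabla.
Hypothesis Hred : C_reducible L nabla.
Notation T := (tm_charts M).
Notation center u := (Defs.coord T u u).
Notation proj := (@Defs.proj R n M).
Let Hreg := cartan_regular HC.
Notation vm p := (vmetric (energy L p)).
Notation angular_in := (angular_in L).
Notation covCform := (covCform nabla).
Notation nablaT := (nablaT L nabla).
Notation k := (n.+1%:R^-1 : R).

Let Es p := @energy_smooth R n M L HL p.

Lemma vm_nondeg u A : slit M u -> (forall W, vm (proj u) A W (center u) = 0) -> A = 0.
Proof.
move=> su H; apply/eqP/negPn/negP => A0.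
by have := vm_posdef HL su A0; rewrite H ltxx.
Qed.

Lemma covT0P u z X Y : slit M u -> smooth_sec X -> smooth_sec Y ->
  covT nabla u z X Y = 0 <-> forall W, nablaT u z (X u) (Y u) W = 0.
Proof.
move=> su Xs Ys; have E W := covTE HL HC z W su Xs Ys; split => [H W|H].
  apply: (etrans (esym (E W))); apply: (etrans (congr1 (fun A => vm (proj u) A W _) H)).
  exact: (linear1_0 (vmetric_lin (@Es (proj u)) W (chart_image_self su))).
by apply: (vm_nondeg su) => W; exact: etrans (E W) (H W).
Qed.

Lemma landsbergP : landsberg nabla <-> forall u, slit M u -> forall X Y W,
  nablaT u (beta nabla u u.2) X Y W = 0.
Proof.
split=> [H u su X Y W|H u su X Y Xs Ys].
  have := (covT0P _ su (frame_smooth (proj u) X) (frame_smooth (proj u) Y)).1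
    (H u su _ _ (frame_smooth (proj u) X) (frame_smooth (proj u) Y)) W.
  by rewrite !frame_at.
by apply/covT0P => // W; exact: H.
Qed.

Lemma general_landsbergP : general_landsberg nabla <-> forall u, slit M u -> forall X,
  covCform u (beta nabla u u.2) X = 0.
Proof.
split=> [H u su X|H u su X Xs].
  have := H u su _ (frame_smooth (proj u) X).
  by rewrite (covCE HL HC _ su (frame_smooth (proj u) X)) frame_at.
apply: (etrans (covCE HL HC _ su Xs)); exact: H.
Qed.

(** For the direct implication the three arguments are set equal: this leaves
    [h v v * covCform v = 0] for all [v], and [angular_in_kill] handles the vectors where [h v v]
    vanishes. *)
Lemma nablaT_eq0P u z : slit M u -> nabla u z (@eta R n M) = 0 ->
  (forall X Y W, nablaT u z X Y W = 0) <-> forall X, covCform u z X = 0.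
Proof.
move=> su Hz; have E X Y W := nablaT_reducible HL HC Hred X Y W su Hz.
split=> [H|H X Y W]; last by apply: (etrans (E X Y W)); apply: sum0_of_terms; exact: H.
apply: (@angular_in_kill _ _ M L nabla HL Hred u (covCform u z) su).
  exact: (covCform_linear HL HC).
move=> v; have k0 : k != 0 by rewrite invr_eq0 pnatr_eq0.
exact: (triple_eq0 k0 (etrans (esym (E v v v)) (H v v v))).
Qed.

Lemma landsberg_general : landsberg nabla <-> general_landsberg nabla.
Proof.
split.
  move/landsbergP => H; apply/general_landsbergP => u su.
  by apply/(nablaT_eq0P su (beta_spec Hreg u.2 su).1); exact: H.
move/general_landsbergP => H; apply/landsbergP => u su.
by apply/(nablaT_eq0P su (beta_spec Hreg u.2 su).1); exact: H.
Qed.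

Lemma berwald_landsberg : berwald nabla -> landsberg nabla.
Proof. by move=> H u su Y Z Ys Zs; exact: (H _ (@eta_smooth _ _ M) u su Y Z Ys Zs). Qed.

End Equivalences.

Lemma sub3_eq0 (F : zmodType) (a b c d e : F) : a - b - c - d - e = 0 -> a - b = c + d + e.
Proof.
move/eqP; rewrite subr_eq0 => /eqP H.
by rewrite -(subrK c (a - b)) -(subrK d (a - b - c)) H addrC [e + d]addrC addrA.
Qed.

Lemma derivable_fibre (R : realType) n (W : normedModType R) (f : 'rV[R]_n * 'rV[R]_n -> W) x y X :
  differentiable f (x, y) ->
  is_derive y X (fun v => f (x, v)) ('D_(0, X) f (x, y)).
Proof.
move=> df; have idc : continuous (idfun : {linear 'rV[R]_n -> 'rV[R]_n}) by move=> z.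
apply: DeriveDef; last exact: (derive_fibre (A := idfun) X idc df).
apply: diff_derivable.
have dp : differentiable (fun v : 'rV[R]_n => (x, v)) y.
  by apply: differentiable_pair => //; exact: differentiable_cst.
exact: (differentiable_comp dp df).
Qed.

(** * The manifold data as data on one fibre *)

Section Dichotomy.
Context {R : realType} {n : nat} (M : manifold R n) (L : TM M -> R).
Variable nabla : connection_op M.
Hypothesis HL : finsler L.
Hypothesis HC : cartan_connection L nabla.
Hypothesis Hred : C_reducible L nabla.
Notation C := (charts M).
Notation T := (tm_charts M).
Notation coord := (Defs.coord C).
Notation proj := (@Defs.proj R n M).
Notation V := 'rV[R]_n.
Let HM := manifold_atlas M.
Let HT := tm_atlas M.
Let HN := cartan_linear HC.
Let Hreg := cartan_regular HC.
Notation chr := (christoffel nabla).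
Notation vm p := (vmetric (energy L p)).
Notation vc p := (vcubic (energy L p)).
Notation angular_in := (angular_in L).
Notation covCform := (covCform nabla).
Notation nablaT := (nablaT L nabla).
Notation k := (n.+1%:R^-1 : R).

Let Es p := @energy_smooth R n M L HL p.
Let Oo (p : M) : open (chart_image p). Proof. exact: chart_image_open. Qed.
Let Eh p := @energy_homog R n M L HL p.

Variable p : M.
Let x0 := coord p p.
Let at_ (y : V) : TM M := (p, y).
Let G X Y y := vm p X Y (x0, y).
Let Cc X Y Z y := vc p X Y Z (x0, y).
Let Gx a X Y y := 'D_(a, 0) (vm p X Y) (x0, y).
Let Cx a X Y Z y := 'D_(a, 0) (vc p X Y Z) (x0, y).
Let Ga y a X := chr (at_ y) (beta nabla (at_ y) a) X.

Let ce y : Defs.coord T (at_ y) (at_ y) = (x0, y). Proof. exact: tm_coord_self. Qed.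

Let ci (y : V) : y != 0 -> chart_image p (x0, y).
Proof.
move=> y0; have su : slit M (at_ y) by [].
exact: (eq_ind _ (chart_image p) (chart_image_self su) _ (ce y)).
Qed.

Let Gsm X Y (y : V) : y != 0 -> smooth_at (vm p X Y) (x0, y).
Proof. by move=> y0; exact: (vmetric_smooth (@Es p) X Y (ci y0)). Qed.

Let Csm X Y Z (y : V) : y != 0 -> smooth_at (vc p X Y Z) (x0, y).
Proof. by move=> y0; exact: (vcubic_smooth (@Es p) X Y Z (ci y0)). Qed.

(** The lift of [a] is [(a, - Ga y a y)], since [eta] is parallel along it; this turns horizontal
    derivatives into base and fibre derivatives. *)
Let beta_derive (f : V * V -> R) a (y : V) : y != 0 -> smooth_at f (x0, y) ->
  'D_(beta nabla (at_ y) a) f (x0, y) =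
  'D_(a, 0) f (x0, y) - 'D_(0, Ga y a y) f (x0, y).
Proof.
move=> y0 fs; have su : slit M (at_ y) by [].
have E : beta nabla (at_ y) a = (-1) *: (0, Ga y a y) + (a, 0).
  rewrite [LHS]surjective_pairing.
  apply: (etrans (congr2 pair (beta_spec Hreg a su).2 (beta_snd HN Hreg a su))).
  transitivity ((-1) *: (0 : V) + a, (-1) *: Ga y a y + (0 : V)) => //.
  by rewrite scaler0 add0r addr0 scaleN1r.
apply: (etrans (congr1 (fun z => 'D_z f (x0, y)) E)).
by rewrite (derive_lin _ _ _ fs) mulN1r addrC.
Qed.

(** [beta] is chosen separately at each point, so smoothness in [v] is obtained by recognizing
    [Ga v a X] as the values, along the fibre, of the smooth section [S]. *)
Let Ga_smooth a X (y : V) : y != 0 -> smooth_at (fun v => Ga v a X) y.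
Proof.
move=> y0; have su : slit M (at_ y) by [].
pose S (w : TM M) := nabla w (beta nabla w (frame p a w)) (frame p X).
have Ss : smooth_sec S.
  apply: (nabla_smooth HN) (frame_smooth _ _).
  exact: (beta_smooth HN Hreg (frame_smooth p a)).
have s1 : smooth_at (sec_in S (at_ y)) (x0, y).
  exact: (eq_ind _ (smooth_at (sec_in S (at_ y))) (Ss _ su) _ (ce y)).
have s2 : smooth_at (fun v : V => (x0, v)) y.
  move=> l; apply: Ck_at_pair; first exact: Ck_at_cst.
  by apply: (@Ck_at_linear R V V l idfun) => z.
have := smooth_at_comp (finite_basis_rVrV n) s2 s1.
apply: smooth_at_near; apply: filterS (fibre_near su) => v v0.
have Dc := dom_center p.
have Ev : (x0, v) = Defs.coord T (at_ y) (at_ v).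
  exact: (congr1 (pair x0) (esym (chart_change_id HM v Dc))).
have Ec : Defs.cinv T (at_ y) (x0, v) = at_ v.
  apply: (etrans (congr1 (Defs.cinv T (at_ y)) Ev)).
  exact: (atlasK HT (Dc : tm_dom (at_ y) (at_ v))).
have E1 : sec_in S (at_ y) (x0, v) = S (at_ v).
  apply: (etrans (congr1 (fun w => tcoord C p (proj w) (S w)) Ec)).
  exact: (chart_change_id HM _ Dc).
apply: (etrans E1); rewrite /S.
apply: (etrans (congr1 (fun b => nabla (at_ v) (beta nabla (at_ v) b) (frame p X)) (frame_at (at_ v) a))).
exact: (nabla_frame_const HN (beta nabla (at_ v) a) X v0).
Qed.

Let fibre_is_derive (f : V * V -> R) X (y : V) : smooth_at f (x0, y) ->
  is_derive y X (fun v => f (x0, v)) ('D_(0, X) f (x0, y)).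
Proof. by move=> fs; apply: derivable_fibre; exact: smooth_at_differentiable. Qed.

Let fibreTE a X Y Z (y : V) : y != 0 ->
  fibreT Cc Cx Ga a X Y Z y = nablaT (at_ y) (beta nabla (at_ y) a) X Y Z.
Proof.
move=> y0; have cs := Csm X Y Z y0.
have E : nablaT (at_ y) (beta nabla (at_ y) a) X Y Z =
    'D_(beta nabla (at_ y) a) (vc p X Y Z) (x0, y) - Cc (Ga y a X) Y Z y
      - Cc X (Ga y a Y) Z y - Cc X Y (Ga y a Z) y.
  exact: (congr1 (fun c => 'D_(beta nabla (at_ y) a) (vc p X Y Z) c - vc p (Ga y a X) Y Z c
    - vc p X (Ga y a Y) Z c - vc p X Y (Ga y a Z) c) (ce y)).
have [_ D] := fibre_is_derive (Ga y a y) cs.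
have B := etrans (beta_derive a y0 cs) (congr1 (fun t => Cx a X Y Z y - t) (esym D)).
apply: esym; apply: (etrans E).
exact: (congr1 (fun t => t - Cc (Ga y a X) Y Z y - Cc X (Ga y a Y) Z y - Cc X Y (Ga y a Z) y) B).
Qed.

Let metE a X Y (y : V) : y != 0 ->
  Gx a X Y y - 2 * Cc (Ga y a y) X Y y = G (Ga y a X) Y y + G X (Ga y a Y) y.
Proof.
move=> y0; have su : slit M (at_ y) by [].
have E := cartan_compat HL HC (beta nabla (at_ y) a) X Y su.
have E1 : 'D_(beta nabla (at_ y) a) (vm p X Y) (x0, y) = G (Ga y a X) Y y + G X (Ga y a Y) y.
  exact: (eq_ind _ (fun c => 'D_(beta nabla (at_ y) a) (vm p X Y) c =
    vm p (Ga y a X) Y c + vm p X (Ga y a Y) c) E _ (ce y)).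
apply: (etrans _ E1); apply: esym; apply: (etrans (beta_derive a y0 (Gsm X Y y0))).
exact: (congr1 (fun t => Gx a X Y y - t) (derive_vmetric (energy L p) (Ga y a y) X Y (x0, y))).
Qed.

Hypothesis Hl : landsberg nabla.

(** The Landsberg condition is used at every nonzero vector of the fibre, because the argument
    differentiates it there; the alternative is nevertheless drawn at each [y] separately. *)
Lemma fibre_landsberg (y : V) : y != 0 ->
  (forall a X Y Z, nablaT (at_ y) (beta nabla (at_ y) a) X Y Z = 0) \/
  (forall X, Defs.formC nabla (at_ y) X = 0).
Proof.
move=> y0.
suff [H|H] : (forall a X Y Z, fibreT Cc Cx Ga a X Y Z y = 0) \/
    (forall X, Defs.formC nabla (at_ y) X = 0).
- by left=> a X Y Z; exact: (etrans (esym (fibreTE a X Y Z y0)) (H a X Y Z)).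
- by right.
have su (v : V) : v != 0 -> slit M (at_ v) by [].
apply: (@fibre_dichotomy R n G Cc Gx Cx Ga _ _ _ _ _ _ _ _ _ _ _ _ _ _ _ _ _ _ _ _ _ _
  (fun X v => Defs.formC nabla (at_ v) X)
  (fun v a X => covCform (at_ v) (beta nabla (at_ v) a) X) k _ _ _ _ _ Hred.1 y y0).
- move=> v v0 Y; exact: (vmetric_lin (@Es p) Y (ci v0)).
- move=> v v0 X Y; exact: (vmetricC (@Es p) X Y (ci v0)).
- move=> v v0 X X0.
  exact: (eq_ind _ (fun c => is_true (0 < vm p X X c)) (vm_posdef HL (su v v0) X0) _ (ce v)).
- move=> v v0 Y Z; exact: (vcubic_lin (@Es p) Y Z (ci v0)).
- move=> v v0 X Y Z; exact: (vcubicC12 (@Es p) X Y Z (ci v0)).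
- move=> v v0 X Y Z; exact: (vcubicC23 (@Oo p) (@Es p) X Y Z (ci v0)).
- move=> v v0 X Y; exact: (vcubic_eta (@Oo p) (@Es p) (@Eh p) X Y (ci v0)).
- move=> v v0 X Y b u u'; apply: (etrans (congr1 (fun z => 'D_z _ _) (hor_lin b u u'))).
  exact: (derive_lin _ _ _ (Gsm X Y v0)).
- move=> v v0 a Y; exact: (derive_vmetric_lin (@Oo p) (@Es p) (a, 0) Y (ci v0)).
- move=> v v0 a X Y; exact: (derive_vmetricC (@Oo p) (@Es p) (a, 0) X Y (ci v0)).
- move=> v v0 a X Y Z; exact: (derive_vcubicC12 (@Oo p) (@Es p) (a, 0) X Y Z (ci v0)).
- move=> v v0 a X Y Z; exact: (derive_vcubicC23 (@Oo p) (@Es p) (a, 0) X Y Z (ci v0)).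
- move=> v v0 a X Y; apply: (etrans (derive_vcubic_eta (@Oo p) (@Es p) (@Eh p) (a, 0) X Y (ci v0))).
  apply: (etrans (congr1 -%R (linear1_0 (vcubic_lin (@Es p) X Y (ci v0))))); exact: oppr0.
- move=> v v0 X Y W; apply: is_derive_val (fibre_is_derive W (Gsm X Y v0)).
  exact: derive_vmetric.
- move=> v v0 a X Y W; apply: is_derive_val (fibre_is_derive W (smooth_at_D (a, 0) (Gsm X Y v0))).
  exact: (derive_vmetric_hor (@Es p) a W X Y (ci v0)).
- by move=> v v0 X Y Z W; have [] := fibre_is_derive W (Csm X Y Z v0).
- move=> v v0 X Y Z W.
  have [_ E1] := fibre_is_derive W (Csm X Y Z v0).
  have [_ E2] := fibre_is_derive X (Csm W Y Z v0).
  apply: (etrans E1); apply: (etrans _ (esym E2)).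
  exact: (derive_vcubicC (@Es p) X Y Z W (ci v0)).
- move=> v v0 a b u u'; exact: christoffel_linear.
- move=> v v0 a X; exact: (christoffel_sym HC a X (su v v0)).
- move=> v v0 a X; exact: Ga_smooth.
- move=> v v0 a X Y; exact: metE.
- move=> v v0 X Y Z; apply: sub3_eq0.
  apply: (etrans (fibreTE v X Y Z v0)).
  exact: ((landsbergP HL HC).1 Hl (at_ v) (su v v0)).
- by rewrite invr_eq0 pnatr_eq0.
- move=> v v0; exact: (formC_linear HC (su v v0)).
- move=> v v0 a; exact: (covCform_linear HL HC (beta nabla (at_ v) a) (su v v0)).
- move=> v v0 X Y Z.
  exact: (eq_ind _ (fun c => vc p X Y Z c = k * (angular_in p X Y c * Defs.formC nabla (at_ v) Z
    + angular_in p Y Z c * Defs.formC nabla (at_ v) X + angular_in p Z X c * Defs.formC nabla (at_ v) Y))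
    (vcubic_reducible_at HL HC Hred X Y Z (su v v0)) _ (ce v)).
- move=> v v0 a X Y Z; apply: (etrans (fibreTE a X Y Z v0)).
  set kf := covCform (at_ v) (beta nabla (at_ v) a).
  exact: (eq_ind _ (fun c => nablaT (at_ v) (beta nabla (at_ v) a) X Y Z = k * (angular_in p X Y c * kf Z
    + angular_in p Y Z c * kf X + angular_in p Z X c * kf Y))
    (nablaT_reducible HL HC Hred X Y Z (su v v0) (beta_spec Hreg a (su v v0)).1) _ (ce v)).
Qed.

End Dichotomy.

(** * From Landsberg to Berwald *)

Section Berwald.
Context {R : realType} {n : nat} (M : manifold R n) (L : TM M -> R).
Variable nabla : connection_op M.
Hypothesis HL : finsler L.
Hypothesis HC : cartan_connection L nabla.
Hypothesis Hred : C_reducible L nabla.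
Notation C := (charts M).
Notation T := (tm_charts M).
Notation center u := (Defs.coord T u u).
Notation V := 'rV[R]_n.
Let HN := cartan_linear HC.
Let Hreg := cartan_regular HC.
Notation covCform := (covCform nabla).
Notation nablaT := (nablaT L nabla).

Lemma smooth_secB (S1 S2 : TM M -> V) : smooth_sec S1 -> smooth_sec S2 ->
  smooth_sec (fun w => S1 w - S2 w).
Proof.
move=> s1 s2.
have c1 : smooth_fun T (slit M) (fun=> -1) by exact: smooth_fun_cst.
have := smooth_secD s1 (smooth_secZ c1 s2).
by apply: smooth_sec_eq => w _; rewrite scaleN1r.
Qed.

(** Provides the continuity by which a nonzero value of the covariant derivative at one point
    persists nearby. *)
Lemma covT_smooth (X Y Z : TM M -> V) : smooth_sec X -> smooth_sec Y -> smooth_sec Z ->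
  smooth_sec (fun w => covT nabla w (beta nabla w (X w)) Y Z).
Proof.
move=> Xs Ys Zs; have bs := beta_smooth HN Hreg Xs.
have ns S : smooth_sec S -> smooth_sec (fun w => nabla w (beta nabla w (X w)) S).
  by move=> Ss; exact: (nabla_smooth HN bs Ss).
apply: smooth_secB; last first.
  by apply: (tensorT_smooth HL HC) Ys _; exact: ns.
apply: smooth_secB; last first.
  by apply: (tensorT_smooth HL HC) _ Zs; exact: ns.
by apply: ns; exact: (tensorT_smooth HL HC).
Qed.

Lemma formC_near0 u z X : slit M u ->
  (\forall x \near center u, forall v, Defs.formC nabla (Defs.cinv T u x) v = 0) ->
  covCform u z X = 0.
Proof.
move=> su H.
have E : \forall x \near center u, chartC nabla u X x = cst 0 x.
  by apply: filterS H => x Hx; exact: Hx.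
have E1 : 'D_z (chartC nabla u X) (center u) = 0.
  by apply: (etrans (near_eq_derive z E)); exact: derive_cst.
have E2 Y : Defs.formC nabla u Y = 0.
  have := nbhs_singleton H Y.
  by rewrite (atlasK (tm_atlas M) (atlas_center (tm_atlas M) u)).
exact: (etrans (congr2 (fun a b => a - b) E1 (E2 _)) (subrr 0)).
Qed.

Lemma landsberg_berwald : landsberg nabla -> berwald nabla.
Proof.
move=> Hl X Xs u su Y Z Ys Zs; pose S w := covT nabla w (beta nabla w (X w)) Y Z.
(* If [S u] is nonzero, then so is [S] nearby, where the dichotomy leaves only [formC = 0]; the
   covariant derivative of C at [u] then vanishes, and with it [S u]. *)
have [//|Su] := eqVneq (S u) 0.
have Ss : smooth_sec S by exact: covT_smooth.
have Sc : {for center u, continuous (sec_in S u)}.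
  exact: (Ck_at_continuous (Ss u su 0)).
have Sn : \forall z \near center u, sec_in S u z != 0.
  by apply: cvgr_neq0 Sc _; rewrite sec_in_center.
have C0 : \forall z \near center u, forall v, Defs.formC nabla (Defs.cinv T u z) v = 0.
  apply: filterS (filterI Sn (near_slit su)) => z [Sz sw].
  set w := Defs.cinv T u z in sw *.
  have Sw : S w != 0 by apply: contra_neq Sz => Sw; rewrite /sec_in -/w Sw tcoord0.
  have [H|//] : (forall a X Y Z, nablaT w (beta nabla w a) X Y Z = 0) \/
      (forall v, Defs.formC nabla w v = 0).
    (* A nearby vector has its own base point [q]; the dichotomy is applied in the chart of [q], not
       in that of [u]. *)
    by case: (w) sw => q y; exact: (fibre_landsberg HL HC Hred q Hl).
  by case/eqP: Sw; apply/(covT0P HL HC) => // W; exact: H.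
apply/(covT0P HL HC) => //; move=> W.
have Hz := (beta_spec Hreg (X u) su).1.
apply: ((nablaT_eq0P HL HC Hred su Hz).2 _ (Y u) (Z u) W) => A.
exact: formC_near0.
Qed.

End Berwald.

Theorem theorem3p6 (R : realType) (n : nat) (M : manifold R n) (L : TM M -> R)
    (nabla : connection_op M) (hL : finsler L)
    (hnabla : cartan_connection L nabla) (hC : C_reducible L nabla) :
  (berwald nabla <-> landsberg nabla) /\
  (landsberg nabla <-> general_landsberg nabla).
Proof.
split; last exact: (landsberg_general hL hnabla hC).
split; first exact: berwald_landsberg.
exact: (landsberg_berwald hL hnabla hC).
Qed.
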